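(* For every integer $t$ there exists an integer $\tau$ (depending only on $t$) such that the following holds. Let $G\in\mathcal{C}_{tt}$, let $(T,\chi)$ be a structured tree decomposition of $G$, let $v\in V(T)$, and let $Y\subseteq\chi(v)\setminus\operatorname{Hub}(G)$ be a stable set. Then $|Y|\leq 4\tau$.
   Context: Graphs are finite and simple; a path is an induced path and $P^*$ its interior. A hole is an induced cycle on at least four vertices; a theta is three internally vertex-disjoint paths between two vertices, each of length at least 2, with pairwise anticomplete interiors; a prism consists of three vertex-disjoint paths $a_i\text{-}\dots\text{-}b_i$, each of length at least 1, with $a_1a_2a_3$, $b_1b_2b_3$ triangles and no other edges between them; a wheel $(H,x)$ is a hole $H$ and a vertex $x$ with at least three neighbors in $H$, even if that number is even. $\mathcal{C}$: graphs with no induced $C_4$, theta, prism or even wheel; $\mathcal{C}_t$: those with no clique of size $t$; $\mathcal{C}_{tt}$: those in $\mathcal{C}_t$ with no induced generalized $t$-pyramid, where a generalized $k$-pyramid is a graph whose vertex set is the disjoint union of paths $P,Q,R_1,\dots,R_k$ such that $P\cup Q$ is a hole; $R_i$ has ends $a_i,b_i$; $a_i$ has exactly two neighbors $x_i,y_i$ in $P$, both in $P^*$ and adjacent; $b_i$ has exactly one neighbor $z_i$ in $Q$; $R_i\setminus\{a_i,b_i\}$ is anticomplete to $P\cup Q$; distinct $R_i$ are pairwise anticomplete; $P$ traverses $x_1,y_1,\dots,x_k,y_k$ in order; $Q$ traverses $z_1,\dots,z_k$ in order (some may coincide); $y_i\neq x_{i+1}$. A wheel $(H,x)$ is a twin wheel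 if $N(x)\cap H$ induces a path of length two, a short pyramid if $|N(x)\cap H|=3$ and $x$ has exactly two adjacent neighbors in $H$, proper otherwise; $\operatorname{Hub}(G)$ is the set of $x$ with $(H,x)$ a proper wheel for some hole $H$. A potential maximal clique (PMC) of $G$ is a maximal clique of some minimal chordal completion of $G$ (a chordal graph obtained from $G$ by adding an inclusion-wise minimal set of non-edges); a tree decomposition is structured if every bag is a PMC of $G$. *)

(* Defs.v *)
From mathcomp Require Import all_boot.
Set Implicit Arguments.
Unset Strict Implicit.
Unset Printing Implicit Defensive.

(* A graph is a relation [e : rel V] on a finite type; [simple_graph]
   makes it undirected and loopless.  A predicate taking [e] and a set [S] speaks
   about the subgraph of [e] induced by [S]. *)

Definition simple_graph (V : finType) (e : rel V) : Prop :=
  symmetric e /\ irreflexive e.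

Definition nbh (V : finType) (e : rel V) (x : V) : {set V} := [set y | e x y].

Definition clique (V : finType) (e : rel V) (K : {set V}) : bool :=
  [forall x in K, forall y in K, (x != y) ==> e x y].

Definition stable (V : finType) (e : rel V) (S : {set V}) : bool :=
  [forall x in S, forall y in S, ~~ e x y].

Definition anticomplete (V : finType) (e : rel V) (A B : {set V}) : bool :=
  [disjoint A & B] && [forall x in A, forall y in B, ~~ e x y].

(* A path is always nonempty and induced; it is given by the list of its vertices
   in traversal order, so its length is [(size p).-1]. *)
Definition induced_path (V : finType) (e : rel V) (p : seq V) : Prop :=
  [/\ 0 < size p, uniq p &
      {in p &, forall x y,
         e x y = ((index x p).+1 == index y p) || ((index y p).+1 == index x p)}].

Definition path_between (V : finType) (e : rel V) (a b : V) (p : seq V) : Prop :=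
  [/\ induced_path e p, head a p = a & last a p = b].

Definition interior (V : finType) (p : seq V) : {set V} :=
  [set x in p | (0 < index x p) && ((index x p).+1 < size p)].

Definition hole (V : finType) (e : rel V) (H : {set V}) : Prop :=
  exists c : seq V,
    [/\ H = [set x in c], 4 <= size c, uniq c &
        {in c &, forall x y, e x y = (next c x == y) || (next c y == x)}].

Definition theta (V : finType) (e : rel V) (S : {set V}) : Prop :=
  exists (a b : V) (P : 'I_3 -> seq V),
    [/\ S = \bigcup_i [set x in P i],
        forall i, path_between e a b (P i),
        forall i, 3 <= size (P i) &
        forall i j, i != j -> anticomplete e (interior (P i)) (interior (P j))].

Definition prism (V : finType) (e : rel V) (S : {set V}) : Prop :=
  exists (a b : 'I_3 -> V) (P : 'I_3 -> seq V),
    [/\ S = \bigcup_i [set x in P i],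
        forall i, path_between e (a i) (b i) (P i),
        forall i, 2 <= size (P i),
        forall i j, i != j -> [disjoint P i & P j] &
        forall i j, i != j -> forall u v, u \in P i -> v \in P j ->
          e u v = ((u == a i) && (v == a j)) || ((u == b i) && (v == b j))].

(* The centre [x] automatically lies outside [H]. *)
Definition wheel (V : finType) (e : rel V) (H : {set V}) (x : V) : Prop :=
  hole e H /\ 3 <= #|nbh e x :&: H|.

Definition even_wheel (V : finType) (e : rel V) (H : {set V}) (x : V) : Prop :=
  wheel e H x /\ ~~ odd #|nbh e x :&: H|.

Definition twin_wheel (V : finType) (e : rel V) (H : {set V}) (x : V) : Prop :=
  wheel e H x /\
  exists p : seq V,
    [/\ nbh e x :&: H = [set y in p], induced_path e p & size p = 3].

Definition short_pyramid (V : finType) (e : rel V) (H : {set V}) (x : V) : Prop :=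
  [/\ wheel e H x, #|nbh e x :&: H| = 3 &
      #|[set y in nbh e x :&: H | [exists z in nbh e x :&: H, e y z]]| = 2].

Definition proper_wheel (V : finType) (e : rel V) (H : {set V}) (x : V) : Prop :=
  [/\ wheel e H x, ~ twin_wheel e H x & ~ short_pyramid e H x].

Definition hub (V : finType) (e : rel V) (x : V) : Prop :=
  exists H : {set V}, proper_wheel e H x.

(* The paths [R i] may have length 0, in which case [a i = b i].  [P]
   and [Q] are each traversed from one of their ends, chosen independently. *)
Definition generalized_pyramid (V : finType) (e : rel V) (k : nat) (S : {set V})
  : Prop :=
  exists (P Q : seq V) (R : 'I_k -> seq V) (a b x y z : 'I_k -> V),
  let HP := [set u in P] in
  let HQ := [set u in Q] in
  let HR := fun i => [set u in R i] in
  [/\ [/\ induced_path e P, induced_path e Q,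
          forall i, path_between e (a i) (b i) (R i) &
          S = HP :|: HQ :|: \bigcup_i HR i],
      [/\ [disjoint HP & HQ],
          forall i, [disjoint HR i & HP :|: HQ] &
          forall i j, i != j -> [disjoint HR i & HR j]],
      hole e (HP :|: HQ) /\
      (forall i j, i != j -> anticomplete e (HR i) (HR j)),
      forall i,
        [/\ nbh e (a i) :&: HP = [set x i; y i],
            [/\ x i \in interior P, y i \in interior P & e (x i) (y i)],
            nbh e (b i) :&: HQ = [set z i] &
            anticomplete e (HR i :\: [set a i; b i]) (HP :|: HQ)] &
      [/\ forall i, index (x i) P < index (y i) P,
          forall i j : 'I_k, i < j -> index (y i) P <= index (x j) P,
          forall i j : 'I_k, i.+1 = j -> y i != x j &
          forall i j : 'I_k, i <= j -> index (z i) Q <= index (z j) Q]].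

Definition class_C (V : finType) (e : rel V) : Prop :=
  [/\ forall H : {set V}, hole e H -> #|H| <> 4,
      forall S : {set V}, ~ theta e S,
      forall S : {set V}, ~ prism e S &
      forall (H : {set V}) (x : V), ~ even_wheel e H x].

Definition class_Ct (t : nat) (V : finType) (e : rel V) : Prop :=
  class_C e /\ forall K : {set V}, clique e K -> #|K| <> t.

Definition class_Ctt (t : nat) (V : finType) (e : rel V) : Prop :=
  class_Ct t e /\ forall S : {set V}, ~ generalized_pyramid e t S.

Definition chordal (V : finType) (e : rel V) : Prop :=
  forall H : {set V}, ~ hole e H.

Definition chordal_completion (V : finType) (e f : rel V) : Prop :=
  [/\ simple_graph f, subrel e f & chordal f].

Definition minimal_chordal_completion (V : finType) (e f : rel V) : Prop :=
  chordal_completion e f /\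
  forall g : rel V, chordal_completion e g -> subrel g f -> subrel f g.

Definition PMC (V : finType) (e : rel V) (K : {set V}) : Prop :=
  exists f : rel V, minimal_chordal_completion e f /\ maxset (clique f) K.

Definition tree (T : finType) (f : rel T) : Prop :=
  [/\ simple_graph f, 0 < #|T|, forall s s', connect f s s' &
      forall c : seq T, 3 <= size c -> ~ ucycle f c].

Definition tree_decomposition (V : finType) (e : rel V)
    (T : finType) (f : rel T) (chi : T -> {set V}) : Prop :=
  [/\ tree f,
      forall u : V, exists s, u \in chi s,
      forall u w : V, e u w -> exists s, (u \in chi s) && (w \in chi s) &
      forall (u : V) (s s' : T), u \in chi s -> u \in chi s' ->
        connect [rel p q | [&& f p q, u \in chi p & u \in chi q]] s s'].

Definition structured (V : finType) (e : rel V)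
    (T : finType) (chi : T -> {set V}) : Prop :=
  forall s : T, PMC e (chi s).

(* Main.v *)
Require Import Defs.
From mathcomp Require Import all_boot zify boolp.
Set Implicit Arguments.
Unset Strict Implicit.
Unset Printing Implicit Defensive.

(** Let [K] be a maximal clique of a minimal chordal completion, [Y] a stable set of non-hubs
    in [K].  Two nonadjacent vertices of [K] have a common attached component of [G \ K], and
    at most two of them since there is no theta; moreover each component [D] misses
    a vertex [w] of [K], so the vertices of [Y] attached to [D] are also attached to a connected set
    anticomplete to [D], made of [w] and of other components.  If each component meets
    the neighborhoods of boundedly many elements of [Y] only, a large [Y] contains four vertices no three
    of which share a component, and these yield a theta.

    It remains to bound a stable set of non-hubs attached to two anticomplete connected sets
    [A] and [B].  Inside each side, after passing to a large subset, either all vertices are pendant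
    to a connected set, or they attach to a path in pairwise disjoint intervals.  Two path sides give a hub.
    In a minimal connected set with pendant terminals every vertex is a cut vertex, so a bounded
    clique number leaves only two shapes, a path with teeth attached at single vertices or at edges,
    and two sides of the same shape contain a theta or a prism.  Two sides of different
    shapes form a generalized pyramid. *)

(** Two anticomplete sides communicate only through the terminals, so sets reaching a terminal from
    either side can be glued there; most of the forbidden subgraphs arise this way. Claws in both
    sides glue to a theta, triangles to a prism. The obstacle is that a side may show either shape.
    Ramsey on triples of terminals makes one side free of claws, which forces a comb with teeth on
    edges of a path; the side facing it is then triangle-free, hence a tree, and contains a comb
    with teeth on vertices. The two combs supply the paths P and Q of a pyramid, the glued teeth its
    paths R_i, and two further rungs close the hole. When one side is a path, a terminal with two
    nonadjacent neighbors on it allows rerouting the path through the terminal, and the other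
    terminals already are teeth on edges; non-hubs matter here, since a hub could face a claw
    without creating a theta. The constant tau is twice the bound for one component, because a
    nonadjacent pair shares at most two components; the factor 4 exceeds the three sets of that size
    which the last of the four chosen vertices has to avoid. *)

(** * Ramsey and pigeonhole principles for sequences *)

Section Ramsey.
Variable T : eqType.
Implicit Type s : seq T.

(** [R] need not be symmetric: only pairs in the order of [s] are compared, and the extracted
    sequence keeps this order. Later uses rely on both facts. *)
Lemma ramsey2 (R : rel T) a b s :
  2 ^ (a + b) <= size s ->
  exists2 s', subseq s' s &
    (size s' = a /\ pairwise R s') \/
    (size s' = b /\ pairwise (fun x y => ~~ R x y) s').
Proof.
elim: a b s => [|a IHa] b s; first by exists [::]; [exact: sub0seq | left].
elim: b s => [|b IHb] s; first by exists [::]; [exact: sub0seq | right].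
case: s => [|x s]; first by rewrite leqNgt expn_gt0.
rewrite addSn addnS expnS mul2n -addnn /= => les.
have := count_predC (R x) s; rewrite -!size_filter => def_s.
have [lea|ltb] := leqP (2 ^ (a + b).+1) (size (filter (R x) s)).
  have [|s' ss' [[ss hom]|hom]] := IHa b.+1 (filter (R x) s).
  - by rewrite addnS.
  - exists (x :: s').
      by rewrite /= eqxx (subseq_trans ss') // filter_subseq.
    left; rewrite /= ss; split=> //; rewrite hom andbT.
    by apply/allP => y /(mem_subseq ss'); rewrite mem_filter => /andP[].
  exists s'; last by right.
  by apply: subseq_trans ss' (subseq_trans (filter_subseq _ _) (subseq_cons _ _)).
have [|s' ss' [hom|[ss hom]]] := IHb (filter (predC (R x)) s).
- by rewrite addSn; lia.
- exists s'; last by left.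
  by apply: subseq_trans ss' (subseq_trans (filter_subseq _ _) (subseq_cons _ _)).
exists (x :: s').
  by rewrite /= eqxx (subseq_trans ss') // filter_subseq.
right; rewrite /= ss; split=> //; rewrite hom andbT.
by apply/allP => y /(mem_subseq ss'); rewrite mem_filter => /andP[].
Qed.

Fixpoint triplewise (P : T -> T -> T -> bool) s :=
  if s is x :: s' then pairwise (P x) s' && triplewise P s' else true.

(** Each chosen element costs one application of [ramsey2] to the pairs of later elements, colored
    by the triples they form with it; hence the tower. *)
Fixpoint ram3 n := if n is m.+1 then (2 ^ (ram3 m + ram3 m)).+1 else 0.

Lemma ramsey3 (P : T -> T -> T -> bool) a b s :
  ram3 (a + b) <= size s ->
  exists2 s', subseq s' s &
    (size s' = a /\ triplewise P s') \/
    (size s' = b /\ triplewise (fun x y z => ~~ P x y z) s').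
Proof.
elim: a b s => [|a IHa] b s; first by exists [::]; [exact: sub0seq | left].
elim: b s => [|b IHb] s; first by exists [::]; [exact: sub0seq | right].
case: s => [|x s]; first by rewrite leqNgt.
rewrite addSn addnS [ram3 _.+1]/= => les.
have [s1 ss1] := ramsey2 (P x) (les : _ <= size s).
case=> [[sz1 hom1]|[sz1 hom1]].
  have [|s' ss' [[ss hom]|hom]] := IHa b.+1 s1.
  - by rewrite sz1 addnS.
  - exists (x :: s').
      by rewrite /= eqxx (subseq_trans ss').
    left; rewrite /= ss hom andbT; split=> //.
    exact: subseq_pairwise ss' hom1.
  exists s'; last by right.
  exact: subseq_trans ss' (subseq_trans ss1 (subseq_cons _ _)).
have [|s' ss' [hom|[ss hom]]] := IHb s1.
- by rewrite sz1 addSn.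
- exists s'; last by left.
  exact: subseq_trans ss' (subseq_trans ss1 (subseq_cons _ _)).
exists (x :: s').
  by rewrite /= eqxx (subseq_trans ss').
right; rewrite /= ss hom andbT; split=> //.
exact: subseq_pairwise ss' hom1.
Qed.

(** The two adjacent transpositions generate all orders of a triple, so the order of [s] no longer
    matters. *)
Lemma triplewise_distinct (P : T -> T -> T -> bool) s :
  (forall x y z, P x y z = P y x z) -> (forall x y z, P x y z = P x z y) ->
  uniq s -> triplewise P s ->
  forall x y z, x \in s -> y \in s -> z \in s ->
    x != y -> x != z -> y != z -> P x y z.
Proof.
move=> P12 P23; elim: s => // w s IH /= /andP[ws us] /andP[Pw Ps] x y z.
have pw u v : u \in s -> v \in s -> u != v -> P w u v.
  elim: (s) Pw us => // a s' IH' /= /andP[/allP Pa Ps'] /andP[as' us'].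
  rewrite !inE => /predU1P[->|us1] /predU1P[->|vs1]; rewrite ?eqxx // => uv.
  - exact: Pa.
  - by rewrite P23; apply: Pa.
  exact: IH'.
rewrite !inE => /predU1P[->|xs] /predU1P[->|ys] /predU1P[->|zs];
  rewrite ?eqxx // => xy xz yz.
- exact: pw.
- by rewrite P12; apply: pw.
- by rewrite P23 P12; apply: pw.
exact: IH.
Qed.

Lemma pigeonhole_fun (S : eqType) (f : T -> S) (ss : seq S) n s :
  (forall x, x \in s -> f x \in ss) -> size ss * n < size s ->
  exists2 c, c \in ss & n < count (fun x => f x == c) s.
Proof.
elim: ss s => [|c ss IH] s fs; first by case: s fs => // x s /(_ x (mem_head _ _)).
rewrite /= mulSn => lts.
have [ltc|lec] := ltnP n (count (fun x => f x == c) s).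
  by exists c; rewrite ?mem_head.
have := count_predC (fun x => f x == c) s.
rewrite -[in X in _ + X]size_filter => def_s.
have [||d dss ltd] := IH (filter (predC (fun x => f x == c)) s).
- by move=> x; rewrite mem_filter /= => /andP[ne /fs]; rewrite inE (negPf ne).
- by lia.
exists d; first by rewrite inE dss orbT.
apply: leq_trans ltd _; rewrite count_filter; apply: sub_count => x /= /andP[] //.
Qed.

End Ramsey.

(** * Connected sets, components and attachments *)

Section Connected.
Variables (V : finType) (e : rel V).
Hypotheses (gsym : symmetric e) (girr : irreflexive e).
Implicit Types (S T A B C : {set V}) (x y z u v : V).

Definition induced S : rel V := [rel x y | [&& e x y, x \in S & y \in S]].
Definition conn S :=
  forall x y, x \in S -> y \in S -> connect (induced S) x y.
(** For [x] outside [S] this is just [[set x]]. *)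
Definition component S x := [set y | connect (induced S) x y].
Definition touch S x := [exists y in S, e x y].

Lemma touchP S x : reflect (exists2 y, y \in S & e x y) (touch S x).
Proof. exact: exists_inP. Qed.

Lemma touchS S T x : S \subset T -> touch S x -> touch T x.
Proof. by move=> /subsetP sST /touchP[y /sST yT xy]; apply/touchP; exists y. Qed.

Lemma touchU S T x : touch (S :|: T) x = touch S x || touch T x.
Proof.
apply/touchP/orP => [[y]|].
  by rewrite inE => /orP[yS|yT] xy; [left | right]; apply/touchP; exists y.
by case=> /touchP[y yS xy]; exists y; rewrite // inE yS ?orbT.
Qed.

Lemma touch1 x y : touch [set x] y = e y x.
Proof.
by apply/touchP/idP => [[z /set1P->]//|xy]; exists x; rewrite ?set11.
Qed.

Lemma anticompleteP A B :
  reflect (forall x y, x \in A -> y \in B -> x != y /\ e x y = false)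
          (anticomplete e A B).
Proof.
apply: (iffP andP) => [[dAB /forall_inP nAB] x y xA yB|nAB].
  split; last by apply/negbTE; move/forall_inP: (nAB x xA); apply.
  by apply: contraTneq yB => <-; rewrite (disjointFr dAB).
split; last first.
  by apply/forall_inP => x xA; apply/forall_inP => y yB; rewrite (nAB x y xA yB).2.
rewrite disjoint_subset; apply/subsetP => x xA; rewrite inE.
by apply/negP => xB; have [] := nAB x x xA xB; rewrite eqxx.
Qed.

Lemma anticomplete_sym A B : anticomplete e A B = anticomplete e B A.
Proof.
by apply/anticompleteP/anticompleteP => h x y xA yB;
  have [] := h y x yB xA; rewrite eq_sym gsym.
Qed.

Lemma anticompleteS A B A' B' : A' \subset A -> B' \subset B ->
  anticomplete e A B -> anticomplete e A' B'.
Proof.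
move=> /subsetP sA /subsetP sB /anticompleteP h; apply/anticompleteP => x y xA yB.
by apply: h; [apply: sA | apply: sB].
Qed.

Lemma anticompleteUl A A' B :
  anticomplete e (A :|: A') B = anticomplete e A B && anticomplete e A' B.
Proof.
apply/idP/andP => [h|[/anticompleteP h /anticompleteP h']].
  by split; apply: anticompleteS h; rewrite // ?subsetUl ?subsetUr.
by apply/anticompleteP => x y; rewrite inE => /orP[]; [apply: h | apply: h'].
Qed.

Lemma anticompleteUr A B B' :
  anticomplete e A (B :|: B') = anticomplete e A B && anticomplete e A B'.
Proof.
by rewrite anticomplete_sym anticompleteUl !(anticomplete_sym A).
Qed.

Lemma connect_mono S T x y : S \subset T ->
  connect (induced S) x y -> connect (induced T) x y.
Proof.
move=> /subsetP sST; apply: connect_sub => u v /= /and3P[uv uS vS].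
by apply: connect1; rewrite /induced /= uv !sST.
Qed.

Lemma induced_sym S : symmetric (induced S).
Proof. by move=> x y; rewrite /induced /= gsym [(x \in S) && _]andbC. Qed.

Lemma connectC S x y : connect (induced S) x y = connect (induced S) y x.
Proof. exact: (sym_connect_sym (induced_sym S)). Qed.

Lemma connect_ind (R : rel V) (P : V -> Prop) x y :
  connect R x y -> P x -> (forall u v, P u -> R u v -> P v) -> P y.
Proof.
move=> /connectP[p pth ->] Px step; elim: p x pth Px => //= z p IH x.
by case/andP=> xz pth Px; apply: IH pth (step _ _ Px xz).
Qed.

Lemma conn_closed S T x : conn S -> x \in T -> x \in S ->
  (forall u v, u \in T -> u \in S -> v \in S -> e u v -> v \in T) ->
  S \subset T.
Proof.
move=> cS xT xS cl; apply/subsetP => y yS.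
have [] // : y \in T /\ y \in S.
apply: (@connect_ind _ (fun v => v \in T /\ v \in S) _ _ (cS x y xS yS)) => // u v [uT uS] /= /and3P[uv _ vS].
by split=> //; apply: cl uv.
Qed.

Lemma conn_leave S T x y : conn S -> x \in T -> x \in S -> y \in S -> y \notin T ->
  exists u v, [/\ u \in T, u \in S, v \in S, v \notin T & e u v].
Proof.
move=> cS xT xS yS yT; apply: contrapT => no.
have /subsetP/(_ y yS) : S \subset T; last by rewrite (negPf yT).
apply: conn_closed xT xS _ => // u v uT uS vS uv; apply: contrapT => /negP vT.
by apply: no; exists u, v.
Qed.

Lemma component_self S x : x \in component S x.
Proof. by rewrite inE connect0. Qed.

Lemma component_sub S x : x \in S -> component S x \subset S.
Proof.
move=> xS; apply/subsetP => y; rewrite inE => xy.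
by apply: (@connect_ind _ (fun v => v \in S) _ _ xy) => // u v _ /and3P[].
Qed.

Lemma component_closed S x u v : x \in S -> u \in component S x -> v \in S -> e u v ->
  v \in component S x.
Proof.
move=> xS ux vS uv; have uS := subsetP (component_sub xS) u ux.
rewrite !inE in ux *; apply: connect_trans ux (connect1 _).
by rewrite /induced /= uv uS vS.
Qed.

Lemma conn_root S r : r \in S ->
  (forall x, x \in S -> connect (induced S) r x) -> conn S.
Proof.
move=> rS h x y xS yS; apply: (connect_trans (y := r)); last exact: h.
by rewrite connectC h.
Qed.

Lemma component_conn S x : x \in S -> conn (component S x).
Proof.
move=> xS; apply: (@conn_root _ x); first exact: component_self.
move=> y; rewrite inE => xy.
suff [] : y \in component S x /\ connect (induced (component S x)) x y by [].
apply: (@connect_ind _ (fun v => v \in component S x /\ connect (induced (component S x)) x v) _ _ xy).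
  by rewrite component_self connect0.
move=> u v [ux xu] /= /and3P[uv uS vS].
have vx := component_closed xS ux vS uv; split=> //.
by apply: connect_trans xu (connect1 _); rewrite /induced /= uv ux.
Qed.

Lemma component_eq S x y : y \in component S x -> component S y = component S x.
Proof.
rewrite inE => xy; apply/setP => z; rewrite !inE.
by apply/idP/idP; apply: connect_trans; rewrite // connectC.
Qed.

Lemma conn1 x : conn [set x].
Proof. by move=> y z /set1P-> /set1P->; apply: connect0. Qed.

Lemma connU A B x y : conn A -> conn B -> x \in A -> y \in B ->
  x = y \/ e x y -> conn (A :|: B).
Proof.
move=> cA cB xA yB xy; apply: (@conn_root _ x); first by rewrite inE xA.
have xyc : connect (induced (A :|: B)) x y.
  case: xy => [->|xy]; first exact: connect0.
  by apply: connect1; rewrite /induced /= xy !inE xA yB orbT.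
move=> z; rewrite inE => /orP[zA|zB].
  exact: connect_mono (subsetUl _ _) (cA _ _ xA zA).
exact: connect_trans xyc (connect_mono (subsetUr _ _) (cB _ _ yB zB)).
Qed.

Lemma connU_touch A B x : conn A -> conn B -> x \in A -> touch B x ->
  conn (A :|: B).
Proof. by move=> cA cB xA /touchP[y yB xy]; apply: connU xA yB (or_intror xy). Qed.

Lemma connU1 A x : conn A -> touch A x -> conn (x |: A).
Proof. by move=> cA; apply: connU_touch (set11 x); last exact: cA; apply: conn1. Qed.

Lemma conn_bigcup (I : finType) (P : pred I) (F : I -> {set V}) r :
  (forall i, P i -> conn (F i)) -> (forall i, P i -> r \in F i) ->
  conn (\bigcup_(i | P i) F i).
Proof.
move=> cF rF x y /bigcupP[i Pi xi] /bigcupP[j Pj yj].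
apply: (connect_trans (y := r)).
  by apply: connect_mono (cF i Pi x r xi (rF i Pi)); apply: bigcup_sup.
by apply: connect_mono (cF j Pj r y (rF j Pj) yj); apply: bigcup_sup.
Qed.

(** A component of [S :\: T], together with the vertices of [T] touching it, is closed under
    adjacency in [S]: a vertex of [T] has a single neighbor in [S] and cannot lead elsewhere. *)
Lemma conn_setD_leaves S T :
  conn S -> (forall u, u \in S -> u \in T -> touch (S :\: T) u) ->
  (forall u v w, u \in S -> u \in T -> v \in S -> w \in S ->
     e u v -> e u w -> v = w) ->
  conn (S :\: T).
Proof.
move=> cS att leaf x y /setDP[xS xT] /setDP[yS yT].
have xST : x \in S :\: T by rewrite inE xT.
set C := component (S :\: T) x.
suff /subsetP/(_ y yS) : S \subset C :|: T by rewrite !inE (negPf yT) orbF.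
have := @conn_closed S (C :|: [set u in S :&: T | touch C u]) x cS.
rewrite !inE connect0 => /(_ isT xS) sub.
have {}sub : S \subset C :|: [set u in S :&: T | touch C u].
  apply: sub => u v; rewrite 2!inE => /orP[uC|].
    move=> uS vS uv; have [vT|vT] := boolP (v \in T).
      rewrite in_setU in_set in_setI vS vT /=; apply/orP; right.
      by apply/touchP; exists u; rewrite // gsym.
    rewrite in_setU; apply/orP; left; apply: component_closed uv => //.
    by rewrite inE vT.
  rewrite inE => /andP[/andP[uS uT] /touchP[w wC uw]] _ vS uv.
  suff -> : v = w by rewrite in_setU wC.
  by apply: leaf uv uw => //; have /setDP[] := subsetP (component_sub xST) w wC.
apply: subset_trans sub _; apply/subsetP => u; rewrite !inE.
by case/orP=> [->//|/andP[/andP[_ ->]]]; rewrite orbT.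
Qed.

End Connected.

(** * Segments and positions in sequences *)

Lemma split_last_has (T : Type) (P : pred T) (s : seq T) : has P s ->
  exists s1 x s2, [/\ s = s1 ++ x :: s2, P x & ~~ has P s2].
Proof.
elim: s => //= a s IH.
have [/IH[s1 [x [s2 [-> Px ns2]]]] _|ns] := boolP (has P s).
  by exists (a :: s1), x, s2.
by rewrite orbF => Pa; exists [::], a, s.
Qed.

Definition seg (T : Type) (p : seq T) i j := drop i (take j p).

Section Seg.
Variable T : eqType.
Implicit Types (p : seq T) (w x : T).

Lemma size_seg p i j : j <= size p -> size (seg p i j) = j - i.
Proof. by move=> jp; rewrite size_drop size_takel. Qed.

Lemma in_drop p i w : uniq p -> (w \in drop i p) = (w \in p) && (i <= index w p).
Proof.
move=> up; have [wp|wp] /= := boolP (w \in p); last first.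
  by apply/negbTE; apply: contra wp => /mem_drop.
rewrite leqNgt -in_take //; move: up wp; rewrite -{1 2}(cat_take_drop i p).
rewrite cat_uniq mem_cat => /and3P[_ /hasPn dis _].
have [wd|wd] := boolP (w \in drop i p); last by rewrite orbF => ->.
by move/dis: wd => /= ->.
Qed.

Lemma index_take p j w : w \in take j p -> index w (take j p) = index w p.
Proof. by move=> wt; rewrite -{2}(cat_take_drop j p) index_cat wt. Qed.

Lemma index_drop p i w : uniq p -> w \in drop i p ->
  index w (drop i p) = index w p - i.
Proof.
move=> up wd; have := wd; rewrite in_drop // => /andP[wp iw].
have wt : w \notin take i p by rewrite in_take // -leqNgt.
rewrite -{2}(cat_take_drop i p) index_cat (negPf wt) size_takel ?addKn //.
by apply: leq_trans iw (ltnW _); rewrite index_mem.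
Qed.

Lemma mem_seg p i j w : uniq p ->
  (w \in seg p i j) = (w \in p) && (i <= index w p < j).
Proof.
move=> up; rewrite in_drop ?take_uniq //.
have [wt|wt] /= := boolP (w \in take j p).
  by rewrite (index_take wt) (index_ltn wt) (mem_take wt) andbT.
by apply/esym/and3P => -[wp _]; rewrite -in_take ?(negPf wt).
Qed.

Lemma index_seg p i j w : uniq p -> w \in seg p i j ->
  index w (seg p i j) = index w p - i.
Proof.
move=> up ws; rewrite index_drop ?take_uniq // index_take //.
exact: mem_drop ws.
Qed.

Lemma seg_uniq p i j : uniq p -> uniq (seg p i j).
Proof. by move=> up; rewrite drop_uniq ?take_uniq. Qed.

Lemma index_inj_in p x y : x \in p -> y \in p ->
  (index x p == index y p) = (x == y).
Proof.
move=> xp yp; apply/eqP/eqP => [xy|-> //].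
by have := nth_index x xp; rewrite xy nth_index.
Qed.

Lemma index_cons_in p x y : x \notin p -> y \in p ->
  index y (x :: p) = (index y p).+1.
Proof. by move=> xp yp /=; case: eqP => // xy; rewrite xy yp in xp. Qed.

Lemma index_head x p : index x (x :: p) = 0.
Proof. by rewrite /= eqxx. Qed.

Lemma index_eq0 x y p : (index y (x :: p) == 0) = (y == x).
Proof. by rewrite /= [x == y]eq_sym; case: (y == x). Qed.

Lemma index_last_eq x y p : uniq (x :: p) ->
  y \in x :: p -> ((index y (x :: p)).+1 == size (x :: p)) = (y == last x p).
Proof.
move=> up yp; rewrite -[size (x :: p)]/(size p).+1 eqSS -[size p](index_last up).
rewrite index_inj_in //.
exact: mem_last.
Qed.

End Seg.

(** * Induced paths *)

Section Paths.
Variables (V : finType) (e : rel V).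
Hypotheses (gsym : symmetric e) (girr : irreflexive e).
Implicit Types (S T A B : {set V}) (x y z u v : V) (s p q : seq V).

(** Recursive Boolean counterpart of [induced_path]. It also accepts the empty list, so it is
    inherited by all segments. *)
Fixpoint ip p : bool :=
  if p is x :: s then
    [&& x \notin s,
        if s is y :: s' then e x y && all (fun z => ~~ e x z) s' else true & ip s]
  else true.

Lemma ip_uniq p : ip p -> uniq p.
Proof. by elim: p => //= x s IH /and3P[-> _ /IH]. Qed.

Lemma ip_consP x s : reflect
  [/\ x \notin s, ip s & forall w, w \in s -> e x w = (index w s == 0)]
  (ip (x :: s)).
Proof.
apply: (iffP and3P) => [[xs hs ips]|[xs ips hs]]; split=> //.
  case: s {xs ips} hs => // y s /andP[xy /allP hs] w; rewrite inE index_eq0.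
  by case: eqP => [->|_] //= /hs/negbTE.
case: s xs ips hs => // y s xs /ip_uniq /= /andP[ys us] hs.
rewrite hs ?mem_head // index_eq0 eqxx; apply/allP => z zs.
by rewrite hs ?inE ?zs ?orbT // index_eq0; apply: contraNneq ys => <-.
Qed.

Lemma ip_index p x y : ip p -> x \in p -> y \in p ->
  e x y = ((index x p).+1 == index y p) || ((index y p).+1 == index x p).
Proof.
elim: p => // a p IH /ip_consP[ap ipp hap]; rewrite !inE.
case/predU1P=> [->|xp] /predU1P[->|yp].
- by rewrite girr index_head.
- by rewrite hap // index_head index_cons_in // orbF eqSS eq_sym.
- by rewrite gsym hap // index_head index_cons_in //= eqSS eq_sym.
by rewrite !index_cons_in // !eqSS; apply: IH.
Qed.

Lemma ip_induced_path p : ip p -> p != [::] -> induced_path e p.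
Proof.
move=> ipp pn; split; first by rewrite lt0n size_eq0.
  exact: ip_uniq.
by move=> x y; apply: ip_index.
Qed.

Lemma induced_path_ip p : induced_path e p -> ip p.
Proof.
case=> _ up; elim: p up => // a p IH up hp; have /= /andP[ap up'] := up.
apply/ip_consP; split=> // [|w wp].
  apply: IH => // x y xp yp; rewrite (hp x y) ?inE ?xp ?yp ?orbT //.
  by rewrite !index_cons_in // !eqSS.
rewrite (hp a w) ?inE ?wp ?eqxx ?orbT //.
by rewrite index_head index_cons_in // orbF eqSS eq_sym.
Qed.

Lemma ip_cat a s b s' :
  ip (a :: s) -> ip (b :: s') ->
  (forall u v, u \in a :: s -> v \in b :: s' ->
     u != v /\ e u v = (u == last a s) && (v == b)) ->
  ip ((a :: s) ++ b :: s').
Proof.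
move=> ips ips'; elim: s a ips => [|c s IH] a ips he.
  rewrite cat1s; apply/ip_consP; split=> //.
    by apply/negP => /(he a a (mem_head _ _))[]; rewrite eqxx.
  by move=> w /(he a w (mem_head _ _))[_ ->]; rewrite /= eqxx index_eq0.
rewrite cat_cons; case/ip_consP: ips => acs ipcs hcs; apply/ip_consP; split.
- rewrite mem_cat negb_or acs; apply/negP => /(he a a (mem_head _ _))[].
  by rewrite eqxx.
- by apply: IH => // u v us vs; apply: he; rewrite // inE us orbT.
move=> w; rewrite mem_cat => /orP[ws|ws].
  by rewrite hcs // index_cat ws.
have [_ ->] := he a w (mem_head _ _) ws.
have wcs : w \notin c :: s.
  apply/negP => wcs; have [] := he w w _ ws; first by rewrite inE wcs orbT.
  by rewrite eqxx.
rewrite index_cat (negPf wcs) /=; apply/andP => -[/eqP al _].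
by move: acs; rewrite al mem_last.
Qed.

Lemma ip_catr s s' : ip (s ++ s') -> ip s'.
Proof. by elim: s => //= a s IH /and3P[_ _ /IH]. Qed.

Lemma ip_catl s s' : ip (s ++ s') -> ip s.
Proof.
elim: s => //= a s IH /and3P[]; rewrite mem_cat negb_or => /andP[-> _].
by case: s IH => // b s IH /=; rewrite all_cat => /and3P[-> -> _] /IH.
Qed.

Lemma ip_cat_edge a s b s' u v : ip ((a :: s) ++ b :: s') ->
  u \in a :: s -> v \in b :: s' -> u != v /\ e u v = (u == last a s) && (v == b).
Proof.
move=> ipc ua vb; have us : u \in (a :: s) ++ b :: s' by rewrite mem_cat ua.
have vs : v \in (a :: s) ++ b :: s' by rewrite mem_cat vb orbT.
have := ip_uniq ipc; rewrite cat_uniq => /and3P[uas /hasPn dis ubs].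
have nv := dis v vb; split; first by apply: contraNneq nv => <-.
rewrite (ip_index ipc us vs) !index_cat ua (negPf nv).
have lt : index u (a :: s) < size (a :: s) by rewrite index_mem.
rewrite -(index_last_eq uas ua) -(index_eq0 b v s').
move: (index u _) (size _) (index v _) lt => i n j lt.
apply/orP/andP => [[]/eqP h|[/eqP h /eqP h']]; [split; apply/eqP; lia | lia |].
by left; apply/eqP; lia.
Qed.

Lemma ip_take i p : ip p -> ip (take i p).
Proof. by rewrite -{1}(cat_take_drop i p) => /ip_catl. Qed.

Lemma ip_drop i p : ip p -> ip (drop i p).
Proof. by rewrite -{1}(cat_take_drop i p) => /ip_catr. Qed.

Lemma ip_seg p i j : ip p -> ip (seg p i j).
Proof. by move=> ipp; apply/ip_drop/ip_take. Qed.

Lemma ip_rev p : ip p -> ip (rev p).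
Proof.
elim: p => // a [|b p] IH //; move/ip_consP=> [abp ipb hab].
rewrite rev_cons -cats1; case def_r: (rev (b :: p)) => [|c r].
  by move/(congr1 size): def_r; rewrite size_rev.
have lr : last c r = b.
  by rewrite -[LHS](last_cons c) -def_r rev_cons last_rcons.
apply: ip_cat => //; first by rewrite -def_r IH.
move=> u v uc; rewrite inE => /eqP->; rewrite eqxx andbT lr.
have ub : u \in b :: p by rewrite -mem_rev def_r.
split; first by apply: contraNneq abp => <-.
by rewrite gsym hab // index_eq0.
Qed.

Lemma ip_conn p : ip p -> conn e [set x in p].
Proof.
case: p => [|a p]; first by move=> _ x y; rewrite inE.
elim: p a => [|b p IH] a /ip_consP[abp ipb hab].
  by move=> x y; rewrite !inE => /eqP-> /eqP->; apply: connect0.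
have -> : [set x in a :: b :: p] = a |: [set x in b :: p].
  by apply/setP => x; rewrite !inE.
apply: connU1 => //; first exact: IH.
apply/touchP; exists b; first by rewrite inE mem_head.
by rewrite hab ?mem_head // index_head.
Qed.

Lemma connect_ip S x y : x \in S -> connect (induced e S) x y ->
  exists s, [/\ ip (x :: s), last x s = y & {subset x :: s <= S}].
Proof.
move=> xS /connectP[p pth ->] {y}.
elim: p x xS pth => [|z p IH] x xS /=.
  by exists [::]; split=> // w; rewrite inE => /eqP->.
case/andP=> /and3P[xz _ zS] /(IH z zS)[s [ips <- sS]].
have [xs|xs] := boolP (x \in z :: s).
  have [s1 [s2 def_s]] : exists s1 s2, z :: s = s1 ++ x :: s2.
    by case/splitPr: xs => s1 s2; exists s1, s2.
  exists s2; split; first by move: ips; rewrite def_s => /ip_catr.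
    by rewrite -[RHS](last_cons x) def_s last_cat.
  by move=> w ws; apply: sS; rewrite def_s mem_cat ws orbT.
(* Jumping from [x] directly to its last neighbor on the induced path leaves no chord at [x]. *)
have /split_last_has[s1 [w [s2 [def_s xw ns2]]]] : has (e x) (z :: s).
  by rewrite /= xz.
exists (w :: s2); split.
- apply/ip_consP; split.
  + by apply: contra xs; rewrite def_s mem_cat => ->; rewrite orbT.
  + by move: ips; rewrite def_s => /ip_catr.
  move=> v; rewrite inE index_eq0 => /predU1P[->|vs]; first by rewrite eqxx.
  rewrite (negPf (hasPn ns2 v vs)); symmetry; apply/negbTE/eqP => vw.
  move: ips; rewrite def_s => /ip_catr/ip_uniq /=.
  by rewrite -vw vs.
- by rewrite -[RHS](last_cons x) def_s last_cat.
move=> v; rewrite inE => /predU1P[->//|vs].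
by apply: sS; rewrite def_s mem_cat vs orbT.
Qed.

Lemma conn_ip S x y : conn e S -> x \in S -> y \in S ->
  exists s, [/\ ip (x :: s), last x s = y & {subset x :: s <= S}].
Proof. by move=> cS xS yS; apply: connect_ip (cS x y xS yS). Qed.

Lemma conn_ip_touch S a b : conn e S -> a != b -> ~~ e a b ->
  touch e S a -> touch e S b ->
  exists s, [/\ ip (a :: rcons s b), s != [::] & {subset s <= S}].
Proof.
move=> cS ab nab ta tb.
have cT : conn e (b |: (a |: S)).
  apply: connU1 => //; first exact: connU1.
  by apply: touchS tb; apply: subsetUr.
have [||s [ips ls sT]] := conn_ip (x := a) (y := b) cT; rewrite ?inE ?eqxx ?orbT //.
case: (lastP s) ls ips sT => [ls|s' c]; first by move: ab; rewrite -ls eqxx.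
rewrite last_rcons => -> ips sT; exists s'; split=> //.
  by case: (s') ips => //=; rewrite (negPf nab) /= andbF.
move=> w ws; have := ip_uniq ips; rewrite /= rcons_uniq mem_rcons => /and3P[].
rewrite inE negb_or => /andP[_ as'] bs' _.
have := sT w; rewrite !inE mem_rcons inE ws !orbT => /(_ isT).
by case/or3P=> [/eqP wb|/eqP wa|//]; move: ws; rewrite ?wb ?wa ?(negPf bs') ?(negPf as').
Qed.

Lemma interior_ends a s b : uniq (a :: rcons s b) ->
  interior (a :: rcons s b) = [set x in s].
Proof.
rewrite /= rcons_uniq mem_rcons inE negb_or -andbA => /and4P[ab nas bs _].
apply/setP => w; rewrite !in_set -cats1 -cat_cons mem_cat index_cat size_cat.
have [ws|ws] := boolP (w \in s).
  by rewrite inE ws orbT index_cons_in //= addn1 !ltnS index_mem.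
rewrite inE (negPf ws) orbF; case: (eqVneq w a) => [->|_] /=.
  by rewrite eqxx.
by rewrite inE; case: eqP => //= ->; rewrite eqxx addn0 addn1 ltnn.
Qed.

End Paths.

(** * Construction of holes, thetas, prisms and hubs *)

Section NextCons.
Variables (T : eqType) (x : T) (s : seq T).
Hypothesis us : uniq (x :: s).

Lemma next_cons u : u \in s -> next (x :: s) u = nth x s (index u s).+1.
Proof. by have /andP[xs _] := us; move=> up; rewrite next_nth inE up orbT index_cons_in. Qed.

Lemma next_cons_eq u v : u \in s -> v \in s ->
  (next (x :: s) u == v) = ((index u s).+1 == index v s).
Proof.
have /andP[xs us'] := us; move=> up vp; rewrite next_cons //.
have [lt|ge] := ltnP (index u s).+1 (size s).
  by rewrite -{1}(nth_index x vp) nth_uniq // index_mem.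
rewrite nth_default //; apply/eqP/eqP => [xv|h]; first by rewrite xv vp in xs.
by move: ge; rewrite h leqNgt index_mem vp.
Qed.

End NextCons.

Section Configurations.
Variables (V : finType) (e : rel V).
Hypotheses (gsym : symmetric e) (girr : irreflexive e).
Implicit Types (S T A B H : {set V}) (x y z u v : V) (s p q : seq V).

Lemma hole_cons x s : 3 <= size s -> x \notin s -> ip e s ->
  (forall w, w \in s -> e x w = (w == head x s) || (w == last x s)) ->
  hole e [set z in x :: s].
Proof.
move=> szs xs ips hx; exists (x :: s); split=> //; first by rewrite /= xs (ip_uniq ips).
case: s szs xs ips hx => // a s szs xs ips hx.
have us := ip_uniq ips; set p := a :: s in szs xs ips hx us *.
have nextx : next (x :: p) x = a by rewrite /= eqxx.
have uxp : uniq (x :: p) by rewrite /= xs.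
have next_x u : u \in p -> (next (x :: p) u == x) = (u == last x p).
  move=> up; rewrite next_cons // -(index_last_eq us up).
  have [lt|ge] := ltnP (index u p).+1 (size p).
    rewrite [RHS]ltn_eqF //; apply/negbTE; apply: contraNneq xs => <-.
    exact: mem_nth.
  by rewrite nth_default // eqxx; apply/esym; rewrite eqn_leq ge index_mem up.
move=> u v; rewrite !inE => /predU1P[->|up] /predU1P[->|vp].
- rewrite girr nextx; apply/esym/negbTE; rewrite orbb.
  by apply: contraNneq xs => <-; rewrite mem_head.
- by rewrite hx // next_x // nextx eq_sym.
- by rewrite gsym hx // next_x // nextx eq_sym orbC.
by rewrite (ip_index gsym girr ips up vp) !next_cons_eq.
Qed.

(** The two paths run in parallel, with heads joined and last vertices joined, so the second is
    reversed to obtain a cyclic list. Only the second may be a single vertex. *)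
Lemma hole_cat a s b s' : ip e (a :: s) -> ip e (b :: s') ->
  4 <= size (a :: s) + size (b :: s') -> 0 < size s ->
  (forall u v, u \in a :: s -> v \in b :: s' -> u != v /\
     e u v = (u == a) && (v == b) || (u == last a s) && (v == last b s')) ->
  hole e ([set x in a :: s] :|: [set x in b :: s']).
Proof.
move=> ips ips' sz s0 he.
case: s s0 ips sz he => // c s _ ips sz he.
case def_r: (rev (b :: s')) => [|d r]; first by move/(congr1 size): def_r; rewrite size_rev.
have mem_r v : (v \in d :: r) = (v \in b :: s') by rewrite -def_r mem_rev.
have hd : d = last b s'.
  by move: def_r; rewrite lastI rev_rcons => -[].
have hl : last d r = b by rewrite -[LHS](last_cons d) -def_r rev_cons last_rcons.
have /ip_consP[acs ipcs hac] := ips.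
have nbl : (a == last c s) = false.
  by apply: contraNF acs => /eqP->; apply: mem_last.
have ipc : ip e ((c :: s) ++ d :: r).
  apply: ip_cat => //; first by rewrite -def_r; apply: (ip_rev gsym).
  move=> u v us; rewrite mem_r => vs.
  have [|-> ->] := he u v _ vs; first by rewrite inE us orbT.
  split=> //; rewrite hd.
  suff -> : (u == a) = false by [].
  by apply: contraNF acs => /eqP<-.
have -> : [set x in a :: c :: s] :|: [set x in b :: s'] =
          [set x in a :: ((c :: s) ++ d :: r)].
  by apply/setP => x; rewrite 4!in_set !(in_cons a) mem_cat mem_r orbA.
apply: hole_cons => //.
- move/(congr1 size): def_r; rewrite size_rev size_cat => <-.
  by move: sz => /=; lia.
- rewrite mem_cat negb_or acs mem_r; apply/negP => /(he a a (mem_head _ _))[].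
  by rewrite eqxx.
move=> w; rewrite mem_cat last_cat mem_r => /orP[ws|ws].
  rewrite hac // index_eq0 /= hl; case: eqP => //= _.
  apply/esym/negbTE/eqP => wb; have [] := he w b _ (mem_head _ _).
    by rewrite inE ws orbT.
  by rewrite wb eqxx.
have [_ ->] := he a w (mem_head _ _) ws.
rewrite /= hl eqxx nbl /= orbF; case: eqP => //= _; rewrite ?orbT //.
rewrite orbF; apply/esym/negbTE/eqP => wc; have [] := he c w _ ws.
  by rewrite !inE eqxx orbT.
by rewrite wc eqxx.
Qed.

Lemma hole_close S a s b : conn e S -> s != [::] -> ip e (a :: rcons s b) ->
  touch e S a -> touch e S b ->
  (forall u v, u \in a :: rcons s b -> v \in S -> u != v) ->
  (forall u v, u \in s -> v \in S -> e u v = false) ->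
  exists H, [/\ hole e H, {subset a :: rcons s b <= H} &
                forall v, v \in H -> v \in a :: rcons s b \/ v \in S].
Proof.
move=> cS sn ips ta tb dis anti.
have us := ip_uniq ips.
have bs : b \in rcons s b by rewrite mem_rcons mem_head.
have ab : a != b.
  by have /= /andP[nas _] := us; apply: contraNneq nas => ->.
have nab : ~~ e a b.
  have /ip_consP[_ _ ->] := ips => //.
  case: (s) sn us => // c s' _ /=; rewrite mem_rcons inE => /and3P[_ /norP[cb _] _].
  by rewrite (negPf cb).
have [r [ipr rn rS]] := conn_ip_touch gsym cS ab nab ta tb.
case: r rn ipr rS => // c r _ ipr rS.
have ipcb : ip e ((c :: r) ++ [:: b]).
  by case/ip_consP: ipr => _; rewrite -cats1.
exists ([set x in a :: rcons s b] :|: [set x in c :: r]); split.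
- apply: hole_cat => //.
  + exact: ip_catl ipcb.
  + by case: (s) sn => //= d s' _; rewrite size_rcons; lia.
  + by rewrite size_rcons.
  move=> u v us1 vr; have vS := rS v vr; split; first exact: dis.
  have ur := ip_uniq ipr.
  have acr : a \notin c :: r.
    by apply/negP => /rS/(dis a a (mem_head _ _)); rewrite eqxx.
  have ea : e a v = (v == c).
    have /ip_consP[_ _ ->] := ipr; last by rewrite mem_rcons inE vr orbT.
    by rewrite -[rcons _ _]/(c :: rcons r b) index_eq0.
  have eb : e b v = (v == last c r).
    have [_] := ip_cat_edge gsym girr (v := b) ipcb vr (mem_head _ _).
    by rewrite eqxx andbT gsym.
  rewrite last_rcons.
  move: us1; rewrite inE mem_rcons inE => /or3P[/eqP->|/eqP->|us1].
  + by rewrite ea eqxx (negPf ab) orbF.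
  + by rewrite eb eqxx [b == a]eq_sym (negPf ab).
  rewrite (anti u v) //; move: us; rewrite /= rcons_uniq mem_rcons inE negb_or.
  case/and3P => /andP[_ as_] bs_ _.
  have -> : (u == a) = false by apply: contraNF as_ => /eqP<-.
  by have -> : (u == b) = false by apply: contraNF bs_ => /eqP<-.
- by move=> x xs; rewrite inE [x \in _]inE xs.
by move=> v; rewrite inE => /orP[]; rewrite inE => h; [left | right; apply: rS].
Qed.

Lemma hole_two_arcs a b S1 S2 : conn e S1 -> conn e S2 -> a != b -> ~~ e a b ->
  a \notin S1 -> b \notin S1 -> a \notin S2 -> b \notin S2 ->
  touch e S1 a -> touch e S1 b -> touch e S2 a -> touch e S2 b ->
  anticomplete e S1 S2 -> exists H, hole e H.
Proof.
move=> c1 c2 ab nab a1 b1 a2 b2 ta1 tb1 ta2 tb2 /anticompleteP anti.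
have [s [ips sn sS]] := conn_ip_touch gsym c1 ab nab ta1 tb1.
have [||H [hH _ _]] := hole_close c2 sn ips ta2 tb2; last by exists H.
- move=> u v; rewrite inE mem_rcons inE => /or3P[/eqP->|/eqP->|/sS uS] vS.
  + by apply: contraNneq a2 => ->.
  + by apply: contraNneq b2 => ->.
  by have [] := anti u v uS vS.
by move=> u v /sS uS vS; have [] := anti u v uS vS.
Qed.

Lemma hole_arcs H a b : hole e H -> a \in H -> b \in H -> a != b -> ~~ e a b ->
  exists S1 S2, [/\ conn e S1 /\ conn e S2, anticomplete e S1 S2,
    [/\ touch e S1 a, touch e S1 b, touch e S2 a & touch e S2 b],
    [/\ a \notin S1, b \notin S1, a \notin S2 & b \notin S2] &
    S1 \subset H /\ S2 \subset H].
Proof.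
case=> c0 [-> sz0 u0 he0]; rewrite !inE => ac0 bc0 ab nab.
(* After rotating the hole to start at [a], the rest is an induced path, and [b] cuts it into the
   two arcs. *)
have [i c rot_c] := rot_to ac0.
have memc x : (x \in a :: c) = (x \in c0) by rewrite -rot_c mem_rot.
have uc : uniq (a :: c) by rewrite -rot_c rot_uniq.
have szc : 4 <= size (a :: c) by rewrite -rot_c size_rot.
have he : {in a :: c &, forall x y, e x y = (next (a :: c) x == y) || (next (a :: c) y == x)}.
  by move=> x y; rewrite !memc => xc yc; rewrite he0 // -rot_c !next_rot.
have bc : b \in c by move: bc0; rewrite -memc inE eq_sym (negPf ab).
have /andP[anc ucc] := uc.
have ipc : ip e c.
  apply: induced_path_ip; split=> //; first by move: szc => /=; lia.
  by move=> x y xc yc; rewrite he ?inE ?xc ?yc ?orbT // !next_cons_eq.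
have ehead : e a (head a c).
  have hc : head a c \in c by case: (c) bc => // d c' _; apply: mem_head.
  by rewrite he ?inE ?eqxx ?hc ?orbT // next_nth mem_head index_head nth0 eqxx.
have elast : e a (last a c).
  have hc : last a c \in c by case: (c) bc => // d c' _ /=; apply: mem_last.
  rewrite he ?inE ?eqxx ?hc ?orbT // (next_cons uc hc) orbC.
  rewrite nth_default ?eqxx // -ltnS ltnS leq_eqVlt; apply/orP; left.
  case: (c) ucc hc => // d c' ucc hc; rewrite eq_sym index_last_eq //.
have [s1 [s2 def_c]] : exists s1 s2, c = s1 ++ b :: s2.
  by case/splitPr: bc => s1 s2; exists s1, s2.
rewrite def_c in ipc ehead elast anc memc ucc.
have s1n : s1 != [::].
  by apply: contraNneq nab => h; move: ehead; rewrite h.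
have s2n : s2 != [::].
  by apply: contraNneq nab => h; move: elast; rewrite h last_cat.
case: s1 s1n def_c ipc ehead elast anc memc ucc => // d1 s1 _ _ ipc ehead elast anc memc ucc.
case: s2 s2n ipc ehead elast anc memc ucc => // d2 s2 _ ipc ehead elast anc memc ucc.
rewrite last_cat /= in elast; rewrite /= in ehead.
exists [set x in d1 :: s1], [set x in d2 :: s2].
have sub1 : {subset d1 :: s1 <= (d1 :: s1) ++ [:: b, d2 & s2]}.
  by move=> x xs; rewrite mem_cat xs.
have sub2 : {subset d2 :: s2 <= (d1 :: s1) ++ [:: b, d2 & s2]}.
  by move=> x xs; rewrite mem_cat (in_cons b) xs !orbT.
have ubl : (b \notin d1 :: s1) /\ (b \notin d2 :: s2).
  have := ip_uniq ipc; rewrite cat_uniq => /and3P[_ /norP[-> _] /andP[-> _]] //.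
have ipb := ip_catr ipc.
split.
- by split; [apply: (ip_conn gsym) (ip_catl ipc) | apply: (ip_conn gsym) (ip_catr (s := [:: b]) ipb)].
- apply/anticompleteP => x y; rewrite !in_set => x1 y2.
  have [|nxy ->] := ip_cat_edge gsym girr (u := x) (v := y) ipc x1 _.
    by rewrite inE y2 orbT.
  split=> //; apply/negbTE; rewrite negb_and; apply/orP; right.
  by apply: contraNneq ubl.2 => <-.
- split; apply/touchP.
  + by exists d1; rewrite ?in_set ?mem_head.
  + exists (last d1 s1); first by rewrite in_set mem_last.
    have [|_] := ip_cat_edge gsym girr (u := last d1 s1) (v := b) ipc (mem_last _ _) _.
      by rewrite mem_head.
    by rewrite !eqxx gsym.
  + by exists (last d2 s2); rewrite ?in_set ?mem_last.
  exists d2; first by rewrite in_set mem_head.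
  by case/ip_consP: ipb => _ _ ->; rewrite ?mem_head // index_head.
- by case: ubl => nb1 nb2; rewrite !in_set; split=> //;
    apply: contra anc => h; [apply: sub1 | apply: sub2].
by split; apply/subsetP => x; rewrite !in_set -memc inE => /[dup] h ?;
  apply/orP; right; [apply: sub1 | apply: sub2].
Qed.

Lemma chordal_no_two_arcs a b S1 S2 : chordal e -> conn e S1 -> conn e S2 ->
  a != b -> ~~ e a b ->
  a \notin S1 -> b \notin S1 -> a \notin S2 -> b \notin S2 ->
  touch e S1 a -> touch e S1 b -> touch e S2 a -> touch e S2 b ->
  anticomplete e S1 S2 -> False.
Proof.
move=> ch c1 c2 ab nab a1 b1 a2 b2 ta1 tb1 ta2 tb2 anti.
by have [H /ch] := hole_two_arcs c1 c2 ab nab a1 b1 a2 b2 ta1 tb1 ta2 tb2 anti.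
Qed.

Definition ord3 (T : Type) (x0 x1 x2 : T) (i : 'I_3) : T :=
  nth x0 [:: x0; x1; x2] i.

Lemma ord3P (P : 'I_3 -> 'I_3 -> Prop) :
  (forall i j, P i j -> P j i) ->
  P (inord 0) (inord 1) -> P (inord 0) (inord 2) -> P (inord 1) (inord 2) ->
  forall i j, i != j -> P i j.
Proof.
move=> sP P01 P02 P12 i j.
rewrite -(inord_val i) -(inord_val j).
case: i => [[|[|[|//]]] ilt]; case: j => [[|[|[|//]]] jlt] /=;
  by rewrite ?eqxx // => _; first [assumption | apply: sP; assumption].
Qed.

(** An induced path from [a] to [b] is taken through each set; anticompleteness of the sets passes
    to the interiors. All thetas below are obtained in this form. *)
Lemma theta_sets a b S0 S1 S2 : conn e S0 -> conn e S1 -> conn e S2 ->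
  a != b -> ~~ e a b ->
  touch e S0 a -> touch e S0 b -> touch e S1 a -> touch e S1 b ->
  touch e S2 a -> touch e S2 b ->
  anticomplete e S0 S1 -> anticomplete e S0 S2 -> anticomplete e S1 S2 ->
  exists S, theta e S.
Proof.
move=> c0 c1 c2 ab nab a0 b0 a1 b1 a2 b2 n01 n02 n12.
have [s0 [ip0 sn0 sS0]] := conn_ip_touch gsym c0 ab nab a0 b0.
have [s1 [ip1 sn1 sS1]] := conn_ip_touch gsym c1 ab nab a1 b1.
have [s2 [ip2 sn2 sS2]] := conn_ip_touch gsym c2 ab nab a2 b2.
pose P i := a :: rcons (ord3 s0 s1 s2 i) b.
pose S' := ord3 S0 S1 S2.
have ipP i : ip e (P i) by case: i => [[|[|[|//]]] ilt].
have subP i : interior (P i) \subset S' i.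
  rewrite interior_ends ?(ip_uniq (ipP i)) //; apply/subsetP => x; rewrite in_set.
  by case: i => [[|[|[|//]]] ilt] /=; [apply: sS0 | apply: sS1 | apply: sS2].
exists (\bigcup_i [set x in P i]), a, b, P; split=> //.
- move=> i; split; [exact: (ip_induced_path gsym girr) | by [] |].
  by rewrite /P /= last_rcons.
- move=> i; rewrite /P /= size_rcons !ltnS lt0n size_eq0.
  by case: i => [[|[|[|//]]] ilt].
apply: ord3P => [i j|||]; first by rewrite anticomplete_sym.
- by apply: anticompleteS (subP _) (subP _) _; rewrite /S' /ord3 !inordK.
- by apply: anticompleteS (subP _) (subP _) _; rewrite /S' /ord3 !inordK.
by apply: anticompleteS (subP _) (subP _) _; rewrite /S' /ord3 !inordK.
Qed.

Definition link A B a b a' b' : Prop := forall u v, u \in A -> v \in B ->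
  u != v /\ e u v = (u == a) && (v == a') || (u == b) && (v == b').

(** Induced paths inside the three sets inherit the prescribed edges; distinct corners in each set
    give length at least 1. *)
Lemma prism_sets L0 L1 L2 a0 a1 a2 b0 b1 b2 :
  conn e L0 -> conn e L1 -> conn e L2 ->
  a0 \in L0 -> a1 \in L1 -> a2 \in L2 -> b0 \in L0 -> b1 \in L1 -> b2 \in L2 ->
  a0 != b0 -> a1 != b1 -> a2 != b2 ->
  link L0 L1 a0 b0 a1 b1 -> link L0 L2 a0 b0 a2 b2 -> link L1 L2 a1 b1 a2 b2 ->
  exists S, prism e S.
Proof.
move=> c0 c1 c2 aL0 aL1 aL2 bL0 bL1 bL2 ab0 ab1 ab2 l01 l02 l12.
have [s0 [ip0 ls0 sS0]] := conn_ip c0 aL0 bL0.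
have [s1 [ip1 ls1 sS1]] := conn_ip c1 aL1 bL1.
have [s2 [ip2 ls2 sS2]] := conn_ip c2 aL2 bL2.
pose a := ord3 a0 a1 a2; pose b := ord3 b0 b1 b2.
pose P i := a i :: ord3 s0 s1 s2 i.
pose L := ord3 L0 L1 L2.
have subP i x : x \in P i -> x \in L i.
  by case: i => [[|[|[|//]]] ilt] /=; [apply: sS0 | apply: sS1 | apply: sS2].
have lP : forall i j, i != j -> link (L i) (L j) (a i) (b i) (a j) (b j).
  apply: ord3P => [i j l u v uA vB|||]; rewrite /L /a /b /ord3 ?inordK //.
  by have [] := l v u vB uA; rewrite eq_sym gsym => -> ->; split=> //; congr orb; apply: andbC.
exists (\bigcup_i [set x in P i]), a, b, P; split=> //.
- move=> i; split; [apply: (ip_induced_path gsym girr) => // | by [] |];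
  by case: i => [[|[|[|//]]] ilt].
- move=> i; rewrite /P /= ltnS.
  by case: i => [[|[|[|//]]] ilt] /=; [case: (s0) ls0 ab0 | case: (s1) ls1 ab1 | case: (s2) ls2 ab2] => //= ->; rewrite eqxx.
- move=> i j ij; rewrite disjoint_has; apply/hasPn => x /subP xi.
  by apply/negP => /subP xj; have [] := lP i j ij x x xi xj; rewrite eqxx.
by move=> i j ij u v /subP ui /subP vj; have [] := lP i j ij u v ui vj.
Qed.

(** Twin wheels and short pyramids have exactly three spokes, so four spokes already make a wheel
    proper. *)
Lemma nonhub_lt4 H y : hole e H -> ~ hub e y -> #|nbh e y :&: H| < 4.
Proof.
move=> hH nhub; rewrite ltnNge; apply/negP => ge4; apply: nhub; exists H; split.
- by split=> //; apply: ltnW.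
- case=> _ [p [def_N [_ up _] sz]].
  by move: ge4; rewrite def_N cardsE (card_uniqP up) sz.
by case=> _ c3 _; rewrite c3 in ge4.
Qed.

(** By [nonhub_lt4] the three vertices are all the neighbors of [y] in [H]. Being stable, they
    neither induce a path of length two nor contain an adjacent pair. *)
Lemma nonhub_adjacent H y u v w : hole e H -> ~ hub e y ->
  u \in H -> v \in H -> w \in H -> e y u -> e y v -> e y w ->
  u != v -> u != w -> v != w -> ~~ e u v -> ~~ e u w -> ~~ e v w -> False.
Proof.
move=> hH nhub uH vH wH yu yv yw uv uw vw nuv nuw nvw.
have sub : [set u; v; w] \subset nbh e y :&: H.
  by apply/subsetP => x; rewrite !inE => /orP[/orP[]|] /eqP->; rewrite ?yu ?yv ?yw.
have c3 : #|[set u; v; w]| = 3.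
  by rewrite -setUA cardsU1 !inE negb_or uv uw /= cards2 vw.
have cN : #|nbh e y :&: H| = 3.
  have := subset_leq_card sub; rewrite c3 => ge3.
  by apply/eqP; rewrite eqn_leq ge3 -ltnS nonhub_lt4.
have defN : nbh e y :&: H = [set u; v; w].
  by apply/esym/eqP; rewrite eqEcard sub cN c3.
have wheelH : wheel e H y by split; rewrite ?cN.
have nadj x z : x \in [set u; v; w] -> z \in [set u; v; w] -> e x z = false.
  rewrite !inE => /orP[/orP[]|] /eqP-> /orP[/orP[]|] /eqP->;
    by rewrite ?girr //; apply/negbTE; rewrite // gsym.
apply: nhub; exists H; split=> //.
- case=> _ [p [def_p [_ up hp] sz]]; move: def_p up hp; rewrite defN.
  case: p sz => [|a [|b [|c []]]] //= _ def_p up hp.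
  have := hp a b; rewrite !inE !eqxx !orbT nadj.
    by move=> /(_ isT isT); rewrite (_ : (a == b) = false) //; move: up; rewrite !inE; case: (a == b).
  + by rewrite def_p !inE eqxx.
  by rewrite def_p !inE eqxx orbT.
case=> _ _; rewrite defN => c2.
have /set0Pn[x] : [set x in [set u; v; w] | [exists z in [set u; v; w], e x z]] != set0.
  by rewrite -card_gt0 c2.
by rewrite inE => /andP[xN /exists_inP[z zN]]; rewrite nadj.
Qed.

End Configurations.

(** * Terminal frames and the parts hanging from their vertices *)

Section Terminals.
Variables (V : finType) (e : rel V).
Hypotheses (gsym : symmetric e) (girr : irreflexive e).
Implicit Types (S T A B C F L D X Y Z : {set V}) (c k u v w x y z : V) (s p q zs : seq V).

Definition pendant A y := exists2 x, x \in A & forall v, v \in A -> e y v = (v == x).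

Lemma pendantS A X y : X \subset A -> pendant A y -> touch e X y -> pendant X y.
Proof.
move=> /subsetP sXA [x xA hx] /touchP[v vX yv].
have := hx v (sXA v vX); rewrite yv => /esym/eqP vx; rewrite {}vx in vX.
by exists x => // w /sXA; apply: hx.
Qed.

(* What remains of the minimality of a connected set [X] having every [y] in [Y] as a pendant
   neighbor. *)
Definition terminal_frame X Y :=
  [/\ [disjoint X & Y], conn e (X :|: Y),
      forall y, y \in Y -> exists2 x, x \in X & forall v, v \in X :|: Y -> e y v = (v == x),
      forall u v, u \in X -> v \in (X :|: Y) :\ u ->
        exists2 y, y \in Y & y \in component e ((X :|: Y) :\ u) v &
      forall u v, u \in X -> v \in (X :|: Y) :\ u ->
        exists2 w, w \in (X :|: Y) :\ u & w \notin component e ((X :|: Y) :\ u) v].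

(** [X] is a connected subset of [A] of least size that still touches every terminal; the last two
    clauses of the frame express that no smaller set does. *)
Lemma exists_terminal_frame A Y : conn e A -> [disjoint A & Y] ->
  stable e Y -> 1 < #|Y| -> (forall y, y \in Y -> pendant A y) ->
  exists2 X : {set V}, X \subset A & terminal_frame X Y.
Proof.
move=> cA dAY /forall_inP stY gt1 pA.
pose P (X : {set V}) := [&& X \subset A, `[< conn e X >] & [forall y in Y, touch e X y]].
have PA : P A.
  rewrite /P subxx /=; apply/andP; split; first exact/asboolP.
  apply/forall_inP => y /pA[x xA hx]; apply/touchP; exists x => //.
  by rewrite hx.
case: (arg_minnP (fun X : {set V} => #|X|) PA) => X /and3P[XA /asboolP cX /forall_inP tX] minX.
have {}minX X' v : v \in X -> X' \subset X -> v \notin X' -> conn e X' ->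
    exists2 y, y \in Y & ~~ touch e X' y.
  move=> vX sX' vX' cX'; apply: contrapT => no.
  have /minX : P X'.
    rewrite /P (subset_trans sX') //=; apply/andP; split; first exact/asboolP.
    by apply/forall_inP => y yY; apply: contrapT => /negP ny; apply: no; exists y.
  rewrite leqNgt proper_card //; apply/properP; split=> //; by exists v.
have dXY : [disjoint X & Y] by apply: disjointWl dAY.
have nY x : x \in X -> x \notin Y by move=> xX; rewrite (disjointFr dXY).
have leaf y : y \in Y -> exists2 x, x \in X & forall v, v \in X :|: Y -> e y v = (v == x).
  move=> yY; have [x xX hx] := pendantS XA (pA y yY) (tX y yY).
  exists x => // v; rewrite inE => /orP[/hx//|vY].
  move/forall_inP: (stY y yY) => /(_ v vY)/negbTE->.
  by apply/esym/negbTE; apply: contraTneq vY => ->; apply: nY.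
exists X => //; split=> //.
- have [y0 /leaf[x0 x0X _]] : exists y, y \in Y by apply/set0Pn; rewrite -card_gt0; lia.
  apply: (conn_root gsym (r := x0)); first by rewrite inE x0X.
  move=> v; rewrite inE => /orP[vX|vY].
    exact: connect_mono (subsetUl _ _) (cX _ _ x0X vX).
  have [x xX hx] := leaf v vY.
  apply: (connect_trans (connect_mono (subsetUl _ _) (cX _ _ x0X xX))).
  by apply: connect1; rewrite /induced /= !inE xX vY gsym hx ?eqxx ?orbT // inE xX.
(* A component [C] without terminals hangs from the rest through [u] only, so [X :\: C] is connected
   and loses no terminal, against minimality. *)
- move=> u v uX vH; set C := component e _ v; apply: contrapT => no.
  have CY w : w \in C -> w \notin Y by move=> wC; apply/negP => wY; apply: no; exists w.
  have sCH := subsetP (component_sub e vH : C \subset _).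
  have CX w : w \in C -> w \in X.
    by move=> wC; have := sCH w wC; rewrite !inE (negPf (CY w wC)) orbF => /andP[].
  have uC : u \notin C by apply/negP => /sCH; rewrite !inE eqxx.
  have vC : v \in C := component_self e _ v.
  have uXC : u \in X :\: C by rewrite inE uC.
  have cXC : conn e (X :\: C).
    suff sub : X \subset component e (X :\: C) u :|: C.
      apply: (conn_root gsym uXC) => w; rewrite inE => /andP[wC wX].
      by have := subsetP sub w wX; rewrite inE (negPf wC) orbF inE.
    apply: (conn_closed (x := u) cX) => //; first by rewrite inE component_self.
    move=> a b; rewrite inE => /orP[aT|aC] aX bX ab; rewrite inE.
      have [//|bC] := boolP (b \in C); first by rewrite orbT.
      by rewrite (component_closed uXC aT) // inE bC.
    have [->|bu] := eqVneq b u; first by rewrite component_self.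
    by rewrite orbC (component_closed vH aC) // !inE bu bX.
  have [||y yY /negP[]] := minX (X :\: C) v (CX v vC) _ _ cXC.
  + exact: subsetDl.
  + by rewrite inE vC.
  have [x xX hx] := leaf y yY; have yx : e y x by rewrite hx ?eqxx // inE xX.
  apply/touchP; exists x => //; rewrite inE xX andbT; apply/negP => xC.
  have /CY : y \in C; last by rewrite yY.
  apply: (component_closed vH xC); last by rewrite gsym.
  rewrite !inE yY orbT andbT; apply: contraTneq yY => ->; exact: nY.
move=> u v uX vH; apply: contrapT => no.
have all_C w : w \in (X :|: Y) :\ u -> connect (induced e ((X :|: Y) :\ u)) v w.
  move=> wH; apply: contrapT => /negP nC; apply: no; exists w => //.
  by rewrite inE.
have cHu : conn e ((X :|: Y) :\ u) by apply: conn_root all_C.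
have nYu y : y \in Y -> y != u by apply: contraTneq => ->; apply: nY.
(* A terminal attached at [u] becomes isolated when [u] is deleted, although [1 < #|Y|] provides
   another terminal it should reach. Without one, [X :\ u] is a smaller admissible set. *)
have [/exists_inP[y0 y0Y y0u]|/exists_inPn nu] := boolP [exists y in Y, e y u].
  have [y1 /setD1P[y10 y1Y]] : exists y, y \in Y :\ y0.
    by apply/set0Pn; rewrite -card_gt0; have := cardsD1 y0 Y; rewrite y0Y; lia.
  have [||||a [b [/set1P-> _]]] := conn_leave (T := [set y0]) (x := y0) (y := y1) cHu.
  - exact: set11.
  - by rewrite !inE y0Y nYu ?orbT.
  - by rewrite !inE y1Y nYu ?orbT.
  - by rewrite inE.
  have [x xX hx] := leaf y0 y0Y.
  rewrite !inE => /andP[bu bH] _; rewrite hx ?inE // => /eqP bx.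
  by move: y0u; rewrite hx ?inE ?uX // -bx eq_sym (negPf bu).
have cXu : conn e (X :\ u).
  have -> : X :\ u = ((X :|: Y) :\ u) :\: Y.
    apply/setP => w; rewrite !inE; case wX: (w \in X); last by case: (w \in Y); rewrite ?andbF.
    by rewrite (negPf (nY w wX)).
  apply: conn_setD_leaves => //.
  - move=> y yH yY; have [x xX hx] := leaf y yY; have yx : e y x by rewrite hx ?eqxx // inE xX.
    apply/touchP; exists x => //; rewrite !inE xX nY //= andbT.
    by apply: contraTneq yx => ->; apply: nu.
  move=> y a b _ /leaf[x xX hx] /setD1P[_ aH] /setD1P[_ bH].
  by rewrite !hx // => /eqP-> /eqP->.
have [||y yY /negP[]] := minX (X :\ u) u uX _ _ cXu.
- exact: subsetDl.
- by rewrite !inE eqxx.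
have [x xX hx] := leaf y yY; have yx : e y x by rewrite hx ?eqxx // inE xX.
apply/touchP; exists x => //; rewrite !inE xX andbT.
by apply: contraTneq yx => ->; apply: nu.
Qed.

(** A subdivided star with center [c] and ends [Z], up to shrinking the legs: connected sets [L y]
    replace the paths. *)
Definition claw A Z := exists c (L : V -> {set V}),
  [/\ c \in A,
      forall y, y \in Z -> [/\ y \in L y, L y \subset y |: A, conn e (L y),
                               c \notin L y & touch e (L y) c] &
      forall y y', y \in Z -> y' \in Z -> y != y' -> anticomplete e (L y) (L y')].

(** For three terminals, a triangle with corners [a y] and one leg from each corner to its terminal.
    The corners are required in [A], hence differ from the terminals outside [A]. *)
Definition tri A Z := exists (a : V -> V) (L : V -> {set V}),
  (forall y, y \in Z -> [/\ y \in L y, L y \subset y |: A, conn e (L y),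
                            a y \in L y & a y \in A]) /\
  (forall y y' u v, y \in Z -> y' \in Z -> y != y' -> u \in L y -> v \in L y' ->
     u != v /\ e u v = (u == a y) && (v == a y')).

Lemma clawS A A' Z : A' \subset A -> claw A' Z -> claw A Z.
Proof.
move=> sA [c [L [cA hL anti]]]; exists c, L; split=> //; first exact: (subsetP sA).
by move=> y /hL[yL sL *]; split=> //; apply: subset_trans sL (setUS _ sA).
Qed.

Section Frame.
Variables X Y : {set V}.
Hypothesis frameXY : terminal_frame X Y.
Let H := X :|: Y.

Lemma frame_leaf y : y \in Y -> exists2 x, x \in X & forall v, v \in H -> e y v = (v == x).
Proof. by case: frameXY => _ _ + _ _ => /(_ y). Qed.

Lemma frame_notY x : x \in X -> x \notin Y.
Proof. by case: frameXY => dXY _ _ _ _ xX; rewrite (disjointFr dXY). Qed.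

Lemma frame_two_nbrs x u v : x \in H -> u \in H -> v \in H -> u != v ->
  e x u -> e x v -> x \in X.
Proof.
rewrite {1}/H inE => /orP[//|/frame_leaf[z zX hz]] uH vH uv.
by rewrite !hz // => /eqP uz /eqP vz; rewrite uz vz eqxx in uv.
Qed.

Lemma conn_frame : conn e H. Proof. by case: frameXY. Qed.

Lemma conn_minus_leaves S D x : S \subset H -> conn e S -> D \subset Y ->
  x \in S -> x \notin D -> conn e (S :\: D).
Proof.
move=> /subsetP sSH cS /subsetP sDY xS xD; apply: conn_setD_leaves => //.
  move=> u uS uD.
  have [||||a [b [/set1P-> _ bS bu ub]]] := conn_leave (T := [set u]) (x := u) (y := x) cS => //.
  - exact: set11.
  - by rewrite inE; apply: contraNneq xD => ->.
  apply/touchP; exists b => //; rewrite inE bS andbT; apply/negP => /sDY bY.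
  have [z zX hz] := frame_leaf (sDY u uD); move: ub; rewrite hz ?sSH // => /eqP bz.
  by move: bY; rewrite bz (negPf (frame_notY zX)).
move=> u v w uS /sDY/frame_leaf[z zX hz] vS wS; rewrite !hz ?sSH //.
by move=> /eqP-> /eqP->.
Qed.

(** [u] is a cut vertex, so a second component exists besides that of [w]. The frame puts a terminal
    into it, and connectivity of the frame makes it touch [u]. *)
Lemma cut_branch u w : u \in X -> w \in H :\ u ->
  exists C y, [/\ conn e C, C \subset H :\ u, touch e C u, y \in C /\ y \in Y &
                  anticomplete e C (component e (H :\ u) w)].
Proof.
move=> uX wH; case: frameXY => _ cH _ term cut.
have [z zH zw] := cut u w uX wH; have [y yY yz] := term u z uX zH.
have sC := subsetP (component_sub e zH).
exists (component e (H :\ u) z), y; split=> //; first exact: component_conn.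
- exact: component_sub.
- have uH : u \in H by rewrite inE uX.
  have [||||a [b [aC _ bH bC ab]]] :=
    conn_leave (T := component e (H :\ u) z) (x := z) (y := u) cH => //.
  + exact: component_self.
  + by case/setD1P: zH.
  + by apply/negP => /sC; rewrite !inE eqxx.
  have [bu|bu] := eqVneq b u; first by apply/touchP; exists a; rewrite // gsym -bu.
  by move: bC; rewrite (component_closed zH aC) // in_setD1 bu.
apply/anticompleteP => a b az bw.
have nbz : b \notin component e (H :\ u) z.
  by apply/negP => bz; rewrite -(component_eq gsym bw) (component_eq gsym bz) component_self in zw.
split; first by apply: contraNneq nbz => <-.
apply: contraNF nbz; apply: component_closed az _ => //.
exact: (subsetP (component_sub e wH)).
Qed.

Definition petal k F := [/\ k \in F, F \subset H, conn e F &
  forall u v, u \in F -> u != k -> v \in H -> e u v -> v \in F].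

(* The part of the frame hanging from [k], as seen from its neighbor [c]. *)
Definition far c k := H :\: component e (H :\ k) c.

Lemma far_root c k : k \in H -> c \in H -> c != k -> k \in far c k.
Proof.
move=> kH cH ck; rewrite inE kH andbT; apply/negP => kc.
have cHk : c \in H :\ k by rewrite in_setD1 ck.
by have := subsetP (component_sub e cHk) k kc; rewrite in_setD1 eqxx.
Qed.

Lemma far_parent c k : c \notin far c k.
Proof. by rewrite inE component_self. Qed.

Lemma far_nbr c k v : c \in H -> v \in H -> c != k -> v != k -> e c v ->
  v \notin far c k.
Proof.
move=> cH vH ck vk cv; rewrite inE negb_and negbK; apply/orP; left.
by apply: component_closed (component_self _ _ _) _ cv; rewrite in_setD1 ?ck ?vk.
Qed.

(** A component of [far c k] missing [k] would be closed under adjacency in the whole frame, which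
    is connected. *)
Lemma petal_far c k : c \in H -> k \in H -> e c k -> petal k (far c k).
Proof.
move=> cH kH ck; have nck : c != k by apply: contraTneq ck => ->; rewrite girr.
have kf := far_root kH cH nck; have cHk : c \in H :\ k by rewrite in_setD1 nck.
have closed u v : u \in far c k -> u != k -> v \in H -> e u v -> v \in far c k.
  rewrite !in_setD => /andP[uc uH] uk vH uv; rewrite vH andbT.
  apply: contra uc => vc; apply: component_closed vc _ _ => //; last by rewrite gsym.
  by rewrite in_setD1 uk.
split=> //; first exact: subsetDl.
apply: (conn_root gsym kf) => u uf; apply: contrapT => /negP nku.
have kT : k \notin component e (far c k) u by rewrite inE connectC.
have uH : u \in H by case/setDP: uf.
have /subsetP/(_ k kH) : H \subset component e (far c k) u.
  apply: conn_closed conn_frame (component_self _ _ _) uH _ => a b aT aH bH ab.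
  apply: (component_closed uf aT _ ab); apply: closed ab => //.
    exact: (subsetP (component_sub e uf)).
  by apply: contraTneq aT => ->.
by rewrite (negPf kT).
Qed.

(** From a common vertex, [F'] would lead to its root [k'] outside [F], and [F] can be left only
    through [k], which is not in [F']; so the petals are disjoint. An edge other than the one
    between the roots would put an end into both. *)
Lemma petals_link k F k' F' u v : petal k F -> petal k' F' ->
  k \notin F' -> k' \notin F -> u \in F -> v \in F' ->
  u != v /\ (e u v -> u = k /\ v = k').
Proof.
move=> [kF sF cF clF] [kF' sF' cF' clF'] kF'n kFn uF vF'.
have dis x : x \in F -> x \in F' -> False.
  move=> xF xF'.
  have [//|//|//|//|a [b [aF aF' bF' bF ab]]] := conn_leave (T := F) (x := x) (y := k') cF'.
  move: bF; rewrite (clF a) //; first by apply: contraNneq kF'n => <-.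
  exact: (subsetP sF').
split; first by apply/negP => /eqP uv; apply: (dis u) => //; rewrite uv.
move=> uv; split.
  apply/eqP; apply: contrapT => /negP uk; apply: (dis v) => //; apply: clF uv => //.
  exact: (subsetP sF').
apply/eqP; apply: contrapT => /negP vk; apply: (dis u) => //; apply: (clF' v) => //.
  exact: (subsetP sF).
by rewrite gsym.
Qed.

Lemma petal_sub k F S x : petal k F -> conn e S -> S \subset H -> x \in S -> x \in F ->
  k \notin S -> S \subset F.
Proof.
move=> [kF sF cF clF] cS /subsetP sS xS xF kS.
apply: (conn_closed cS xF xS) => // u v uF uS vS uv; apply: clF uv => //; last exact: sS.
by apply: contraNneq kS => <-.
Qed.

Lemma far_leaf c k : c \in H -> k \in Y -> e c k -> far c k = [set k].
Proof.
move=> cH kY ck; have kH : k \in H by rewrite inE kY orbT.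
have [kf sf cf _] := petal_far cH kH ck.
apply/eqP; rewrite eqEsubset sub1set kf andbT; apply/subsetP => u uf.
rewrite inE; apply: contrapT => /negP uk.
have [||//||a [b [/set1P-> _ bf _ kb]]] := conn_leave (T := [set k]) (x := k) (y := u) cf.
- exact: set11.
- by [].
- by rewrite inE.
have [z zX hz] := frame_leaf kY.
have cz : c = z by apply/eqP; rewrite -hz // gsym.
have bz : b = z by apply/eqP; rewrite -hz // (subsetP sf).
by move: bf; rewrite bz -cz (negPf (far_parent c k)).
Qed.

(** The cut property at [k] supplies a terminal [y] beyond [k]. All other terminals are leaves and
    can be deleted without disconnecting the rest. *)
Lemma far_leg c k : c \in H -> k \in H -> e c k ->
  exists y L, [/\ y \in Y, y \in L, k \in L, L \subset far c k &
                  conn e L /\ L \subset y |: X].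
Proof.
move=> cH kH ck; have [kY|kY] := boolP (k \in Y).
  exists k, [set k]; rewrite set11 far_leaf //; split=> //.
  by split; [apply: conn1 | rewrite sub1set !inE eqxx].
have kX : k \in X by move: kH; rewrite inE (negPf kY) orbF.
have nck : c != k by apply: contraTneq ck => ->; rewrite girr.
have cHk : c \in H :\ k by rewrite in_setD1 nck.
case: frameXY => _ _ _ term cut.
have [w wH wc] := cut k c kX cHk; have [y yY yw] := term k w kX wH.
have [kf sf cf _] := petal_far cH kH ck.
have yf : y \in far c k.
  have yH : y \in H by rewrite inE yY orbT.
  rewrite in_setD yH andbT; apply: contra wc => yc.
  by rewrite -(component_eq gsym yc) (component_eq gsym yw) component_self.
exists y, (far c k :\: (Y :\ y)); split=> //.
- by rewrite in_setD yf !inE eqxx.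
- by rewrite in_setD kf !inE (negPf kY) andbF.
- exact: subsetDl.
split.
  apply: (@conn_minus_leaves _ _ k) => //; first exact: subsetDl.
  by rewrite !inE (negPf kY) andbF.
apply/subsetP => v /setDP[/(subsetP sf)]; rewrite !inE => /orP[->|->]; first by rewrite orbT.
by rewrite andbT negbK => ->.
Qed.

Lemma set3_choice (T : Type) (P : V -> T -> Prop) y1 y2 y3 (L1 L2 L3 : T) :
  y1 != y2 -> y1 != y3 -> y2 != y3 -> P y1 L1 -> P y2 L2 -> P y3 L3 ->
  forall y, y \in [set y1; y2; y3] ->
    P y (if y == y1 then L1 else if y == y2 then L2 else L3).
Proof.
move=> y12 y13 y23 P1 P2 P3 y; rewrite !inE => /orP[/orP[]|] /eqP->; rewrite ?eqxx //.
  by rewrite eq_sym (negPf y12).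
by rewrite ![y3 == _]eq_sym (negPf y13) (negPf y23).
Qed.

Lemma star_claw u u1 u2 u3 : u \in X -> u1 \in H -> u2 \in H -> u3 \in H ->
  e u u1 -> e u u2 -> e u u3 -> u1 != u2 -> u1 != u3 -> u2 != u3 ->
  ~~ e u1 u2 -> ~~ e u1 u3 -> ~~ e u2 u3 ->
  exists y1 y2 y3, [/\ y1 \in Y, y2 \in Y & y3 \in Y] /\
    [/\ y1 != y2, y1 != y3, y2 != y3 & claw X [set y1; y2; y3]].
Proof.
move=> uX u1H u2H u3H uu1 uu2 uu3 u12 u13 u23 n12 n13 n23.
have uH : u \in H by rewrite inE uX.
have ne v : e u v -> u != v by apply: contraTneq => <-; rewrite girr.
have [y1 [L1 [y1Y y1L u1L sL1 [cL1 XL1]]]] := far_leg uH u1H uu1.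
have [y2 [L2 [y2Y y2L u2L sL2 [cL2 XL2]]]] := far_leg uH u2H uu2.
have [y3 [L3 [y3Y y3L u3L sL3 [cL3 XL3]]]] := far_leg uH u3H uu3.
have anti a b (La Lb : {set V}) : a \in H -> b \in H -> e u a -> e u b -> a != b ->
    ~~ e a b -> La \subset far u a -> Lb \subset far u b -> anticomplete e La Lb.
  move=> aH bH ua ub ab nab /subsetP sa /subsetP sb; apply/anticompleteP => v w vL wL.
  have [||-> h] := petals_link (petal_far uH aH ua) (petal_far uH bH ub) _ _ (sa v vL) (sb w wL).
  - by apply: far_nbr => //; apply: ne.
  - by apply: far_nbr => //; rewrite ?ne // eq_sym.
  by split=> //; apply: contraNF nab => /[dup] /h[-> ->].
have a12 := anti _ _ _ _ u1H u2H uu1 uu2 u12 n12 sL1 sL2.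
have a13 := anti _ _ _ _ u1H u3H uu1 uu3 u13 n13 sL1 sL3.
have a23 := anti _ _ _ _ u2H u3H uu2 uu3 u23 n23 sL2 sL3.
have dif A B x y : anticomplete e A B -> x \in A -> y \in B -> x != y.
  by move=> /anticompleteP h xA yB; have [] := h x y xA yB.
have y12 := dif _ _ _ _ a12 y1L y2L; have y13 := dif _ _ _ _ a13 y1L y3L.
have y23 := dif _ _ _ _ a23 y2L y3L.
exists y1, y2, y3; split=> //; split=> //.
have uL v L : L \subset far u v -> u \notin L.
  by move=> sL; apply: contra (far_parent u v); apply: (subsetP sL).
have tL v L : e u v -> v \in L -> touch e L u by move=> uv vL; apply/touchP; exists v.
pose L y := if y == y1 then L1 else if y == y2 then L2 else L3.
exists u, L; split=> //.
  have := @set3_choice _ (fun y (A : {set V}) => [/\ y \in A, A \subset y |: X, conn e A,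
    u \notin A & touch e A u]) y1 y2 y3 L1 L2 L3 y12 y13 y23.
  by apply; [move: sL1 uu1 u1L | move: sL2 uu2 u2L | move: sL3 uu3 u3L] =>
    sL uv vL; rewrite (uL _ _ sL) (tL _ _ uv vL).
move=> y y'; rewrite /L !inE.
have e21 : (y2 == y1) = false by rewrite eq_sym (negPf y12).
have e31 : (y3 == y1) = false by rewrite eq_sym (negPf y13).
have e32 : (y3 == y2) = false by rewrite eq_sym (negPf y23).
by move=> /orP[/orP[]|] /eqP-> /orP[/orP[]|] /eqP->;
  rewrite ?eqxx ?e21 ?e31 ?e32 // => _; rewrite anticomplete_sym.
Qed.

Lemma triangle_tri u1 u2 u3 : u1 \in H -> u2 \in H -> u3 \in H ->
  e u1 u2 -> e u1 u3 -> e u2 u3 ->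
  exists y1 y2 y3, [/\ y1 \in Y, y2 \in Y & y3 \in Y] /\
    [/\ y1 != y2, y1 != y3, y2 != y3 & tri X [set y1; y2; y3]].
Proof.
move=> u1H u2H u3H e12 e13 e23.
have ne v w : e v w -> v != w by apply: contraTneq => <-; rewrite girr.
have e21 : e u2 u1 by rewrite gsym.
have e31 : e u3 u1 by rewrite gsym.
have e32 : e u3 u2 by rewrite gsym.
have u1X := frame_two_nbrs u1H u2H u3H (ne _ _ e23) e12 e13.
have u2X := frame_two_nbrs u2H u1H u3H (ne _ _ e13) e21 e23.
have u3X := frame_two_nbrs u3H u1H u2H (ne _ _ e12) e31 e32.
(* Each corner is seen from another corner, in cyclic order. Seen from there, the third corner is
   not beyond it, so the three parts meet only in the triangle. *)
have [y1 [L1 [y1Y y1L u1L sL1 [cL1 XL1]]]] := far_leg u2H u1H e21.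
have [y2 [L2 [y2Y y2L u2L sL2 [cL2 XL2]]]] := far_leg u3H u2H e32.
have [y3 [L3 [y3Y y3L u3L sL3 [cL3 XL3]]]] := far_leg u1H u3H e13.
have lnk a b c d (La Lb : {set V}) : a \in H -> b \in H -> c \in H -> d \in H ->
    e c a -> e d b -> e a b -> (b == c) || e c b -> (a == d) || e d a ->
    La \subset far c a -> Lb \subset far d b ->
    forall u v, u \in La -> v \in Lb -> u != v /\ e u v = (u == a) && (v == b).
  move=> aH bH cH dH ca db ab bc ad /subsetP sa /subsetP sb v w vL wL.
  have [||-> h] := petals_link (petal_far cH aH ca) (petal_far dH bH db) _ _ (sa v vL) (sb w wL).
  - case/orP: ad => [/eqP->|da]; first exact: far_parent.
    by apply: far_nbr => //; apply: ne.
  - case/orP: bc => [/eqP->|cb]; first exact: far_parent.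
    by apply: far_nbr => //; [apply: ne | rewrite eq_sym ne].
  by split=> //; apply/idP/andP => [/h[-> ->]//|[/eqP-> /eqP->]].
have l12 : forall u v, u \in L1 -> v \in L2 -> u != v /\ e u v = (u == u1) && (v == u2).
  by apply: lnk sL1 sL2; rewrite ?eqxx ?e31 ?orbT.
have l13 : forall u v, u \in L1 -> v \in L3 -> u != v /\ e u v = (u == u1) && (v == u3).
  by apply: lnk sL1 sL3; rewrite ?eqxx ?e23 ?orbT.
have l23 : forall u v, u \in L2 -> v \in L3 -> u != v /\ e u v = (u == u2) && (v == u3).
  by apply: lnk sL2 sL3; rewrite ?eqxx ?e12 ?orbT.
have y12 : y1 != y2 by have [] := l12 y1 y2 y1L y2L.
have y13 : y1 != y3 by have [] := l13 y1 y3 y1L y3L.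
have y23 : y2 != y3 by have [] := l23 y2 y3 y2L y3L.
exists y1, y2, y3; split=> //; split=> //.
pose L y := if y == y1 then (u1, L1) else if y == y2 then (u2, L2) else (u3, L3).
exists (fun y => (L y).1), (fun y => (L y).2); split.
  have := @set3_choice _ (fun y (p : V * {set V}) => [/\ y \in p.2, p.2 \subset y |: X, conn e p.2,
                            p.1 \in p.2 & p.1 \in X]) y1 y2 y3 (u1, L1) (u2, L2) (u3, L3).
  by apply.
move=> y y' u v; rewrite /L !inE.
have f21 : (y2 == y1) = false by rewrite eq_sym (negPf y12).
have f31 : (y3 == y1) = false by rewrite eq_sym (negPf y13).
have f32 : (y3 == y2) = false by rewrite eq_sym (negPf y23).
by move=> /orP[/orP[]|] /eqP-> /orP[/orP[]|] /eqP->;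
  rewrite ?eqxx ?f21 ?f31 ?f32 // => _ uL vL /=; rewrite ?(negPf y12);
  first [exact: l12 | exact: l13 | exact: l23 | idtac];
  rewrite eq_sym gsym andbC; first [exact: l12 | exact: l13 | exact: l23].
Qed.

End Frame.
End Terminals.

(** * Combs extracted from terminal frames *)

Section Combs.
Variables (V : finType) (e : rel V).
Hypotheses (gsym : symmetric e) (girr : irreflexive e).
Implicit Types (S T A B C F L D X Y Z : {set V}) (c k u v w x y z : V) (s p q zs : seq V).

(* The tooth [Lam y] meets the path through [at_ y] only: at one vertex if [b = false], at
   two consecutive vertices if [b = true]. *)
Definition comb (b : bool) A s zs (Lam : V -> {set V}) (at_ : V -> V) (pos : V -> nat) :=
  [/\ ip e s, {subset s <= A}, uniq zs & pairwise (fun y y' => pos y + b <= pos y') zs] /\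
  [/\ forall y, y \in zs -> [/\ y \in Lam y, at_ y \in Lam y, Lam y \subset y |: A & conn e (Lam y)],
      forall y, y \in zs -> pos y + b < size s,
      forall y v w, y \in zs -> v \in Lam y -> w \in s -> v != w /\
        e v w = (v == at_ y) && ((index w s == pos y) || b && (index w s == (pos y).+1)) &
      forall y y', y \in zs -> y' \in zs -> y != y' -> anticomplete e (Lam y) (Lam y')].

Lemma comb_subseq b A s zs zs' Lam at_ pos : subseq zs' zs ->
  comb b A s zs Lam at_ pos -> comb b A s zs' Lam at_ pos.
Proof.
move=> sub [[ips sA us pw] [h1 h2 h3 h4]]; have m := mem_subseq sub.
split; split=> //.
- exact: subseq_uniq sub us.
- exact: subseq_pairwise sub pw.
- by move=> y /m; apply: h1.
- by move=> y /m; apply: h2.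
- by move=> y v w /m; apply: h3.
by move=> y y' /m yz /m; apply: h4.
Qed.

Lemma combS b A A' s zs Lam at_ pos : A \subset A' ->
  comb b A s zs Lam at_ pos -> comb b A' s zs Lam at_ pos.
Proof.
move=> sA [[ips sA1 us pw] [h1 h2 h3 h4]]; split; split=> //.
  by move=> x /sA1; apply: (subsetP sA).
by move=> y /h1[? ? s1 ?]; split=> //; apply: subset_trans s1 (setUS _ sA).
Qed.

Lemma comb_cons_tooth b A s zs Lam at_ pos y L a n :
  comb b A s zs Lam at_ pos -> y \notin zs -> y \in L -> a \in L -> L \subset y |: A ->
  conn e L -> n + b < size s ->
  (forall v w, v \in L -> w \in s -> v != w /\
     e v w = (v == a) && ((index w s == n) || b && (index w s == n.+1))) ->
  (forall y', y' \in zs -> anticomplete e L (Lam y')) ->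
  (forall y', y' \in zs -> n + b <= pos y') ->
  comb b A s (y :: zs) (fun z => if z == y then L else Lam z)
    (fun z => if z == y then a else at_ z) (fun z => if z == y then n else pos z).
Proof.
move=> [[ips sA us pw] [h1 h2 h3 h4]] yzs yL aL LA cL ltn hL anti le_n.
have ne z : z \in zs -> (z == y) = false by apply: contraTF => /eqP->.
split; split=> //.
- by rewrite /= yzs.
- rewrite /= eqxx; apply/andP; split.
    by apply/allP => z zz; rewrite ne // le_n.
  apply: (sub_in_pairwise (P := mem zs)) pw => [z z'|]; last by apply/allP.
  by move=> /= /ne-> /ne->.
- move=> z; rewrite inE; case: eqP => [->|_] //=; exact: h1.
- move=> z; rewrite inE; case: eqP => [->|_] //=; exact: h2.
- move=> z v w; rewrite inE; case: eqP => [->|_] /=; [move=> _; exact: hL | exact: h3].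
move=> z z'; rewrite !inE; case: eqP => [->|_]; case: eqP => [->|_]; rewrite ?eqxx //=.
- by move=> _ zz _; apply: anti.
- by move=> zz _ _; rewrite anticomplete_sym // anti.
exact: h4.
Qed.

Lemma comb_cons_path b A s zs Lam at_ pos k :
  comb b A s zs Lam at_ pos -> k \in A -> ip e (k :: s) ->
  (forall y v, y \in zs -> v \in Lam y -> v != k /\ e v k = false) ->
  comb b A (k :: s) zs Lam at_ (fun z => (pos z).+1).
Proof.
move=> [[ips sA us pw] [h1 h2 h3 h4]] kA ipk hk.
have kns : k \notin s by case/ip_consP: ipk.
split; split=> //.
  by move=> x; rewrite inE => /predU1P[->|/sA].
move=> y v w yz vL; rewrite inE => /predU1P[->|ws].
  have [-> ->] := hk y v yz vL; split=> //.
  by rewrite index_head andbF andbF.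
by rewrite index_cons_in // !eqSS; apply: h3.
Qed.

Section Frame.
Variables X Y : {set V}.
Hypothesis frameXY : terminal_frame e X Y.
Let H := X :|: Y.

(** [cut_branch] yields a third neighbor of [u] in another component, anticomplete to [w] and [w'];
    to avoid a star, [w] and [w'] must be adjacent. *)
Lemma clique_blocks :
  (forall u w w' w'', u \in X -> w \in H -> w' \in H -> w'' \in H -> e u w -> e u w' -> e u w'' ->
     w != w' -> w != w'' -> w' != w'' -> [|| e w w', e w w'' | e w' w'']) ->
  forall u w w', u \in X -> w \in H -> w' \in H -> e u w -> e u w' -> w != w' ->
    connect (induced e (H :\ u)) w w' -> e w w'.
Proof.
move=> nostar u w w' uX wH w'H uw uw' ww' cww'.
have wHu : w \in H :\ u by rewrite in_setD1 wH andbT; apply: contraTneq uw => ->; rewrite girr.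
have [C [y [_ sC /touchP[a aC ua] _ /anticompleteP anti]]] := cut_branch gsym frameXY uX wHu.
have aH : a \in H by have /setD1P[] := subsetP sC a aC.
have [naw eaw] := anti a w aC (component_self _ _ _).
have w'c : w' \in component e (H :\ u) w by rewrite inE.
have [naw' eaw'] := anti a w' aC w'c.
by have := nostar u a w w' uX aH wH w'H ua uw uw' naw naw' ww'; rewrite eaw eaw'.
Qed.

(** Two neighbors of [u] in one component close a hole through [u]. Without triangles it contains a
    vertex [v] not adjacent to [u] and following [w]. Both [u] and [v] are cut vertices with a
    branch off this hole, and [B] connects the two branches into the third path of a theta. *)
Lemma tree_blocks B : (forall S, ~ theta e S) ->
  conn e B -> anticomplete e X B -> (forall y, y \in Y -> touch e B y) ->
  (forall w w' w'', w \in H -> w' \in H -> w'' \in H -> e w w' -> e w w'' -> ~~ e w' w'') ->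
  forall u w w', u \in X -> w \in H -> w' \in H -> e u w -> e u w' -> w != w' ->
    ~ connect (induced e (H :\ u)) w w'.
Proof.
move=> notheta cB /anticompleteP XB tB notri u w w' uX wH w'H uw uw' ww' cww'.
have uH : u \in H by rewrite inE uX.
have ne x z : e x z -> x != z by apply: contraTneq => ->; rewrite girr.
have wHu : w \in H :\ u by rewrite in_setD1 wH andbT eq_sym ne.
have sHu := subsetP (component_sub e wHu).
set D := component e (H :\ u) w in sHu.
have inX x : x \in H -> e x u -> x \in D -> x \in X.
  move=> xH xu xD; have [z zD zx] : exists2 z, z \in D & z != x.
    have [xw|xw] := eqVneq x w; first by exists w'; rewrite ?inE // xw eq_sym.
    by exists w; rewrite ?component_self // eq_sym.
  have [|//|//||a [b [/set1P-> _ bD bx xb]]] :=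
    conn_leave (T := [set x]) (x := x) (y := z) (component_conn gsym wHu).
  - exact: set11.
  - by rewrite inE.
  have /setD1P[bu bH] := sHu b bD.
  exact: frame_two_nbrs frameXY _ _ _ xH bH uH bu xb xu.
have wX : w \in X by apply: inX; rewrite ?component_self // gsym.
have w'D : w' \in D by rewrite inE.
have w'X : w' \in X by apply: inX; rewrite // gsym.
have cDX : conn e (D :\: (D :&: Y)).
  apply: (conn_minus_leaves gsym frameXY (x := w)).
  - by apply/subsetP => x /sHu /setD1P[].
  - exact: component_conn.
  - exact: subsetIr.
  - exact: component_self.
  by rewrite inE (negPf (frame_notY frameXY wX)) andbF.
have wDX : w \in D :\: (D :&: Y) by rewrite in_setD in_setI negb_and (frame_notY frameXY wX) orbT component_self.
have w'DX : w' \in D :\: (D :&: Y) by rewrite 2!inE w'D (negPf (frame_notY frameXY w'X)).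
have [s [ips ls sD]] := conn_ip cDX wDX w'DX.
have {}sD x : x \in w :: s -> x \in D /\ x \in X.
  move=> /sD; rewrite 2!inE => /andP[nY xD]; split=> //.
  by have := sHu x xD; rewrite in_setD1 inE; case: (x \in Y) nY; rewrite ?xD ?orbF // => _ /andP[].
have hs : has (e u) s.
  apply/hasP; exists w' => //; case: (s) ls => [/= h|z s' <- /=]; last exact: mem_last.
  by rewrite h eqxx in ww'.
(* The path from [w] is stopped at the first further neighbor [z] of [u], so that it closes up with
   [u] without chords. *)
case: (split_find hs) ips sD => z s1 s2 uz ns1 ips sD.
have zD : z \in D /\ z \in X by apply: sD; rewrite inE mem_cat mem_rcons mem_head orbT.
have zH : z \in H by rewrite inE zD.2.
case: s1 ns1 ips sD => [|v s1] ns1 ips sD.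
  have wz : e w z by have /ip_consP[_ _ ->] := ips; rewrite /= ?mem_head ?eqxx.
  by have := notri u w z uH wH zH uw uz; rewrite wz.
have [vD vX] : v \in D /\ v \in X by apply: sD; rewrite !inE eqxx orbT.
have vH : v \in H by rewrite inE vX.
have /norP[nuv ns1'] : ~~ has (e u) (v :: s1) by [].
have /setD1P[vu _] := sHu v vD.
have {}ips : ip e (w :: v :: rcons s1 z) by move: ips; rewrite -cat_cons => /ip_catl.
have wv : e w v by case/ip_consP: ips => _ _ ->; rewrite ?mem_head // index_head.
have /ip_consP[wns ipvs hw] := ips.
have /ip_consP[vns ips1 hv] := ipvs.
have sub1 x : x \in rcons s1 z -> x \in D /\ x \in X.
  by move=> xs; apply: sD; rewrite !inE mem_cat xs !orbT.
have [Cu [yu [cCu sCu tCu [yuC yuY] /anticompleteP aCu]]] := cut_branch gsym frameXY uX wHu.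
have uHv : u \in H :\ v by rewrite in_setD1 uH andbT eq_sym.
have [Cv [yv [cCv sCv tCv [yvC yvY] /anticompleteP aCv]]] := cut_branch gsym frameXY vX uHv.
have wv' : w \in component e (H :\ v) u.
  by apply: component_closed (component_self _ _ _) _ uw; rewrite ?uHv // in_setD1 wH ne.
have sv' x : x \in rcons s1 z -> x \in component e (H :\ v) u.
  have zv : z \in component e (H :\ v) u.
    apply: component_closed (component_self _ _ _) _ uz => //.
    rewrite in_setD1 zH andbT; apply: contraNneq vns => <-.
    by rewrite mem_rcons mem_head.
  move=> xs; rewrite -(component_eq gsym zv) inE.
  apply: (connect_mono (S := [set x in rcons s1 z])).
    apply/subsetP => a; rewrite inE => as1; rewrite in_setD1.
    have [_ aX] := sub1 a as1; rewrite inE aX andbT.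
    by apply: contraNneq vns => <-.
  by apply: (ip_conn gsym ips1); rewrite inE // mem_rcons mem_head.
have s1n : s1 ++ [:: z] != [::] by case: (s1).
have cw : conn e [set w] by apply: conn1.
have cS2 : conn e [set x in rcons s1 z] := ip_conn gsym ips1.
(* The branch at [u] reaches a terminal, [B] leads to a terminal of the branch at [v], and this
   branch returns to [v]. *)
have cS3 : conn e (Cu :|: B :|: Cv).
  have cuB : conn e (Cu :|: B) by apply: connU_touch yuC (tB _ yuY).
  have /touchP[b bB yb] := tB _ yvY.
  by apply: (@connU _ e gsym _ _ b yv) => //; rewrite ?inE ?bB ?orbT //; right; rewrite gsym.
suff [S /notheta//] : exists S, theta e S.
apply: (theta_sets gsym girr (a := u) (b := v) cw cS2 cS3); rewrite ?touch1 ?touchU ?tCu ?tCv ?orbT //.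
- by rewrite eq_sym.
- by rewrite gsym.
- by apply/touchP; exists z; rewrite // inE mem_rcons mem_head.
- apply/touchP; exists (head z s1); first by rewrite inE; case: (s1) => [|a s1'] /=; rewrite ?mem_head.
  by rewrite hv; case: (s1) => [|a s1'] /=; rewrite ?mem_head ?eqxx.
- apply/anticompleteP => a x /set1P->; rewrite inE => xs.
  split; first by apply: contraNneq wns => ->; rewrite inE xs orbT.
  rewrite hw ?inE ?xs ?orbT //; apply/negbTE; rewrite index_eq0.
  by apply: contraNneq vns => <-.
- rewrite !(anticompleteUr gsym) -andbA; apply/and3P; split; apply/anticompleteP => a x /set1P-> xC.
  + by have [] := aCu x w xC (component_self _ _ _); rewrite eq_sym gsym.
  + exact: XB.
  by have [] := aCv x w xC wv'; rewrite eq_sym gsym.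
rewrite !(anticompleteUr gsym) -andbA; apply/and3P; split; apply/anticompleteP => a x; rewrite inE => as1 xC.
- by have [] := aCu x a xC (sub1 a as1).1; rewrite eq_sym gsym.
- by apply: XB xC; case: (sub1 a as1).
by have [] := aCv x a xC (sv' a as1); rewrite eq_sym gsym.
Qed.

Section Children.
Hypothesis blocks : forall u w w', u \in X -> w \in H -> w' \in H -> e u w -> e u w' ->
  w != w' -> connect (induced e (H :\ u)) w w' -> e w w'.

(** For [x] not adjacent to [k], let [z] be a vertex reached from [x] away from the neighbors of
    [k], with a neighbor [j] adjacent to [k]. Were [x] joined to [k] around [j], then [z] and [k]
    would be neighbors of [j] in one component, hence adjacent by [blocks]. *)
Lemma petal_cover k F x : petal e X Y k F -> x \in F -> x != k ->
  exists2 j, (j \in F) && e k j & x \in far e X Y k j.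
Proof.
move=> [kF sF cF clF] xF xk; have sFH := subsetP sF.
have [kx|kx] := boolP (e k x).
  exists x; first by rewrite xF.
  by apply: far_root; rewrite ?sFH // eq_sym.
set R := F :\: (k |: [set v | e k v]).
have xR : x \in R by rewrite !inE negb_or xk kx.
have sR v : v \in component e R x -> [/\ v \in F, v != k & ~~ e k v].
  by move=> /(subsetP (component_sub e xR)); rewrite !inE negb_or => /andP[/andP[]].
have [||||z [j [zT _ jF jT zj]]] := conn_leave (T := component e R x) (x := x) (y := k) cF => //.
- exact: component_self.
- by apply/negP => /sR[]; rewrite eqxx.
have [zF zk nkz] := sR z zT.
have jk : j != k by apply: contraNneq nkz => <-; rewrite gsym.
have kj : e k j.
  apply: contraNT jT => nkj; apply: component_closed xR zT _ zj.
  by rewrite !inE negb_or jk nkj.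
exists j; first by rewrite jF.
rewrite inE (sFH x xF) andbT; apply/negP; rewrite inE => ckx.
have jzx : connect (induced e (H :\ j)) x z.
  apply: connect_mono (component_conn gsym xR (component_self _ _ _) zT).
  apply/subsetP => v vT; have [vF _ nkv] := sR v vT; rewrite in_setD1 sFH // andbT.
  by apply: contraNneq nkv => ->.
have ejk : e j k by rewrite gsym.
have ejz : e j z by rewrite gsym.
case/negP: nkz; apply: (blocks (u := j)); rewrite ?sFH //.
- by apply: (frame_two_nbrs frameXY (x := j) (u := k) (v := z)); rewrite ?sFH // eq_sym.
- by rewrite eq_sym.
exact: connect_trans ckx jzx.
Qed.
(** Below a parent, the children of a vertex form a clique for [true] and a stable set for [false].
    The Boolean is that of [comb]: a sibling of the next path vertex is a tooth on an edge or on a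
    vertex. *)
Definition local_kind (b : bool) :=
  if b then
    forall u w w' w'', u \in X -> w \in H -> w' \in H -> w'' \in H ->
      e u w -> e u w' -> e u w'' -> w != w' -> w != w'' -> w' != w'' ->
      [|| e w w', e w w'' | e w' w'']
  else
    forall w w' w'', w \in H -> w' \in H -> w'' \in H ->
      e w w' -> e w w'' -> ~~ e w' w''.

Lemma far_child k j v : k \in H -> j \in H -> e k j -> v \in far e X Y k j ->
  v != k /\ e v k = (v == j).
Proof.
move=> kH jH kj vf; have [jf sf _ cl] := petal_far gsym girr frameXY kH jH kj.
have kf := far_parent e X Y k j.
split; first by apply: contraNneq kf => vk; rewrite -{1}vk.
have [->|vj] := eqVneq v j; first by rewrite gsym.
by apply: contraNF kf => vk; apply: cl vk.
Qed.

Lemma far_children_link k j j' u v : k \in H -> j \in H -> j' \in H -> e k j -> e k j' ->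
  j != j' -> u \in far e X Y k j -> v \in far e X Y k j' ->
  u != v /\ e u v = [&& u == j, v == j' & e j j'].
Proof.
move=> kH jH j'H kj kj' jj' uf vf.
have ne x z : e x z -> x != z by apply: contraTneq => ->; rewrite girr.
have [||-> h] := petals_link gsym (petal_far gsym girr frameXY kH jH kj)
  (petal_far gsym girr frameXY kH j'H kj') _ _ uf vf.
- by apply: far_nbr => //; apply: ne.
- by apply: far_nbr => //; [apply: ne | rewrite eq_sym].
split=> //; apply/idP/and3P => [/[dup] /h[-> ->] ->//|[/eqP-> /eqP->//]].
Qed.

(** All teeth sit at position 0 of the one-vertex path [[:: k]]; combs of kind [false] allow equal
    positions. *)
Lemma star_comb k js : k \in X -> uniq js ->
  (forall j, j \in js -> (j \in H) && e k j) ->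
  {in js &, forall j j', ~~ e j j'} ->
  exists zs Lam at_ pos, [/\ comb false X [:: k] zs Lam at_ pos, size zs = size js,
    {subset zs <= Y} &
    forall y, y \in zs -> exists2 j, j \in js & Lam y \subset far e X Y k j].
Proof.
move=> kX; have kH : k \in H by rewrite inE kX.
elim: js => [|j js IH] /= ujs hjs stjs.
  exists [::], (fun=> set0), id, (fun=> 0); split=> //; split; split=> //.
  by move=> x; rewrite inE => /eqP->.
case/andP: ujs => jjs ujs.
have [||zs [Lam [at_ [pos [cmb sz zsY hL]]]]] := IH ujs.
- by move=> j' j'js; apply: hjs; rewrite inE j'js orbT.
- by move=> x z xs zs; apply: stjs; rewrite inE ?xs ?zs orbT.
have /andP[jH kj] := hjs j (mem_head _ _).
have [y [L [yY yL jL sL [cL LX]]]] := far_leg gsym girr frameXY kH jH kj.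
have anti y' : y' \in zs -> anticomplete e L (Lam y').
  move=> /hL[j' j'js /subsetP sL']; apply/anticompleteP => u v uL vL.
  have /andP[j'H kj'] : (j' \in H) && e k j' by apply: hjs; rewrite inE j'js orbT.
  have jj' : j != j' by apply: contraNneq jjs => ->.
  have [-> ->] := far_children_link kH jH j'H kj kj' jj' (subsetP sL u uL) (sL' v vL).
  split=> //; apply/and3P => -[_ _]; apply/negP; apply: stjs; rewrite ?mem_head //.
  by rewrite inE j'js orbT.
have yzs : y \notin zs.
  apply/negP => yz; have /anticompleteP/(_ y y yL) := anti y yz.
  have [_ [/(_ y yz)[yLam _ _ _] _ _ _]] := cmb.
  by move=> /(_ yLam)[]; rewrite eqxx.
eexists (y :: zs), _, _, _; split.
- apply: (comb_cons_tooth (n := 0) cmb yzs yL jL LX cL) => // v w vL.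
  rewrite inE => /eqP->; rewrite index_head eqxx andbT.
  exact: far_child kH jH kj (subsetP sL v vL).
- by rewrite /= sz.
- by move=> x; rewrite inE => /predU1P[->|/zsY].
move=> z; rewrite inE; case: eqP => [_ _|_ /=].
  by exists j; rewrite ?mem_head.
by move=> /hL[j' j'js sL']; exists j'; rewrite // inE j'js orbT.
Qed.

Section Recursion.
Variables (b : bool) (t m : nat).
Hypothesis kind : local_kind b.
Hypothesis small_clique : forall K : {set V}, clique e K -> #|K| < t.
Let d := maxn t m.

Lemma clique_pairwise (K : {set V}) :
  {in K &, forall x y, x != y -> e x y} -> clique e K.
Proof.
move=> h; apply/forall_inP => x xK; apply/forall_inP => y yK; apply/implyP.
exact: h.
Qed.

(** Induction on the petal, descending to a child with many terminals. A level with at least two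
    children costs a factor [d] and yields one tooth, a leg through a sibling; a level with one
    child costs nothing. The path starts at [k] and stays in [F] so that the parent can be
    prepended. *)
Lemma comb_in_petal r k F c : petal e X Y k F -> k \in X -> c \in H -> c \notin F ->
  e c k -> d ^ r < #|F :&: Y| ->
  (exists s zs Lam at_ pos, [/\ comb b X s zs Lam at_ pos, size zs = m & {subset zs <= Y}]) \/
  (exists s zs Lam at_ pos, [/\ comb b X (k :: s) zs Lam at_ pos, size zs = r,
     {subset k :: s <= F}, {subset zs <= Y} & forall y, y \in zs -> Lam y \subset F]).
Proof.
have [n] := ubnP #|F|; elim: n r k F c => // n IH r k F c ltF pF kX cH cF ck big.
have [kF sF cnF clF] := pF; have sFH := subsetP sF; have kH := sFH k kF.
have ne x z : e x z -> x != z by apply: contraTneq => ->; rewrite girr.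
have d0 : 0 < d.
  rewrite /d leq_max (leq_ltn_trans _ (small_clique (K := set0) _)) //.
  by apply/forall_inP => x; rewrite inE.
case: r => [|r] in big *.
  right; exists [::], [::], (fun=> set0), id, (fun=> 0); split=> //.
    by split; split=> // x; rewrite inE => /eqP->.
  by move=> x; rewrite inE => /eqP->.
pose J := [set j in F | e k j].
have JH j : j \in J -> j \in H by rewrite inE => /andP[/sFH].
have Jk j : j \in J -> e k j by rewrite inE => /andP[].
(* For kind [true], the parent [c] is a neighbor of [k] adjacent to no child, so two nonadjacent
   children would complete a star. *)
have Jadj j j' : j \in J -> j' \in J -> j != j' -> e j j' = b.
  move=> jJ j'J jj'; have cj i : i \in J -> e c i = false.
    rewrite inE => /andP[iF ki]; apply: contraNF cF => ci.
    by apply: (clF i) => //; rewrite 1?gsym // eq_sym ne.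
  have cn i : i \in J -> c != i by rewrite inE => /andP[iF _]; apply: contraNneq cF => ->.
  move: kind; rewrite /local_kind; case: (b) => kd.
    have := kd k c j j' kX cH (JH j jJ) (JH j' j'J).
    by rewrite gsym ck !Jk ?cn // !cj //= => ->.
  by apply/negbTE; exact: (kd k j j' kH (JH j jJ) (JH j' j'J) (Jk j jJ) (Jk j' j'J)).
have far_sub j : j \in J -> far e X Y k j \subset F.
  move=> jJ; have [jf sf cf _] := petal_far gsym girr frameXY kH (JH j jJ) (Jk j jJ).
  apply: (petal_sub pF cf sf jf); first by move: jJ; rewrite inE => /andP[].
  exact: far_parent.
have [/andP[nb leJ]|/nandP leJ] := boolP (~~ b && (m <= #|J|)).
  left; have [//||||zs [Lam [at_ [pos [cmb sz zsY _]]]]] := star_comb (k := k) (js := take m (enum J)).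
  - by rewrite take_uniq ?enum_uniq.
  - by move=> j /mem_take; rewrite mem_enum => jJ; rewrite JH ?Jk.
  - move=> j j' /mem_take; rewrite mem_enum => jJ /mem_take; rewrite mem_enum => j'J.
    by have [->|jj'] := eqVneq j j'; rewrite ?girr // Jadj.
  exists [:: k], zs, Lam, at_, pos; rewrite (negbTE nb); split=> //.
  by rewrite sz size_takel // -cardE.
(* Children forming a clique number fewer than [t], stable ones fewer than [m] by the previous case:
   the origin of [maxn t m]. *)
have Jd : #|J| <= d.
  case: leJ => [bT|]; last by rewrite -ltnNge /d leq_max => /ltnW->; rewrite orbT.
  have : #|J| < t.
    by apply/small_clique/clique_pairwise => x y xJ yJ xy; rewrite Jadj // (negbNE bT).
  by rewrite /d leq_max => /ltnW->.
pose f y := odflt k [pick j in J | y \in far e X Y k j].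
have fP y : y \in F :&: Y -> f y \in J /\ y \in far e X Y k (f y).
  move=> /setIP[yF yY]; rewrite /f; case: pickP => [j /andP[]//|no].
  have [|j /andP[jF kj] yj] := petal_cover pF yF.
    by apply: contraTneq yY => ->; exact: (frame_notY frameXY kX).
  by have := no j; rewrite !inE jF kj /=; rewrite !inE in yj; rewrite yj.
have [||j jJ ltj] := pigeonhole_fun (f := f) (ss := enum J) (n := d ^ r) (s := enum (F :&: Y)).
- by move=> y; rewrite !mem_enum => /fP[].
- by rewrite -!cardE; apply: leq_ltn_trans big; rewrite expnS leq_mul2r Jd orbT.
rewrite mem_enum in jJ; have [jH kj] := (JH j jJ, Jk j jJ).
have {}ltj : d ^ r < #|far e X Y k j :&: Y|.
  apply: leq_trans ltj _; rewrite -size_filter cardE; apply: uniq_leq_size.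
    by rewrite filter_uniq ?enum_uniq.
  move=> y; rewrite mem_filter !mem_enum => /andP[/eqP fy yFY].
  have [_] := fP y yFY; rewrite fy => yf.
  by apply/setIP; split=> //; case/setIP: yFY.
have pj := petal_far gsym girr frameXY kH jH kj; have [jf sf cf clf] := pj.
have kf := far_parent e X Y k j.
have dr : 0 < d ^ r by rewrite expn_gt0 d0.
have jX : j \in X.
  have := jH; rewrite inE => /orP[//|jY].
  have := leq_ltn_trans dr ltj; rewrite (far_leaf gsym girr frameXY kH jY kj) => gt1.
  by have := subset_leq_card (subsetIl [set j] Y); rewrite cards1 leqNgt gt1.
have ltfF : #|far e X Y k j| < n.
  rewrite -ltnS; apply: leq_trans ltF; rewrite ltnS.
  apply: proper_card; apply/properP; split; first exact: far_sub.
  by exists k.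
have prepend s zs Lam at_ pos : comb b X (j :: s) zs Lam at_ pos ->
    {subset j :: s <= far e X Y k j} ->
    (forall y, y \in zs -> Lam y \subset far e X Y k j) ->
    comb b X (k :: j :: s) zs Lam at_ (fun z => (pos z).+1).
  move=> cmb ssub Lsub; case: (cmb) => [[ips _ _ _] [_ _ h3 _]].
  apply: comb_cons_path => //.
    apply/ip_consP; split=> //; first by apply: contra kf => /ssub.
    move=> w ws; rewrite index_eq0 gsym.
    by case: (far_child kH jH kj (ssub w ws)).
  move=> y v yz vL; have [-> ->] := far_child kH jH kj (subsetP (Lsub y yz) v vL).
  split=> //; apply/negbTE.
  by have [] := h3 y v j yz vL (mem_head _ _).
(* A leg through the sibling [j2] becomes a tooth at position 0. It meets [k], and for kind [true]
   also the next path vertex [j]. *)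
have [/exists_inP[j2 j2J j2j]|/exists_inPn no2] := boolP [exists j2 in J, j2 != j].
  have [|] := IH r j (far e X Y k j) k ltfF pj jX kH kf kj ltj; first by left.
  case=> s [zs [Lam [at_ [pos [cmb sz ssub zsY Lsub]]]]]; right.
  have [j2H kj2] := (JH j2 j2J, Jk j2 j2J).
  have [y [L [yY yL j2L sL [cL LX]]]] := far_leg gsym girr frameXY kH j2H kj2.
  have link u v : u \in L -> v \in far e X Y k j -> u != v /\ e u v = [&& u == j2, v == j & b].
    move=> uL vf; rewrite -(Jadj _ _ j2J jJ j2j).
    exact: far_children_link (subsetP sL u uL) vf.
  case: (cmb) => [[ips _ _ _] [h1 _ h3 _]].
  have anti y' : y' \in zs -> anticomplete e L (Lam y').
    move=> y'z; apply/anticompleteP => u v uL vL.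
    have [-> ->] := link u v uL (subsetP (Lsub y' y'z) v vL); split=> //.
    have [/negbTE-> _] := h3 y' v j y'z vL (mem_head _ _).
    by rewrite andbF.
  have yzs : y \notin zs.
    apply/negP => yz; have /anticompleteP/(_ y y yL) := anti y yz.
    by case: (h1 y yz) => -> _ _ _ /(_ isT)[]; rewrite eqxx.
  eexists (j :: s), (y :: zs), _, _, _; split.
  - apply: (comb_cons_tooth (n := 0) (prepend _ _ _ _ _ cmb ssub Lsub) yzs yL j2L LX cL) => //.
    + by case: (b).
    + move=> v w vL; rewrite inE => /predU1P[->|ws].
        rewrite index_head eqxx andbT.
        exact: far_child kH j2H kj2 (subsetP sL v vL).
      rewrite index_cons_in; last exact: ws.
        rewrite eqSS index_eq0 /= [b && _]andbC.
        by apply: link => //; apply: ssub.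
      by apply: contra kf => /ssub.
    by move=> y' _; case: (b).
  - by rewrite /= sz.
  - move=> x; rewrite inE => /predU1P[->//|/ssub]; exact: (subsetP (far_sub j jJ)).
  - by move=> x; rewrite inE => /predU1P[->|/zsY].
  move=> z; rewrite inE; case: eqP => [_ _|_ /= zz].
    exact: subset_trans sL (far_sub j2 j2J).
  exact: subset_trans (Lsub z zz) (far_sub j jJ).
have big' : d ^ r.+1 < #|far e X Y k j :&: Y|.
  apply: leq_trans big (subset_leq_card _); apply/subsetP => y yFY.
  have [fJ yf] := fP y yFY; rewrite inE (setIP yFY).2 andbT.
  by have := no2 _ fJ; rewrite negbK => /eqP <-.
have [|] := IH r.+1 j (far e X Y k j) k ltfF pj jX kH kf kj big'; first by left.
case=> s [zs [Lam [at_ [pos [cmb sz ssub zsY Lsub]]]]]; right.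
exists (j :: s), zs, Lam, at_, (fun z => (pos z).+1); split=> //.
- exact: prepend.
- move=> x; rewrite inE => /predU1P[->//|/ssub]; exact: (subsetP (far_sub j jJ)).
by move=> y yz; apply: subset_trans (Lsub y yz) (far_sub j jJ).
Qed.

Lemma comb_in_frame : (d ^ m).+1 < #|Y| ->
  exists s zs Lam at_ pos, [/\ comb b X s zs Lam at_ pos, size zs = m & {subset zs <= Y}].
Proof.
move=> big; have [y0 y0Y] : exists y, y \in Y by apply/set0Pn; rewrite -card_gt0; lia.
(* Rooting at a terminal [y0] leaves every other terminal beyond its neighbor [k]; only [y0] is lost
   in the count. *)
have [k kX hk] := frame_leaf frameXY y0Y.
have kH : k \in H by rewrite inE kX.
have y0H : y0 \in H by rewrite inE y0Y orbT.
have y0k : e y0 k by rewrite hk ?eqxx.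
have ny0k : y0 != k by apply: contraTneq y0k => ->; rewrite girr.
have pk := petal_far gsym girr frameXY y0H kH y0k.
have y0Hk : y0 \in H :\ k by rewrite in_setD1 ny0k.
have [||[s [zs [Lam [at_ [pos [cmb sz _ zsY _]]]]]]] :=
  comb_in_petal (r := m) pk kX y0H (far_parent _ _ _ _ _) y0k; last 1 first.
- by exists (k :: s), zs, Lam, at_, pos.
- have sub : Y :\ y0 \subset far e X Y y0 k :&: Y.
    apply/subsetP => y /setD1P[yy0 yY]; rewrite inE yY andbT inE.
    have -> /= : y \in X :|: Y by rewrite inE yY orbT.
    rewrite andbT; apply/negP => yc.
    have [||||a [b' [/set1P-> _ bc _]]] := conn_leave (T := [set y0]) (x := y0) (y := y)
      (component_conn gsym y0Hk) => //.
    + exact: set11.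
    + exact: component_self.
    + by rewrite inE.
    have /setD1P[bk bH] := subsetP (component_sub e y0Hk) b' bc.
    by rewrite hk // (negPf bk).
  have := subset_leq_card sub; have := cardsD1 y0 Y; rewrite y0Y; lia.
by [].
Qed.

End Recursion.

End Children.

End Frame.
End Combs.

(** * Ladders and generalized pyramids *)

Section Ladder.
Variables (V : finType) (e : rel V).
Hypotheses (gsym : symmetric e) (girr : irreflexive e).
Implicit Types (A B G : {set V}) (u v w x y z : V) (s p q zs : seq V).

Lemma ip_cat_nonempty x0 s s' : ip e s -> ip e s' -> s != [::] -> s' != [::] ->
  (forall u v, u \in s -> v \in s' ->
     u != v /\ e u v = (u == last x0 s) && (v == head x0 s')) ->
  ip e (s ++ s').
Proof. by case: s => // a s; case: s' => // b s' i1 i2 _ _; apply: ip_cat. Qed.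

Lemma hole_cat_nonempty x0 s s' : ip e s -> ip e s' -> 3 <= size s -> s' != [::] ->
  (forall u v, u \in s -> v \in s' -> u != v /\
     e u v = (u == head x0 s) && (v == head x0 s') || (u == last x0 s) && (v == last x0 s')) ->
  hole e ([set x in s] :|: [set x in s']).
Proof.
case: s => // a s; case: s' => // b s' i1 i2 sz _; apply: hole_cat => //.
  by move: sz => /=; lia.
by move: sz => /=; lia.
Qed.

Lemma seg_head x0 p i j w : uniq p -> i < j <= size p -> w \in seg p i j ->
  (w == head x0 (seg p i j)) = (index w p == i).
Proof.
move=> up /andP[ij jp] ws; have us := seg_uniq i j up; have := ws.
rewrite mem_seg // => /and3P[wp iw wj].
have sz := size_seg i jp; case def_s: (seg p i j) ws sz us => [|a s] // ws sz us.
rewrite [head _ _]/= -(index_eq0 a w s) -def_s index_seg ?def_s // subn_eq0.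
by rewrite eqn_leq iw andbT.
Qed.

Lemma seg_last x0 p i j w : uniq p -> i < j <= size p -> w \in seg p i j ->
  (w == last x0 (seg p i j)) = ((index w p).+1 == j).
Proof.
move=> up /andP[ij jp] ws; have us := seg_uniq i j up; have := ws.
rewrite mem_seg // => /and3P[wp iw wj].
have sz := size_seg i jp; case def_s: (seg p i j) ws sz us => [|a s] // ws sz us.
rewrite [last _ _]/= -(index_last_eq us ws) -def_s index_seg ?def_s // sz.
by apply/eqP/eqP; lia.
Qed.

(** The first and last rungs, with the stretches of [p] and [q] between them, form the hole, both
    rungs being absorbed into [P]; this is why [k.+2] rungs are needed. Steps of 2 along [p] keep
    consecutive feet disjoint; along [q] feet may coincide. *)
Lemma ladder k p q zs (G : V -> {set V}) (a b : V -> V) (c d : V -> nat) :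
  ip e p -> ip e q -> anticomplete e [set x in p] [set x in q] ->
  uniq zs -> size zs = k.+2 ->
  pairwise (fun y y' => c y + 2 <= c y') zs -> pairwise (fun y y' => d y <= d y') zs ->
  (forall y, y \in zs ->
     [/\ conn e (G y), a y \in G y, b y \in G y, (c y).+1 < size p & d y < size q]) ->
  (forall y v w, y \in zs -> v \in G y -> w \in p -> v != w /\
     e v w = (v == a y) && ((index w p == c y) || (index w p == (c y).+1))) ->
  (forall y v w, y \in zs -> v \in G y -> w \in q -> v != w /\
     e v w = (v == b y) && (index w q == d y)) ->
  (forall y y', y \in zs -> y' \in zs -> y != y' -> anticomplete e (G y) (G y')) ->
  exists S, generalized_pyramid e k S.
Proof.
move=> ipp ipq /anticompleteP pq uz szz pwc pwd hG hp hq anti.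
have [x0 x0z] : exists x0, x0 \in zs by case: (zs) szz => // x s _; exists x; apply: mem_head.
have up := ip_uniq ipp; have uq := ip_uniq ipq.
pose z i := nth x0 zs i.
have zz i : i < k.+2 -> z i \in zs by move=> ik; rewrite mem_nth ?szz.
have zc i j : i < j -> j < k.+2 -> c (z i) + 2 <= c (z j).
  by move=> ij jk; apply: (pairwiseP x0 pwc); rewrite ?inE ?szz ?(ltn_trans ij jk).
have zd i j : i <= j -> j < k.+2 -> d (z i) <= d (z j).
  rewrite leq_eqVlt => /predU1P[->//|ij jk].
  by apply: (pairwiseP x0 pwd); rewrite ?inE ?szz ?(ltn_trans ij jk).
have zne i j : i < k.+2 -> j < k.+2 -> i != j -> z i != z j.
  by move=> ik jk; rewrite nth_uniq ?szz.
have [r hr] : {r : V -> seq V & forall y, y \in zs ->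
    [/\ ip e (a y :: r y), last (a y) (r y) = b y & {subset a y :: r y <= G y}]}.
  apply: (@choice _ _ (fun y s => y \in zs -> [/\ ip e (a y :: s), last (a y) s = b y &
    {subset a y :: s <= G y}])) => y; have [yz|] := boolP (y \in zs); last by exists [::].
  have [cG aG bG _ _] := hG y yz.
  by have [s hs] := conn_ip cG aG bG; exists s.
pose f := z 0; pose l := z k.+1.
have fz : f \in zs by apply: zz.
have lz : l \in zs by apply: zz.
have fl : f != l by apply: zne.
have cfl : c f + 2 <= c l by apply: zc.
have dfl : d f <= d l by apply: zd.
have [ipf lf sf] := hr f fz; have [ipl ll sl] := hr l lz.
have [_ _ _ clp dlq] := hG l lz.
(* From the second foot of the first rung to the first foot of the last one, so each extreme rung
   meets [ps] in a single vertex. *)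
pose ps := seg p (c f).+1 (c l).+1.
have psE w : (w \in ps) = (w \in p) && (c f < index w p <= c l) by rewrite mem_seg.
have szps : size ps = c l - c f by rewrite size_seg ?subSS // ltnW.
have psn : ps != [::] by rewrite -size_eq0 szps -lt0n subn_gt0; move: cfl; clear; lia.
have rngp : c f < c l < size p by move: cfl clp; clear; lia.
pose Rf := a f :: r f; pose Rl := a l :: r l.
pose P := rev Rf ++ ps ++ Rl.
(* Both extreme feet are included; this is a single vertex when they coincide. *)
pose Q := seg q (d f) (d l).+1.
have QE w : (w \in Q) = (w \in q) && (d f <= index w q <= d l) by rewrite mem_seg.
have szQ : size Q = (d l).+1 - d f by rewrite size_seg.
have Qn : Q != [::] by rewrite -size_eq0 szQ -lt0n subn_gt0 ltnS.
have dG y y' u v : y \in zs -> y' \in zs -> y != y' -> u \in G y -> v \in G y' ->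
    u != v /\ e u v = false.
  by move=> yz y'z yy' uG vG; have /anticompleteP := anti y y' yz y'z yy'; apply.
have PE w : (w \in P) = [|| w \in Rf, w \in ps | w \in Rl].
  by rewrite !mem_cat mem_rev.
have lastrev : last x0 (rev Rf) = a f by rewrite rev_cons last_rcons.
have headrev : head x0 (rev Rf) = b f.
  by rewrite /Rf lastI rev_rcons /= lf.
have lastps w : w \in ps -> (w == last x0 ps) = (index w p == c l).
  by move=> wps; rewrite (seg_last _ up _ wps) ?eqSS //; move: cfl clp; clear; lia.
have headps w : w \in ps -> (w == head x0 ps) = (index w p == (c f).+1).
  by move=> wps; rewrite (seg_head _ up _ wps) //; move: cfl clp; clear; lia.
have ippl : ip e (ps ++ Rl).
  apply: (ip_cat_nonempty (x0 := x0)) => //; first exact: ip_seg.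
  move=> u v; move=> /[dup] ups; rewrite psE => /and3P[upp _ ul] /sl vG.
  have [nvu evu] := hp l v u lz vG upp.
  rewrite eq_sym gsym nvu evu lastps // andbC; split=> //; congr andb.
  have -> : (index u p == (c l).+1) = false by apply/negbTE; rewrite neq_ltn ltnS ul.
  by rewrite orbF.
have headpl : head x0 (ps ++ Rl) = head x0 ps by case: (ps) psn.
have ipP : ip e P.
  apply: (ip_cat_nonempty (x0 := x0)) => //.
  - exact: ip_rev.
  - by rewrite -size_eq0 size_rev.
  - by case: (ps).
  move=> u v; rewrite mem_rev lastrev headpl => /sf uG.
  rewrite mem_cat => /orP[/[dup] vps|/sl vG].
    rewrite psE => /and3P[vp vf _]; have [-> ->] := hp f u v fz uG vp.
    rewrite headps //; split=> //; congr andb.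
    by have -> : (index v p == c f) = false by apply/negbTE; rewrite neq_ltn vf orbT.
  have [-> ->] := dG f l u v fz lz fl uG vG; split=> //; apply/esym/negbTE/negP.
  move=> /andP[_ /eqP vh]; have : v \in ps by rewrite vh; case: (ps) psn => // *; apply: mem_head.
  by rewrite psE => /andP[vp _]; have [] := hp l v v lz vG vp; rewrite eqxx.
have ipQ : ip e Q by apply: ip_seg.
have headP : head x0 P = b f by rewrite /P; case: (rev Rf) headrev (size_rev Rf).
have lastP : last x0 P = b l by rewrite /P !last_cat /= ll.
have headQ w : w \in Q -> (w == head x0 Q) = (index w q == d f).
  by move=> wQ; rewrite (seg_head _ uq _ wQ) // ltnS dfl.
have lastQ w : w \in Q -> (w == last x0 Q) = (index w q == d l).
  by move=> wQ; rewrite (seg_last _ uq _ wQ) ?eqSS // ltnS dfl.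
have [cGf aGf bGf _ _] := hG f fz; have [cGl aGl bGl _ _] := hG l lz.
have holePQ : hole e ([set x in P] :|: [set x in Q]).
  apply: (hole_cat_nonempty (x0 := x0)) => //.
    by rewrite !size_cat size_rev szps /=; move: cfl; clear; lia.
  move=> u v; rewrite PE headP lastP => uP vQ.
  rewrite headQ ?lastQ //; have := vQ; rewrite QE => /andP[vq _].
  case/or3P: uP => [/sf uG|ups|/sl uG].
  - have [-> ->] := hq f u v fz uG vq; split=> //.
    have [/negbTE-> _] := dG f l u (b l) fz lz fl uG bGl.
    by rewrite orbF.
  - move: ups; rewrite psE => /andP[upp _].
    have [-> ->] : u != v /\ e u v = false by apply: pq; rewrite inE.
    have [nb _] := hp f (b f) u fz bGf upp; have [nb' _] := hp l (b l) u lz bGl upp.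
    by rewrite ![u == _]eq_sym (negbTE nb) (negbTE nb').
  have [-> ->] := hq l u v lz uG vq; split=> //.
  have [/negbTE nf _] := dG f l (b f) u fz lz fl bGf uG.
  by rewrite [u == b f]eq_sym nf.
have indexP w : w \in ps -> index w P = size Rf + (index w p - (c f).+1).
  move=> wps; rewrite index_cat size_rev mem_rev.
  have -> : (w \in Rf) = false.
    apply/negP => /sf wG; move: wps; rewrite psE => /andP[wp _].
    by have [] := hp f w w fz wG wp; rewrite eqxx.
  by rewrite index_cat wps index_seg.
have szP : size P = size Rf + (c l - c f) + size Rl.
  by rewrite !size_cat size_rev szps addnA.
pose g (i : 'I_k) := z i.+1.
have ltik (i : 'I_k) : i.+1 < k.+1 by rewrite ltnS.
have ltik2 (i : 'I_k) : i.+1 < k.+2 by apply: ltnW; rewrite ltnS.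
have gz i : g i \in zs by apply: zz.
have gf i : g i != f by apply: zne.
have gl i : g i != l by apply: zne => //; rewrite ltn_eqF.
have gc i : c f + 2 <= c (g i) /\ c (g i) + 2 <= c l by split; apply: zc.
have gd i : d f <= d (g i) <= d l by rewrite !zd // ltnW.
have gne i j : i != j -> g i != g j by move=> ij; apply: zne.
have lc i : (c (g i)).+1 < size p by have [_ _ _ + _] := hG _ (gz i).
have ld i : d (g i) < size q by have [_ _ _ _ +] := hG _ (gz i).
pose x i := nth x0 p (c (g i)); pose y i := nth x0 p (c (g i)).+1.
pose t i := nth x0 q (d (g i)).
have ix i : index (x i) p = c (g i) by rewrite index_uniq // (ltnW (lc i)).
have iy i : index (y i) p = (c (g i)).+1 by rewrite index_uniq // ?(ltnW (lc i)) ?lc.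
have it i : index (t i) q = d (g i) by rewrite index_uniq // ld.
have xp i : x i \in p by rewrite mem_nth // ?(ltnW (lc i)) ?lc.
have yp i : y i \in p by rewrite mem_nth // ?(ltnW (lc i)) ?lc.
have tq i : t i \in q by rewrite mem_nth // ld.
have xps i : x i \in ps by rewrite psE xp ix; have := gc i; clear; lia.
have yps i : y i \in ps by rewrite psE yp iy; have := gc i; clear; lia.
have tQ i : t i \in Q by rewrite QE tq it gd.
have midP i u w : u \in G (g i) -> w \in P ->
    u != w /\ e u w = (u == a (g i)) && ((w == x i) || (w == y i)).
  move=> uG; rewrite PE => /or3P[/sf wG|wps|/sl wG].
  - have [-> ->] := dG _ _ u w (gz i) fz (gf i) uG wG; split=> //.
    have [/negbTE nx _] := hp f w (x i) fz wG (xp i).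
    by have [/negbTE ny _] := hp f w (y i) fz wG (yp i); rewrite nx ny andbF.
  - have wp : w \in p by move: wps; rewrite psE => /andP[].
    have [-> ->] := hp (g i) u w (gz i) uG wp; split=> //.
    by rewrite -(iy i) -(ix i) !index_inj_in.
  have [-> ->] := dG _ _ u w (gz i) lz (gl i) uG wG; split=> //.
  have [/negbTE nx _] := hp l w (x i) lz wG (xp i).
  by have [/negbTE ny _] := hp l w (y i) lz wG (yp i); rewrite nx ny andbF.
have midQ i u w : u \in G (g i) -> w \in Q ->
    u != w /\ e u w = (u == b (g i)) && (w == t i).
  move=> uG; rewrite QE => /andP[wq _].
  have [-> ->] := hq (g i) u w (gz i) uG wq; split=> //.
  by rewrite -it index_inj_in.
pose R i := a (g i) :: r (g i).
have hR i : [/\ ip e (R i), last (a (g i)) (r (g i)) = b (g i) & {subset R i <= G (g i)}].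
  exact: hr.
have xP i : x i \in P by rewrite PE xps orbT.
have yP i : y i \in P by rewrite PE yps orbT.
exists ([set u in P] :|: [set u in Q] :|: \bigcup_i [set u in R i]).
exists P, Q, R, (fun i => a (g i)), (fun i => b (g i)), x, y, t.
have dRPQ i u w : u \in R i -> w \in [set u in P] :|: [set u in Q] -> u != w.
  have [_ _ sR] := hR i; move=> /sR uG; rewrite !inE => /orP[wP|wQ].
    by have [] := midP i u w uG wP.
  by have [] := midQ i u w uG wQ.
have dRR i j : i != j -> anticomplete e [set u in R i] [set u in R j].
  move=> ij; apply/anticompleteP => u w; rewrite !inE => uR wR.
  have [_ _ sR] := hR i; have [_ _ sR'] := hR j.
  by apply: (dG (g i) (g j)); rewrite ?gne // ?sR ?sR'.
have disjI A B : (forall u v, u \in A -> v \in B -> u != v) -> [disjoint A & B].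
  move=> h; rewrite -setI_eq0; apply/eqP/setP => u; rewrite !inE; apply/andP => -[uA uB].
  by have := h u u uA uB; rewrite eqxx.
split.
- split=> //; [apply: (ip_induced_path gsym girr) => // | apply: (ip_induced_path gsym girr) => // |].
    by rewrite -size_eq0 szP -lt0n addnS.
  move=> i; have [ipR lR _] := hR i; split=> //.
  by apply: (ip_induced_path gsym girr).
- split; last by move=> i j /dRR /andP[].
    apply: disjI => u v; rewrite !inE PE => /or3P[/sf uG|ups|/sl uG]; rewrite QE => /andP[vq _].
    + by have [] := hq f u v fz uG vq.
    + by have [] : u != v /\ e u v = false by apply: pq; rewrite inE //; move: ups; rewrite psE => /andP[].
    by have [] := hq l u v lz uG vq.
  by move=> i; apply: disjI => u w; rewrite inE; apply: dRPQ.
- by split.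
- move=> i; have [cG aG bG _ _] := hG (g i) (gz i).
  have interP w : w \in ps -> index w p < c l -> w \in interior P.
    move=> wps ltw; have := wps; rewrite psE => /and3P[wp wf _].
    by rewrite inE PE wps orbT indexP // szP /=; move: wf ltw; clear; lia.
  have gci := gc i; split.
  + apply/setP => w; rewrite !inE; have [wP|wP] := boolP (w \in P).
      by rewrite andbT; have [_ ->] := midP i _ w aG wP; rewrite eqxx.
    by rewrite andbF; apply/esym/norP; split; apply: contraNneq wP => ->.
  + split; [by apply: interP; rewrite // ix; move: gci; clear; lia | by apply: interP; rewrite // iy; move: gci; clear; lia |].
    by rewrite (ip_index gsym girr ipp) // ix iy eqxx.
  + apply/setP => w; rewrite !inE; have [wQ|wQ] := boolP (w \in Q).
      by rewrite andbT; have [_ ->] := midQ i _ w bG wQ; rewrite eqxx.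
    by rewrite andbF; apply/esym/negbTE; apply: contraNneq wQ => ->.
  apply/anticompleteP => u w; rewrite !inE => /andP[/norP[/negbTE ua /negbTE ub] uR].
  have [_ _ sR] := hR i; have uG := sR u uR.
  move=> /orP[/(midP i u w uG)|/(midQ i u w uG)] [-> ->]; by rewrite ?ua ?ub.
split.
- by move=> i; rewrite !indexP // ix iy; have := gc i; clear; lia.
- move=> i j ij; rewrite !indexP // ix iy.
  have : c (g i) + 2 <= c (g j) by apply: zc.
  have := gc i; clear; lia.
- move=> i j ij; apply/eqP => yx; have := iy i; rewrite yx ix.
  have : c (g i) + 2 <= c (g j) by apply: zc; rewrite // -ij.
  have := gc i; clear; lia.
move=> i j ij; have := tQ i; have := tQ j; rewrite /Q => tj ti.
rewrite !index_seg // !it leq_sub2r //.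
by apply: zd.
Qed.

Lemma index_rev_in p w : uniq p -> w \in p -> index w (rev p) = size p - (index w p).+1.
Proof.
elim: p => // a p IH /andP[ap up]; rewrite inE rev_cons -cats1 index_cat mem_rev size_rev.
have [wp _|wp] := boolP (w \in p); first by rewrite index_cons_in // IH.
by rewrite orbF => /eqP->; rewrite !index_head addn0 /=; lia.
Qed.

Lemma ladder_rev k p q zs (G : V -> {set V}) (a b : V -> V) (c d : V -> nat) :
  ip e p -> ip e q -> anticomplete e [set x in p] [set x in q] ->
  uniq zs -> size zs = k.+2 ->
  pairwise (fun y y' => c y + 2 <= c y') zs -> pairwise (fun y y' => d y' <= d y) zs ->
  (forall y, y \in zs ->
     [/\ conn e (G y), a y \in G y, b y \in G y, (c y).+1 < size p & d y < size q]) ->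
  (forall y v w, y \in zs -> v \in G y -> w \in p -> v != w /\
     e v w = (v == a y) && ((index w p == c y) || (index w p == (c y).+1))) ->
  (forall y v w, y \in zs -> v \in G y -> w \in q -> v != w /\
     e v w = (v == b y) && (index w q == d y)) ->
  (forall y y', y \in zs -> y' \in zs -> y != y' -> anticomplete e (G y) (G y')) ->
  exists S, generalized_pyramid e k S.
Proof.
move=> ipp ipq pq uz szz pwc pwd hG hp hq anti.
have uq := ip_uniq ipq.
apply: (@ladder k p (rev q) zs G a b c (fun y => size q - (d y).+1)) => //.
- exact: ip_rev.
- by rewrite (_ : [set x in rev q] = [set x in q]) //; apply/setP => x; rewrite !inE mem_rev.
- by apply: sub_pairwise pwd => y y' /=; lia.
- move=> y yz; have [? ? ? ? h] := hG y yz; split=> //.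
  by rewrite size_rev; case: (size q) h => // n _; rewrite subSS ltnS leq_subr.
move=> y v w yz vG; rewrite mem_rev => wq; have [_ _ _ _ dq] := hG y yz.
have [-> ->] := hq y v w yz vG wq; split=> //; congr andb.
rewrite index_rev_in //; have : index w q < size q by rewrite index_mem.
by move: dq; clear; move: (index w q) (size q) => i n ? ?; apply/eqP/eqP; lia.
Qed.

End Ladder.

(** * Monotone subsequences and attachments along a path *)

Lemma pairwise_comparable (T : eqType) (r : rel T) s x y : pairwise r s ->
  x \in s -> y \in s -> x != y -> r x y \/ r y x.
Proof.
elim: s => //= a s IH /andP[/allP ra /IH {}IH]; rewrite !inE.
case/predU1P=> [->|xs] /predU1P[->|ys]; rewrite ?eqxx // => xy; last exact: IH.
  by left; apply: ra.
by right; apply: ra.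
Qed.

(** For comparable elements the failure of [r x y] is [r y x], so Ramsey yields a monotone
    subsequence, in the manner of Erdos and Szekeres. *)
Lemma ramsey2_chain (T : eqType) (r : rel T) m s : uniq s ->
  {in s &, forall x y, x != y -> r x y \/ r y x} -> 2 ^ (m + m) <= size s ->
  exists s', [/\ subseq s' s, size s' = m &
    pairwise r s' \/ pairwise (fun x y => r y x) s'].
Proof.
move=> us cmp /(ramsey2 r)[s' ss [[sz hom]|[sz hom]]]; exists s'; split=> //.
  by left.
right; have m' := mem_subseq ss.
have : pairwise (fun x y => ~~ r x y && (x != y)) s'.
  by rewrite pairwise_relI hom -uniq_pairwise (subseq_uniq ss).
apply: (sub_in_pairwise (P := mem s')); last by apply/allP.
by move=> x y xs ys /= /andP[/negP nr]; case/(cmp x y (m' x xs) (m' y ys)).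
Qed.

Lemma pairwise_rev (T : Type) (r : rel T) s :
  pairwise r (rev s) = pairwise (fun x y => r y x) s.
Proof.
elim: s => //= a s IH; rewrite rev_cons -cats1 pairwise_cat IH /= andbT.
by rewrite allrel1r all_rev andbC.
Qed.

Lemma size_filter_mem (T : eqType) (s s' : seq T) : uniq s -> uniq s' ->
  {subset s' <= s} -> size (filter (mem s') s) = size s'.
Proof.
move=> us us' sub; apply/perm_size/uniq_perm; rewrite ?filter_uniq // => x.
by rewrite mem_filter andb_idr //; apply: sub.
Qed.

Section Spans.
Variables (V : finType) (e : rel V).
Hypotheses (gsym : symmetric e) (girr : irreflexive e).
Implicit Types (A B X W S : {set V}) (u v w x y z : V) (s p q zs : seq V).

Lemma stable_in zs y y' : stable e [set y in zs] -> y \in zs -> y' \in zs -> e y y' = false.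
Proof.
move=> /forall_inP st yz y'z; apply/negbTE.
have := st y; rewrite inE yz => /(_ isT)/forall_inP/(_ y').
by rewrite inE y'z; apply.
Qed.

Lemma stable_sub zs zs' : {subset zs' <= zs} -> stable e [set y in zs] ->
  stable e [set y in zs'].
Proof.
move=> sub st; apply/forall_inP => y; rewrite inE => /sub yz.
by apply/forall_inP => y'; rewrite inE => /sub y'z; rewrite (stable_in st).
Qed.

(** A Boolean, so that it can serve as a color in [ramsey2]. It is vacuous when [y] or [y'] has no
    neighbor on [p]. *)
Definition before p y y' :=
  all (fun w => all (fun w' => (e y w && e y' w') ==> (index w p < index w' p)) p) p.

Lemma beforeP p y y' :
  reflect (forall w w', w \in p -> w' \in p -> e y w -> e y' w' -> index w p < index w' p)
          (before p y y').
Proof.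
apply: (iffP allP) => [h w w' wp w'p yw yw'|h w wp].
  by have /allP/(_ w' w'p) := h w wp; rewrite yw yw'.
by apply/allP => w' w'p; apply/implyP => /andP[]; apply: h.
Qed.

(** On an induced path, two positions at distance at least 2 are two nonadjacent neighbors of
    [y]. *)
Definition wide p y :=
  has (fun w => has (fun w' => [&& e y w, e y w' & index w p + 2 <= index w' p]) p) p.

Lemma wideP p y :
  reflect (exists w w', [/\ w \in p, w' \in p, e y w, e y w' & index w p + 2 <= index w' p])
          (wide p y).
Proof.
apply: (iffP hasP) => [[w wp /hasP[w' w'p /and3P[]]]|[w [w' [wp w'p *]]]].
  by exists w, w'.
by exists w => //; apply/hasP; exists w' => //; apply/and3P.
Qed.

Lemma first_nbr p y : touch e [set x in p] y -> exists w, [/\ w \in p, e y w &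
  forall w', w' \in p -> e y w' -> index w p <= index w' p].
Proof.
case/touchP=> w0; rewrite inE => w0p yw0.
have h0 : (w0 \in p) && e y w0 by rewrite w0p.
case: (@arg_minnP _ w0 (fun w => (w \in p) && e y w) (fun w => index w p) h0) => w /andP[wp yw] minw.
by exists w; split=> // w' w'p yw'; apply: minw; rewrite w'p.
Qed.

Lemma last_nbr p y : touch e [set x in p] y -> exists w, [/\ w \in p, e y w &
  forall w', w' \in p -> e y w' -> index w' p <= index w p].
Proof.
case/touchP=> w0; rewrite inE => w0p yw0.
have h0 : (w0 \in p) && e y w0 by rewrite w0p.
case: (@arg_maxnP _ w0 (fun w => (w \in p) && e y w) (fun w => index w p) h0) => w /andP[wp yw] maxw.
by exists w; split=> // w' w'p yw'; apply: maxw; rewrite w'p.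
Qed.

Lemma not_wide_nbrs p y : ~~ wide p y -> 1 < #|nbh e y :&: [set x in p]| ->
  exists2 c, c.+1 < size p &
    forall w, w \in p -> e y w = (index w p == c) || (index w p == c.+1).
Proof.
move=> nw gt1.
have tp : touch e [set x in p] y.
  have /set0Pn[w] : nbh e y :&: [set x in p] != set0 by rewrite -card_gt0 ltnW.
  by rewrite !inE => /andP[yw wp]; apply/touchP; exists w; rewrite ?inE.
have [u [upp yu minu]] := first_nbr tp.
have ule w : w \in p -> e y w -> index w p <= (index u p).+1.
  move=> wp yw; rewrite leqNgt; apply: contra nw => lt; apply/wideP.
  by exists u, w; split=> //; rewrite addn2.
have [v /setD1P[vu]] : exists v, v \in (nbh e y :&: [set x in p]) :\ u.
  apply/set0Pn; rewrite -card_gt0.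
  by move: gt1; rewrite (cardsD1 u) !inE yu upp add1n ltnS.
rewrite !inE => /andP[yv vp].
have iv : index v p = (index u p).+1.
  apply/eqP; rewrite eqn_leq ule // ltn_neqAle minu // andbT.
  by rewrite index_inj_in // eq_sym.
exists (index u p); first by rewrite -iv index_mem.
move=> w wp; rewrite index_inj_in // -iv index_inj_in //.
apply/idP/orP => [yw|[/eqP->|/eqP->]] //.
rewrite -(index_inj_in wp upp) -(index_inj_in wp vp) iv; apply/orP.
have := minu w wp yw; have := ule w wp yw; clear.
by move: (index w p) (index u p) => i j; lia.
Qed.

(** [s] is the stretch of [p] from the last neighbor of [y] to the first neighbor of [y']. The last
    clause serves to show that [s] contains every neighbor of a vertex placed between [y] and
    [y']. *)
Lemma bridge p y y' : ip e p -> touch e [set x in p] y -> touch e [set x in p] y' ->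
  before p y y' -> exists s, [/\ ip e s, s != [::], {subset s <= p},
    forall x0 w, w \in s -> e y w = (w == head x0 s) /\ e y' w = (w == last x0 s) &
    (forall w u, w \in s -> u \in p -> (e y u -> index u p <= index w p) /\
                                      (e y' u -> index w p <= index u p)) /\
    (forall w, w \in p -> (forall u, u \in p -> e y u -> index u p < index w p) ->
       (forall u, u \in p -> e y' u -> index w p < index u p) -> w \in s)].
Proof.
move=> ipp ty ty' /beforeP bef; have up := ip_uniq ipp.
have [r [rp yr maxr]] := last_nbr ty; have [l [lp yl minl]] := first_nbr ty'.
have lt := bef r l rp lp yr yl.
have rng : index r p < (index l p).+1 <= size p by rewrite ltnS ltnW //= index_mem.
exists (seg p (index r p) (index l p).+1); split.
- exact: ip_seg.
- rewrite -size_eq0 size_seg; last by case/andP: rng.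
  by move: lt; clear; lia.
- by move=> w; rewrite mem_seg // => /andP[].
- move=> x0 w ws; rewrite (seg_head _ up rng ws) (seg_last _ up rng ws) eqSS.
  have := ws; rewrite mem_seg // ltnS => /and3P[wp rw wl]; split.
    rewrite index_inj_in //; apply/idP/eqP => [yw|-> //].
    apply/eqP; rewrite -(index_inj_in wp rp) eqn_leq rw andbT; exact: maxr.
  rewrite index_inj_in //; apply/idP/eqP => [yw|-> //].
  by apply/eqP; rewrite -(index_inj_in wp lp) eqn_leq wl /=; apply: minl.
split=> [w u|w wp hr hl].
  rewrite mem_seg // ltnS => /and3P[wp rw wl] upp; split=> [yu|yu].
    exact: leq_trans (maxr u upp yu) rw.
  exact: leq_trans wl (minl u upp yu).
by rewrite mem_seg // wp ltnS ltnW ?hr // ltnW // hl.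
Qed.

(** A largest connected proper subset of [X] above [W] misses one vertex only, since a vertex
    adjacent to it can be added. *)
Lemma conn_extend X W w0 : conn e X -> conn e W -> w0 \in W -> W \proper X ->
  exists2 x, x \in X :\: W & conn e (X :\ x).
Proof.
move=> cX cW w0W pW.
pose P (S : {set V}) := [&& W \subset S, S \proper X & `[< conn e S >]].
have PW : P W by rewrite /P subxx pW /=; apply/asboolP.
case: (arg_maxnP (fun S : {set V} => #|S|) PW) => S /and3P[WS SX /asboolP cS] maxS.
have /properP[sSX [x' x'X x'S]] := SX.
have w0S := subsetP WS w0 w0W.
have [a [x [aS _ xX xS ax]]] := conn_leave cX w0S (subsetP sSX w0 w0S) x'X x'S.
have cxS : conn e (x |: S).
  by apply: connU1 => //; apply/touchP; exists a; rewrite // gsym.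
have defX : x |: S = X.
  apply/eqP; rewrite eqEsubset subUset sub1set xX sSX /=.
  apply: contraT => nsub; have := maxS (x |: S).
  rewrite /P (subset_trans WS (subsetUr _ _)) properE nsub subUset sub1set xX sSX /=.
  have -> : `[< conn e (x |: S) >] by apply/asboolP.
  by move=> /(_ isT); rewrite cardsU1 xS ltnn.
exists x; first by rewrite inE xX andbT; apply: contra xS; apply: (subsetP WS).
suff -> : X :\ x = S by [].
by rewrite -defX setU1K.
Qed.

(* In a minimal connected set meeting all neighborhoods, every vertex whose removal
   keeps it connected is the only neighbor of some [y]; if there are few of those, the set is
   the union of few paths joining them. *)
Lemma attach_pendant_or_path A zs m n : conn e A -> uniq zs ->
  (forall y, y \in zs -> touch e A y) -> m.+1 * n < size zs ->
  (exists X zs', [/\ X \subset A, conn e X, uniq zs' /\ {subset zs' <= zs}, size zs' = m &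
     forall y, y \in zs' -> pendant e X y]) \/
  (exists p zs', [/\ ip e p, {subset p <= A}, uniq zs' /\ {subset zs' <= zs}, n < size zs' &
     forall y, y \in zs' -> touch e [set x in p] y]).
Proof.
move=> cA uz tA big.
pose P (S : {set V}) := [&& S \subset A, `[< conn e S >] & all (touch e S) zs].
have PA : P A by rewrite /P subxx /=; apply/andP; split; [apply/asboolP | apply/allP].
case: (arg_minnP (fun S : {set V} => #|S|) PA) => X /and3P[XA /asboolP cX /allP tX] minX.
have [u0 u0X] : exists u0, u0 \in X.
  by case: (zs) big tX => // y s _ /(_ y (mem_head _ _))/touchP[u0 u0X _]; exists u0.
pose priv u y := [forall v in X, e y v == (v == u)].
pose U := [set u in X | has (priv u) zs].
have [leU|ltU] := leqP m #|U|.
  left; pose g u := nth u0 zs (find (priv u) zs).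
  have gP u : u \in U -> g u \in zs /\ priv u (g u).
    rewrite inE => /andP[_ hu]; split; last exact: nth_find.
    by rewrite mem_nth // -has_find.
  exists X, (map g (take m (enum U))); split=> //.
  - split.
      rewrite map_inj_in_uniq ?take_uniq ?enum_uniq // => u v /mem_take + /mem_take.
      rewrite !mem_enum => uU vU guv; have [_ /forall_inP pu] := gP u uU.
      have [_ /forall_inP pv] := gP v vU.
      have uX : u \in X by case/setIdP: uU.
      by have /eqP := pu u uX; rewrite eqxx guv (eqP (pv u uX)) => /eqP.
    move=> y /mapP[u /mem_take]; rewrite mem_enum => /gP[gz _] ->; exact: gz.
  - by rewrite size_map size_takel // -cardE.
  move=> y /mapP[u /mem_take]; rewrite mem_enum => uU ->.
  have [_ /forall_inP pu] := gP u uU; exists u; first by case/setIdP: uU.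
  by move=> v vX; apply/eqP/pu.
(* The base vertex [u0] starts all the paths, which makes their union [W] connected and is the one
   vertex added to [U] in the count. *)
right; pose U' := u0 |: U.
have U'X u : u \in U' -> u \in X by case/setU1P=> [->//|/setIdP[]].
have [r hr] : {r : V -> seq V & forall u, u \in U' ->
    [/\ ip e (u0 :: r u), last u0 (r u) = u & {subset u0 :: r u <= X}]}.
  apply: (@choice _ _ (fun u s => u \in U' -> [/\ ip e (u0 :: s), last u0 s = u &
    {subset u0 :: s <= X}])) => u; have [uU|] := boolP (u \in U'); last by exists [::].
  by have [s hs] := conn_ip cX u0X (U'X u uU); exists s.
pose W := \bigcup_(u in U') [set x in u0 :: r u].
have u0U : u0 \in U' by rewrite !inE eqxx.
have cW : conn e W.
  apply: (conn_bigcup (r := u0)) => u uU; last by rewrite inE mem_head.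
  by apply: ip_conn => //; have [] := hr u uU.
have u0W : u0 \in W by apply/bigcupP; exists u0; rewrite // inE mem_head.
have U'W u : u \in U' -> u \in W.
  move=> uU; apply/bigcupP; exists u => //; have [_ lu _] := hr u uU.
  by rewrite inE -{1}lu mem_last.
have WX : W \subset X.
  by apply/bigcupsP => u uU; apply/subsetP => x; rewrite inE; have [_ _] := hr u uU; apply.
have defW : W = X.
  apply/eqP; rewrite eqEproper WX /=; apply/negP => pW.
  have [x /setDP[xX xW] cXx] := conn_extend cX cW u0W pW.
  have : ~~ P (X :\ x).
    apply: contraL (proper_card (properD1 xX)) => /minX; by rewrite -leqNgt.
  rewrite /P (subset_trans (subsetDl _ _) XA) /=.
  have -> /= : `[< conn e (X :\ x) >] by apply/asboolP.
  move=> /allPn[y yz nty]; case/negP: xW; apply: U'W; rewrite !inE xX; apply/orP; right.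
  apply/hasP; exists y => //; have /touchP[v vX yv] := tX y yz.
  have ony w : w \in X -> e y w -> w = x.
    move=> wX yw; apply/eqP; apply: contraNT nty => wx.
    by apply/touchP; exists w; rewrite // !inE wx.
  apply/forall_inP => w wX; apply/eqP; apply/idP/eqP => [/(ony w wX)//|->].
  by rewrite -(ony v vX yv).
pose f y := odflt u0 [pick u in U' | touch e [set x in u0 :: r u] y].
have fP y : y \in zs -> f y \in U' /\ touch e [set x in u0 :: r (f y)] y.
  move=> yz; rewrite /f; case: pickP => [u /andP[]//|no].
  have /touchP[v + yv] := tX y yz; rewrite -defW => /bigcupP[u uU vu].
  case/negP: (negbT (no u)); rewrite /= uU.
  by apply/touchP; exists v.
have [||u uU ltn] := pigeonhole_fun (f := f) (ss := enum U') (n := n) (s := zs).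
- by move=> y /fP[]; rewrite mem_enum.
- rewrite -cardE; apply: leq_ltn_trans big; rewrite leq_mul2r; apply/orP; right.
  by rewrite cardsU1; case: (u0 \in U) => /=; move: ltU; clear; lia.
have [ipu _ sX] := hr u (etrans (esym (mem_enum _ _)) uU).
exists (u0 :: r u), (filter (fun y => f y == u) zs); split=> //.
- by move=> x /sX; apply: (subsetP XA).
- by split; [rewrite filter_uniq | move=> y; rewrite mem_filter => /andP[]].
- by rewrite size_filter.
by move=> y; rewrite mem_filter => /andP[/eqP <- /fP[]].
Qed.

(** The neighbors on [p] span intervals, and Ramsey makes these pairwise meeting or pairwise
    disjoint. Meeting intervals share a vertex [c], as in Helly's theorem, and at most one element
    of [zs] is not adjacent to it. Disjoint intervals are sorted by whether they contain one
    neighbor or more. *)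
Lemma spread_on_path A B p zs m : (forall S, ~ theta e S) -> conn e B ->
  anticomplete e A B -> ip e p -> {subset p <= A} -> uniq zs -> stable e [set y in zs] ->
  (forall y, y \in zs -> y \notin A) ->
  (forall y, y \in zs -> touch e [set x in p] y /\ touch e B y) ->
  2 ^ (2 ^ ((m + m) + (m + m)) + m.+1) <= size zs ->
  (exists X zs', [/\ X \subset A, conn e X, uniq zs' /\ {subset zs' <= zs}, size zs' = m &
     forall y, y \in zs' -> pendant e X y]) \/
  (exists zs', [/\ uniq zs', {subset zs' <= zs}, size zs' = m, pairwise (before p) zs' &
     forall y, y \in zs' -> 1 < #|nbh e y :&: [set x in p]|]).
Proof.
move=> notheta cB AB ipp pA uz stz zA att big; have up := ip_uniq ipp.
pose R y y' := before p y y' || before p y' y.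
have pA' : [set x in p] \subset A by apply/subsetP => x; rewrite inE; apply: pA.
have [s ss [[sz hom]|[sz hom]]] := ramsey2 R big; last first.
  left; have subs := mem_subseq ss; have us := subseq_uniq ss uz.
  have [l hl] : {l : V -> V & forall y, y \in s -> [/\ l y \in p, e y (l y) &
      forall w', w' \in p -> e y w' -> index (l y) p <= index w' p]}.
    apply: (@choice _ _ (fun y w => y \in s -> [/\ w \in p, e y w &
      forall w', w' \in p -> e y w' -> index w p <= index w' p])) => y.
    have [ys|] := boolP (y \in s); last by exists y.
    by have [w hw] := first_nbr (att y (subs y ys)).1; exists w.
  have [y0 y0s] : exists y0, y0 \in s by case: (s) sz => // y s' _; exists y; apply: mem_head.
  (* The Helly point is the rightmost of the first neighbors. *)
  have [y1 y1s maxl] : exists2 y1, y1 \in s & forall y, y \in s -> index (l y) p <= index (l y1) p.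
    case: (@arg_maxnP _ y0 (mem s) (fun y => index (l y) p) y0s) => y1 y1s maxl.
    by exists y1.
  set c := l y1; have [cp y1c _] := hl y1 y1s.
  have meet y : y \in s -> exists w, [/\ w \in p, e y w & index c p <= index w p].
    move=> ys; have [->|yy1] := eqVneq y y1; first by exists c.
    have nR : ~~ R y y1.
      have symR a b : ~~ R a b -> ~~ R b a by rewrite /R orbC.
      by case: (pairwise_comparable hom ys y1s yy1) => // /symR.
    move: nR; rewrite /R negb_or => /andP[nb _].
    apply: contrapT => no; case/negP: nb; apply/beforeP => w w' wp w'p yw y1w'.
    have [_ _ minl] := hl y1 y1s; apply: leq_trans (minl w' w'p y1w').
    by rewrite ltnNge; apply/negP => cw; apply: no; exists w.
  (* Two elements missing [c] attach to both parts of the path left by [c]; with [B] these give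
     three paths of a theta. *)
  have few y y' : y \in s -> y' \in s -> ~~ e y c -> ~~ e y' c -> y = y'.
    move=> ys y's nyc ny'c; apply/eqP; apply: contrapT => /negP yy'.
    pose S1 := [set x in take (index c p) p]; pose S2 := [set x in drop (index c p).+1 p].
    have t1 z : z \in s -> ~~ e z c -> touch e S1 z.
      move=> zs' nzc; have [lp zl _] := hl z zs'; apply/touchP; exists (l z) => //.
      rewrite inE in_take // ltn_neqAle maxl // andbT index_inj_in //.
      by apply: contraNneq nzc => <-.
    have t2 z : z \in s -> ~~ e z c -> touch e S2 z.
      move=> zs' nzc; have [w [wp zw cw]] := meet z zs'; apply/touchP; exists w => //.
      rewrite inE in_drop // wp ltn_neqAle cw andbT index_inj_in //.
      by apply: contraNneq nzc => ->.
    have nyy' : ~~ e y y' by rewrite (stable_in stz) ?subs.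
    have [S /notheta//] : exists S, theta e S.
    have cS1 : conn e S1 := ip_conn gsym (ip_take _ ipp).
    have cS2 : conn e S2 := ip_conn gsym (ip_drop _ ipp).
    have sS1 : S1 \subset A by apply: subset_trans pA'; apply/subsetP => x; rewrite !inE => /mem_take.
    have sS2 : S2 \subset A by apply: subset_trans pA'; apply/subsetP => x; rewrite !inE => /mem_drop.
    apply: (theta_sets gsym girr (a := y) (b := y') cS1 cS2 cB) => //;
      do ?[exact: t1|exact: t2|by have [] := att _ (subs _ ys)|by have [] := att _ (subs _ y's)].
    - apply/anticompleteP => a b; rewrite !inE in_drop // => at_ /andP[bp cb].
      have ap := mem_take at_; rewrite in_take // in at_.
      split; first by apply: contraTneq cb => <-; rewrite -ltnNge ltnS ltnW.
      rewrite (ip_index gsym girr ipp) //; apply/negbTE.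
      by move: at_ cb; clear; lia.
    - exact: anticompleteS AB.
    exact: anticompleteS AB.
  exists [set c], (take m (filter (fun y => e y c) s)); split.
  - by rewrite sub1set pA.
  - exact: conn1.
  - split; first by rewrite take_uniq ?filter_uniq.
    by move=> y /mem_take; rewrite mem_filter => /andP[_ /subs].
  - apply: size_takel.
    have cnt := count_predC (fun y => e y c) s.
    rewrite size_filter; suff : count (predC (fun y => e y c)) s <= 1.
      by move: cnt; rewrite sz; clear; lia.
    rewrite -size_filter; case def_f: (filter _ s) => [|a [|b f]] //.
    have : uniq (filter (predC (fun y => e y c)) s) by rewrite filter_uniq.
    have := mem_filter (predC (fun y => e y c)); rewrite def_f => mf.
    have := mf a s; have := mf b s; rewrite def_f !inE !eqxx !orbT /= => /esym/andP[nb bs] /esym/andP[na as_].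
    by rewrite (few a b as_ bs na nb) inE eqxx.
  move=> y /mem_take; rewrite mem_filter => /andP[yc _]; exists c; first exact: set11.
  by move=> v /set1P->; rewrite yc eqxx.
have [s1 [us1 ss1 sz1 pw1]] : exists s1, [/\ uniq s1, {subset s1 <= zs}, size s1 = m + m &
    pairwise (before p) s1].
  have us := subseq_uniq ss uz; have cmp : {in s &, forall y y', y != y' -> before p y y' \/ before p y' y}.
    by move=> y y' ys y's /(pairwise_comparable hom ys y's)[]/orP[]; [left|right|right|left].
  have [s1 [ss1 sz1 [pw1|pw1]]] := ramsey2_chain us cmp (eq_leq (esym sz)).
    exists s1; split=> //; first exact: subseq_uniq ss1 us.
    by move=> y /(mem_subseq ss1)/(mem_subseq ss).
  exists (rev s1); rewrite rev_uniq size_rev pairwise_rev (subseq_uniq ss1 us); split=> //.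
  by move=> y; rewrite mem_rev => /(mem_subseq ss1)/(mem_subseq ss).
pose two y := 1 < #|nbh e y :&: [set x in p]|.
have [le|lt] := leqP m (count two s1).
  right; exists (take m (filter two s1)); split.
  - by rewrite take_uniq ?filter_uniq.
  - by move=> y /mem_take; rewrite mem_filter => /andP[_ /ss1].
  - by rewrite size_takel // size_filter.
  - by apply: subseq_pairwise pw1; apply: subseq_trans (take_subseq _ _) (filter_subseq _ _).
  by move=> y /mem_take; rewrite mem_filter => /andP[].
left; exists [set x in p], (take m (filter (predC two) s1)); split=> //.
- exact: ip_conn.
- split; first by rewrite take_uniq ?filter_uniq.
  by move=> y /mem_take; rewrite mem_filter => /andP[_ /ss1].
- rewrite size_takel // size_filter; have := count_predC two s1; rewrite sz1.
  by move: lt; clear; lia.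
move=> y /mem_take; rewrite mem_filter /= /two -leqNgt => /andP[le1 ys].
have /touchP[x xp yx] := (att y (ss1 y ys)).1.
exists x => // v vp; apply/idP/eqP => [yv|-> //].
have xN : x \in nbh e y :&: [set x in p] by rewrite inE xp inE yx.
have vN : v \in nbh e y :&: [set x in p] by rewrite inE vp inE yv.
exact: (card_le1_eqP le1).
Qed.

(** The factor [m.+1] comes from the pigeonhole over the paths. In the exponent, [m.+1] pays for the
    element that may miss the Helly point, and [m + m] for the split by number of neighbors after
    sorting. *)
Definition side_bound m := (m.+1 * 2 ^ (2 ^ ((m + m) + (m + m)) + m.+1)).+1.

Lemma attach_side A B zs m : (forall S, ~ theta e S) -> conn e A -> conn e B ->
  anticomplete e A B -> uniq zs -> stable e [set y in zs] ->
  (forall y, y \in zs -> y \notin A) ->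
  (forall y, y \in zs -> touch e A y /\ touch e B y) ->
  side_bound m <= size zs ->
  (exists X zs', [/\ X \subset A, conn e X, uniq zs' /\ {subset zs' <= zs}, size zs' = m &
     forall y, y \in zs' -> pendant e X y]) \/
  (exists p zs', [/\ ip e p /\ {subset p <= A}, uniq zs' /\ {subset zs' <= zs}, size zs' = m,
     pairwise (before p) zs' & forall y, y \in zs' -> 1 < #|nbh e y :&: [set x in p]|]).
Proof.
move=> notheta cA cB AB uz stz zA att big.
have tA y : y \in zs -> touch e A y by move=> /att[].
case: (attach_pendant_or_path cA uz tA big) => [|[p [zs1 [ipp pA [uz1 sz1] lt1 tp]]]]; first by left.
have [|||X|] := spread_on_path (p := p) (zs := zs1) notheta cB AB ipp pA uz1 _ _ _ (ltnW lt1).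
- exact: stable_sub stz.
- by move=> y /sz1/zA.
- by move=> y yz; split; [apply: tp | have [] := att y (sz1 y yz)].
- case: X => X [zs' [XA cX [uz' sz'] szm pend]]; left; exists X, zs'; split=> //.
  by split=> // y /sz'/sz1.
case=> zs' [uz' sz' szm pw two]; right; exists p, zs'; split=> //.
by split=> // y /sz'/sz1.
Qed.

End Spans.

(** * Two anticomplete sides with pendant terminals *)

Section TwoSides.
Variables (V : finType) (e : rel V).
Hypotheses (gsym : symmetric e) (girr : irreflexive e).
Implicit Types (A B L X Y Z S : {set V}) (u v w x y z : V) (s p q zs : seq V).

(** The terminals belong to both sides, so a pair involving one of them can always be read within a
    single side; any other mixed pair lies in [A] and [B]. *)
Lemma cross_cases A B y y' L1 L1' L2 L2' u v : anticomplete e A B ->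
  y \in L1 -> y \in L1' -> y' \in L2 -> y' \in L2' ->
  L1 \subset y |: A -> L1' \subset y |: B -> L2 \subset y' |: A -> L2' \subset y' |: B ->
  u \in L1 :|: L1' -> v \in L2 :|: L2' ->
  [\/ u \in L1 /\ v \in L2, u \in L1' /\ v \in L2' | u != v /\ e u v = false].
Proof.
move=> /anticompleteP AB y1 y1' y2 y2' /subsetP s1 /subsetP s1' /subsetP s2 /subsetP s2'.
rewrite !inE => /orP[u1|u1] /orP[v2|v2]; try by [constructor 1 | constructor 2].
  have := s1 u u1; rewrite !inE => /predU1P[def_u|uA]; first by constructor 2; rewrite def_u.
  have := s2' v v2; rewrite !inE => /predU1P[def_v|vB]; first by constructor 1; rewrite def_v.
  by constructor 3; apply: AB.
have := s1' u u1; rewrite !inE => /predU1P[def_u|uA]; first by constructor 1; rewrite def_u.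
have := s2 v v2; rewrite !inE => /predU1P[def_v|vB]; first by constructor 2; rewrite def_v.
by constructor 3; have [] := AB v u vB uA; rewrite eq_sym gsym.
Qed.

(** The two legs at each terminal glue there to a connected set between the centers. *)
Lemma claw_claw_theta A B y1 y2 y3 : anticomplete e A B ->
  y1 != y2 -> y1 != y3 -> y2 != y3 ->
  claw e A [set y1; y2; y3] -> claw e B [set y1; y2; y3] -> exists S, theta e S.
Proof.
move=> AB y12 y13 y23 [a [L [aA hL aL]]] [b [L' [bB hL' aL']]].
have [ab eab] : a != b /\ e a b = false by apply: (anticompleteP _ _ _ AB).
have in1 : y1 \in [set y1; y2; y3] by rewrite !inE eqxx.
have in2 : y2 \in [set y1; y2; y3] by rewrite !inE eqxx orbT.
have in3 : y3 \in [set y1; y2; y3] by rewrite !inE eqxx orbT.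
have cS y : y \in [set y1; y2; y3] -> [/\ conn e (L y :|: L' y), touch e (L y :|: L' y) a &
    touch e (L y :|: L' y) b].
  move=> yZ; have [yL _ cL _ ta] := hL y yZ; have [yL' _ cL' _ tb] := hL' y yZ.
  rewrite !touchU ta tb orbT; split=> //.
  by apply: (connU gsym cL cL' yL yL'); left.
have anti y y' : y \in [set y1; y2; y3] -> y' \in [set y1; y2; y3] -> y != y' ->
    anticomplete e (L y :|: L' y) (L y' :|: L' y').
  move=> yZ y'Z yy'; apply/anticompleteP => u v uS vS.
  have [yL sL _ _ _] := hL y yZ; have [yL' sL' _ _ _] := hL' y yZ.
  have [y'L s'L _ _ _] := hL y' y'Z; have [y'L' s'L' _ _ _] := hL' y' y'Z.
  have /anticompleteP h := aL y y' yZ y'Z yy'; have /anticompleteP h' := aL' y y' yZ y'Z yy'.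
  by case: (cross_cases AB yL yL' y'L y'L' sL sL' s'L s'L' uS vS) => // -[]; [apply: h | apply: h'].
have [c1 ta1 tb1] := cS y1 in1; have [c2 ta2 tb2] := cS y2 in2; have [c3 ta3 tb3] := cS y3 in3.
by apply: (theta_sets gsym girr c1 c2 c3 ab) => //; rewrite ?eab // anti.
Qed.

(** Unlike in [tri], a corner may be the terminal itself, as happens when a tooth of a comb is a
    single vertex. *)
Definition weak_tri A Z := exists (a : V -> V) (L : V -> {set V}),
  (forall y, y \in Z -> [/\ y \in L y, L y \subset y |: A, conn e (L y) & a y \in L y]) /\
  (forall y y' u v, y \in Z -> y' \in Z -> y != y' -> u \in L y -> v \in L y' ->
     u != v /\ e u v = (u == a y) && (v == a y')).

(** One of the two triangles has its corners inside [A], so they differ from those of the other even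
    if the latter are terminals; the prism paths thus have length at least 1. *)
Lemma tri_weak_tri_prism A B y1 y2 y3 : anticomplete e A B ->
  (forall y, y \in [set y1; y2; y3] -> y \notin A) ->
  y1 != y2 -> y1 != y3 -> y2 != y3 ->
  tri e A [set y1; y2; y3] -> weak_tri B [set y1; y2; y3] -> exists S, prism e S.
Proof.
move=> AB yA y12 y13 y23 [a [L [hL aL]]] [b [L' [hL' aL']]].
have in1 : y1 \in [set y1; y2; y3] by rewrite !inE eqxx.
have in2 : y2 \in [set y1; y2; y3] by rewrite !inE eqxx orbT.
have in3 : y3 \in [set y1; y2; y3] by rewrite !inE eqxx orbT.
have cS y : y \in [set y1; y2; y3] -> [/\ conn e (L y :|: L' y), a y \in L y :|: L' y,
    b y \in L y :|: L' y & a y != b y].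
  move=> yZ; have [yL _ cL ayL ayA] := hL y yZ; have [yL' /subsetP sL' cL' byL'] := hL' y yZ.
  rewrite !inE ayL byL' orbT; split=> //; first by apply: (connU gsym cL cL' yL yL'); left.
  have := sL' _ byL'; rewrite !inE => /orP[/eqP->|bB].
    by apply: contraTneq ayA => ->; apply: yA.
  by have [] := anticompleteP _ _ _ AB _ _ ayA bB.
have lnk y y' : y \in [set y1; y2; y3] -> y' \in [set y1; y2; y3] -> y != y' ->
    link e (L y :|: L' y) (L y' :|: L' y') (a y) (b y) (a y') (b y').
  move=> yZ y'Z yy' u v uS vS.
  have [yL sL _ aL1 _] := hL y yZ; have [yL' sL' _ bL1] := hL' y yZ.
  have [y'L s'L _ aL2 _] := hL y' y'Z; have [y'L' s'L' _ bL2] := hL' y' y'Z.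
  have [_ eaa] := aL y y' _ _ yZ y'Z yy' aL1 aL2.
  have [_ ebb] := aL' y y' _ _ yZ y'Z yy' bL1 bL2.
  rewrite !eqxx in eaa ebb.
  have back : (u == a y) && (v == a y') || (u == b y) && (v == b y') -> e u v.
    by case/orP=> /andP[/eqP-> /eqP->].
  case: (cross_cases AB yL yL' y'L y'L' sL sL' s'L s'L' uS vS) => [[uL vL]|[uL vL]|[uv euv]].
  - have [uv euv] := aL y y' u v yZ y'Z yy' uL vL; split=> //.
    by apply/idP/idP => [|/back //]; rewrite euv => ->.
  - have [uv euv] := aL' y y' u v yZ y'Z yy' uL vL; split=> //.
    by apply/idP/idP => [|/back //]; rewrite euv => ->; rewrite orbT.
  by split=> //; apply/idP/idP => [|/back //]; rewrite euv.
have [c1 ta1 tb1 n1] := cS y1 in1; have [c2 ta2 tb2 n2] := cS y2 in2.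
have [c3 ta3 tb3 n3] := cS y3 in3.
exact: (prism_sets gsym girr c1 c2 c3 ta1 ta2 ta3 tb1 tb2 tb3 n1 n2 n3
  (lnk _ _ in1 in2 y12) (lnk _ _ in1 in3 y13) (lnk _ _ in2 in3 y23)).
Qed.

Lemma set3_swap12 y1 y2 y3 : [set y1; y2; y3] = [set y2; y1; y3].
Proof. by apply/setP => x; rewrite !inE [(x == y1) || _]orbC. Qed.

Lemma set3_swap23 y1 y2 y3 : [set y1; y2; y3] = [set y1; y3; y2].
Proof. by apply/setP => x; rewrite !inE orbAC. Qed.

(** The middle tooth and the edge of [p] it is attached to form the triangle. Cutting [p] at this
    edge leaves two parts, each merged with the outer tooth on its side. *)
Lemma comb_weak_tri A p zs Lam at_ pos y1 y2 y3 : comb e true A p zs Lam at_ pos ->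
  y1 \in zs -> y2 \in zs -> y3 \in zs -> y1 != y2 -> y1 != y3 -> y2 != y3 ->
  weak_tri A [set y1; y2; y3].
Proof.
move=> [[ipp pA uz pw] [h1 h2 h3 h4]]; have up := ip_uniq ipp.
have key a b c : a \in zs -> b \in zs -> c \in zs -> a != b -> a != c -> b != c ->
    pos a < pos b -> pos b < pos c -> weak_tri A [set a; b; c].
  move=> az bz cz ab ac bc lab lbc.
  have [aL atL sLa cLa] := h1 a az; have [bL btL sLb cLb] := h1 b bz.
  have [cL ctL sLc cLc] := h1 c cz.
  have pb1 : (pos b).+1 < size p by have := h2 b bz; rewrite addn1.
  have pc1 : pos c < size p by have := h2 c cz; rewrite addn1 => /ltnW.
  have pb : pos b < size p := ltnW pb1.
  have pa : pos a < size p := ltn_trans lab pb.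
  pose T := [set x in take (pos b).+1 p]; pose D := [set x in drop (pos b).+1 p].
  pose g := nth a p.
  have gp i : i < size p -> g i \in p by move=> ip; rewrite mem_nth.
  have gi i : i < size p -> index (g i) p = i by move=> ip; rewrite index_uniq.
  have TE w : (w \in T) = (w \in p) && (index w p <= pos b).
    rewrite inE; have [wp|wp] := boolP (w \in p); first by rewrite in_take.
    by apply/negbTE; apply: contra wp; apply: mem_take.
  have DE w : (w \in D) = (w \in p) && (pos b < index w p) by rewrite inE in_drop.
  pose La := Lam a :|: T; pose Lc := Lam c :|: D.
  have adj y i : y \in zs -> i < size p -> pos y = i -> e (at_ y) (g i).
    move=> yz ip yi; have [_ atLy _ _] := h1 y yz.
    by have [_ ->] := h3 y _ _ yz atLy (gp i ip); rewrite eqxx gi // yi eqxx.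
  have cLa' : conn e La.
    apply: (@connU _ _ gsym _ _ (at_ a) (g (pos a))) => //.
    - exact: (ip_conn gsym (ip_take _ ipp)).
    - by rewrite TE gp // gi // ltnW.
    by right; apply: adj.
  have cLc' : conn e Lc.
    apply: (@connU _ _ gsym _ _ (at_ c) (g (pos c))) => //.
    - exact: (ip_conn gsym (ip_drop _ ipp)).
    - by rewrite DE gp // gi.
    by right; apply: adj.
  have pA' : [set x in p] \subset A by apply/subsetP => x; rewrite inE; apply: pA.
  have sTA : T \subset A by apply: subset_trans pA'; apply/subsetP => x; rewrite TE inE => /andP[].
  have sDA : D \subset A by apply: subset_trans pA'; apply/subsetP => x; rewrite DE inE => /andP[].
  have gb : g (pos b) \in p by apply: gp.
  have gb1 : g (pos b).+1 \in p by apply: gp.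
  have neL y v w : y \in zs -> v \in Lam y -> w \in p -> (v == w) = false.
    by move=> yz vL wp; apply/negbTE; have [] := h3 y v w yz vL wp.
  have anti y y' u v : y \in zs -> y' \in zs -> y != y' -> u \in Lam y -> v \in Lam y' ->
      u != v /\ e u v = false.
    by move=> yz y'z yy' uL vL; have /anticompleteP := h4 y y' yz y'z yy'; apply.
  have lab' u v : u \in La -> v \in Lam b -> u != v /\ e u v = (u == g (pos b)) && (v == at_ b).
    move=> /setUP[uL|uT] vL.
      by have [-> ->] := anti a b u v az bz ab uL vL; rewrite (neL a).
    move: uT; rewrite TE => /andP[upp ub]; have [nvu evu] := h3 b v u bz vL upp.
    rewrite eq_sym gsym nvu evu andbC -(index_inj_in upp gb) gi //.
    have -> : (index u p == (pos b).+1) = false by rewrite ltn_eqF // ltnS.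
    by rewrite orbF.
  have lcb' u v : u \in Lc -> v \in Lam b -> u != v /\ e u v = (u == g (pos b).+1) && (v == at_ b).
    move=> /setUP[uL|uD] vL.
      by have [] := anti c b u v cz bz _ uL vL; rewrite 1?eq_sym // => -> ->; rewrite (neL c).
    move: uD; rewrite DE => /andP[upp ub]; have [nvu evu] := h3 b v u bz vL upp.
    rewrite eq_sym gsym nvu evu andbC -(index_inj_in upp gb1) gi //.
    by have -> : (index u p == pos b) = false by rewrite gtn_eqF.
  have lac' u v : u \in La -> v \in Lc -> u != v /\ e u v = (u == g (pos b)) && (v == g (pos b).+1).
    move=> /setUP[uL|uT] /setUP[vL|vD].
    - by have [-> ->] := anti a c u v az cz ac uL vL; rewrite (neL a).
    - move: vD; rewrite DE => /andP[vp bv]; have [-> ->] := h3 a u v az uL vp.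
      rewrite (neL a u (g (pos b))) // !gtn_eqF ?andbF //; first exact: leq_ltn_trans bv.
      exact: ltn_trans bv.
    - move: uT; rewrite TE => /andP[upp ub]; have [nvu evu] := h3 c v u cz vL upp.
      rewrite eq_sym gsym nvu evu (neL c v (g (pos b).+1)) // andbF !ltn_eqF ?andbF //.
        by rewrite ltnS; apply: leq_trans ub (ltnW lbc).
      exact: leq_ltn_trans lbc.
    move: uT vD; rewrite TE DE => /andP[upp ub] /andP[vp bv].
    split; first by apply: contraTneq bv => <-; rewrite -leqNgt.
    rewrite (ip_index gsym girr ipp) // -(index_inj_in upp gb) -(index_inj_in vp gb1) !gi //.
    by move: (index u p) (index v p) (pos b) ub bv; clear; lia.
  have ba : (b == a) = false by rewrite eq_sym (negbTE ab).
  have ca : (c == a) = false by rewrite eq_sym (negbTE ac).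
  have cb : (c == b) = false by rewrite eq_sym (negbTE bc).
  pose F y := if y == a then (g (pos b), La) else if y == b then (at_ b, Lam b) else (g (pos b).+1, Lc).
  exists (fun y => (F y).1), (fun y => (F y).2); split.
    move=> y; rewrite /F !inE => /orP[/orP[]|] /eqP->; rewrite ?eqxx ?ba ?ca ?cb //=.
      split=> //; [by rewrite inE aL| |by rewrite inE TE gb gi // leqnn orbT].
      by rewrite subUset sLa (subset_trans sTA) ?subsetUr.
    split=> //; [by rewrite inE cL| |by rewrite inE DE gb1 gi // leqnn orbT].
    by rewrite subUset sLc (subset_trans sDA) ?subsetUr.
  have flip (X1 X2 : {set V}) x1 x2 : (forall u v, u \in X1 -> v \in X2 -> u != v /\ e u v = (u == x1) && (v == x2)) ->
      forall u v, u \in X2 -> v \in X1 -> u != v /\ e u v = (u == x2) && (v == x1).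
    by move=> h u v uX vX; have [] := h v u vX uX; rewrite eq_sym gsym andbC.
  by move=> y y' u v; rewrite /F !inE => /orP[/orP[]|] /eqP-> /orP[/orP[]|] /eqP->;
    rewrite ?eqxx ?ba ?ca ?cb //= ?(negbTE ab) ?(negbTE ac) ?(negbTE bc) // => _ uL vL;
    first [exact: lab' | exact: lac' | exact: lcb' | exact: (flip _ _ _ _ lab')
          | exact: (flip _ _ _ _ lac') | exact: (flip _ _ _ _ lcb')].
have cmp a b : a \in zs -> b \in zs -> a != b -> pos a < pos b \/ pos b < pos a.
  by move=> az bz ab; rewrite -!(addn1 (pos _)); apply: (pairwise_comparable pw az bz ab).
move=> z1 z2 z3 n12 n13 n23.
have n21 : y2 != y1 by rewrite eq_sym. have n31 : y3 != y1 by rewrite eq_sym.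
have n32 : y3 != y2 by rewrite eq_sym.
case: (cmp y1 y2) => // l12; case: (cmp y2 y3) => // l23.
- exact: key.
- case: (cmp y1 y3) => // l13; first by rewrite set3_swap23; apply: key.
  by rewrite set3_swap23 set3_swap12; apply: key.
- case: (cmp y1 y3) => // l13; first by rewrite set3_swap12; apply: key.
  by rewrite set3_swap12 set3_swap23; apply: key.
by rewrite set3_swap12 set3_swap23 set3_swap12; apply: key.
Qed.

(** Positions increase strictly, so among three teeth the outer two are at distance 2: the unwanted
    color has no set of size 3. *)
Lemma comb_spread A p zs Lam at_ pos m : comb e true A p zs Lam at_ pos ->
  2 ^ (m + 3) <= size zs ->
  exists zs', [/\ subseq zs' zs, size zs' = m & pairwise (fun y y' => pos y + 2 <= pos y') zs'].
Proof.
move=> [[_ _ _ pw] _] big.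
have [s ss [[sz hom]|[sz hom]]] := ramsey2 (fun y y' => pos y + 2 <= pos y') big.
  by exists s.
have := subseq_pairwise ss pw; move: hom.
case: (s) sz => [|a [|b [|c []]]] //= _; rewrite !andbT.
by move=> /andP[/andP[_ h1] _] /andP[/andP[h2 _] h3]; move: h1 h2 h3; clear; lia.
Qed.

(** The outer power separates the teeth on the first path, the inner one makes their positions on
    the second path monotone, and [k.+2] rungs remain for the ladder. *)
Definition comb_comb_bound k := 2 ^ (2 ^ (k.+2 + k.+2) + 3).

(** The two teeth of a terminal glue at it to a rung, with an edge as foot on [p] and a vertex as
    foot on [q]. *)
Lemma comb_comb k A B p q zs zs2 Lam Lam' at_ at' pos pos' : anticomplete e A B ->
  comb e true A p zs Lam at_ pos -> comb e false B q zs2 Lam' at' pos' ->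
  {subset zs2 <= zs} -> comb_comb_bound k <= size zs2 ->
  exists S, generalized_pyramid e k S.
Proof.
move=> AB cmb cmb' sub big; have aAB := anticompleteP _ _ _ AB.
have [_ _ uz _] := cmb.1; have [ipq qB uz2 _] := cmb'.1.
have cmb1 := comb_subseq (filter_subseq (mem zs2) zs) cmb.
have [|L1 [ss1 sz1 pw1]] := comb_spread (m := 2 ^ (k.+2 + k.+2)) cmb1.
  by rewrite size_filter_mem.
have [L2 ss2 hL2] := ramsey2 (fun y y' => pos' y <= pos' y') (eq_leq (esym sz1)).
have ss : subseq L2 zs by apply: subseq_trans ss2 (subseq_trans ss1 (filter_subseq _ _)).
have [[ipp pA uL2 _] [h1 h2 h3 h4]] := comb_subseq ss cmb.
have s2 y : y \in L2 -> y \in zs2.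
  by move=> /(mem_subseq ss2)/(mem_subseq ss1); rewrite mem_filter => /andP[].
have [_ [h1' h2' h3' h4']] := cmb'.
have pw2 := subseq_pairwise ss2 pw1.
pose G y := Lam y :|: Lam' y.
have pq : anticomplete e [set x in p] [set x in q].
  by apply/anticompleteP => u v; rewrite !inE => /pA uA /qB; apply: aAB.
have hG y : y \in L2 -> [/\ conn e (G y), at_ y \in G y, at' y \in G y,
    (pos y).+1 < size p & pos' y < size q].
  move=> yL; have [yLam atL _ cLam] := h1 y yL; have [yLam' atL' _ cLam'] := h1' y (s2 y yL).
  have := h2 y yL; have := h2' y (s2 y yL); rewrite addn0 addn1 => ltq ltp.
  split; rewrite ?inE ?atL ?atL' ?orbT //.
  by apply: (connU gsym cLam cLam' yLam yLam'); left.
have hp y v w : y \in L2 -> v \in G y -> w \in p -> v != w /\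
    e v w = (v == at_ y) && ((index w p == pos y) || (index w p == (pos y).+1)).
  move=> yL vG wp; have [yLam atL _ _] := h1 y yL; have [_ _ sL' _] := h1' y (s2 y yL).
  have [vL|vL] := boolP (v \in Lam y); first exact: h3.
  have vB : v \in B.
    move: vG; rewrite inE (negbTE vL) => /(subsetP sL'); rewrite !inE => /predU1P[vy|//].
    by rewrite vy yLam in vL.
  have [nwv ewv] := aAB w v (pA w wp) vB; rewrite eq_sym gsym nwv ewv.
  by have -> : (v == at_ y) = false by apply: contraNF vL => /eqP->.
have hq y v w : y \in L2 -> v \in G y -> w \in q -> v != w /\
    e v w = (v == at' y) && (index w q == pos' y).
  move=> yL vG wq; have [_ _ sL _] := h1 y yL; have [yLam' atL' _ _] := h1' y (s2 y yL).
  have [vL|vL] := boolP (v \in Lam' y).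
    by have := h3' y v w (s2 y yL) vL wq; rewrite orbF.
  have vA : v \in A.
    move: vG; rewrite inE (negbTE vL) orbF => /(subsetP sL); rewrite !inE => /predU1P[vy|//].
    by rewrite vy yLam' in vL.
  have [nvw evw] := aAB v w vA (qB w wq); rewrite nvw evw.
  by have -> : (v == at' y) = false by apply: contraNF vL => /eqP->.
have anti y y' : y \in L2 -> y' \in L2 -> y != y' -> anticomplete e (G y) (G y').
  move=> yL y'L yy'; apply/anticompleteP => u v uG vG.
  have [a1 _ b1 _] := h1 y yL; have [a2 _ b2 _] := h1 y' y'L.
  have [a3 _ b3 _] := h1' y (s2 y yL); have [a4 _ b4 _] := h1' y' (s2 y' y'L).
  have /anticompleteP g := h4 y y' yL y'L yy'.
  have /anticompleteP g' := h4' y y' (s2 y yL) (s2 y' y'L) yy'.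
  by case: (cross_cases AB a1 a3 a2 a4 b1 b3 b2 b4 uG vG) => // -[]; [apply: g | apply: g'].
case: hL2 => -[szL2 mono].
  exact: (ladder gsym girr ipp ipq pq uL2 szL2 pw2 mono hG hp hq anti).
apply: (ladder_rev gsym girr ipp ipq pq uL2 szL2 pw2 _ hG hp hq anti).
by apply: sub_pairwise mono => y y' /=; rewrite -ltnNge => /ltnW.
Qed.

Section Class.
Variables (t k : nat).
Hypothesis notheta : forall S, ~ theta e S.
Hypothesis noprism : forall S, ~ prism e S.
Hypothesis small_clique : forall K : {set V}, clique e K -> #|K| < t.
Hypothesis nopyramid : forall S, ~ generalized_pyramid e k S.

Definition comb_bound m := (maxn t m ^ m).+2.

(** A triangle in the frame taken inside [B] would form a prism with three teeth in [A]. So the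
    frame is triangle-free and, as [A] joins all terminals, a tree by [tree_blocks]; a large one
    contains a comb of kind [false], and the two combs form a pyramid. *)
Lemma pendant_claw_comb A B p zs Lam at_ pos : conn e A -> conn e B -> anticomplete e A B ->
  comb e true A p zs Lam at_ pos -> stable e [set y in zs] ->
  (forall y, y \in zs -> [/\ y \notin A, y \notin B, touch e A y & pendant e B y]) ->
  size zs < comb_bound (comb_comb_bound k).
Proof.
move=> cA cB AB cmb stz hz; rewrite ltnNge; apply/negP => big.
have [_ _ uz _] := cmb.1.
have czs : #|[set y in zs]| = size zs by rewrite cardsE (card_uniqP uz).
have [X XB frm] : exists2 X : {set V}, X \subset B & terminal_frame e X [set y in zs].
  apply: exists_terminal_frame => //.
  - rewrite disjoint_sym disjoint_subset; apply/subsetP => y; rewrite !inE => /hz[_ nB _ _].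
    exact: nB.
  - by rewrite czs; apply: leq_trans big.
  by move=> y; rewrite inE => /hz[].
have XA : anticomplete e X A by rewrite anticomplete_sym //; apply: anticompleteS AB.
have notri w w' w'' : w \in X :|: [set y in zs] -> w' \in X :|: [set y in zs] ->
    w'' \in X :|: [set y in zs] -> e w w' -> e w w'' -> ~~ e w' w''.
  move=> wH w'H w''H ww' ww''; apply/negP => w'w''.
  have [y1 [y2 [y3 [[y1z y2z y3z] [n12 n13 n23 tr]]]]] :=
    triangle_tri gsym girr frm wH w'H w''H ww' ww'' w'w''.
  rewrite !inE in y1z y2z y3z.
  have wtr := comb_weak_tri cmb y1z y2z y3z n12 n13 n23.
  have [|S /noprism//] := tri_weak_tri_prism XA _ n12 n13 n23 tr wtr.
  by move=> y; rewrite !inE => /orP[/orP[]|] /eqP-> ; apply/negP => /(subsetP XB);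
    apply/negP; [case: (hz y1 y1z) | case: (hz y2 y2z) | case: (hz y3 y3z)].
have blocks u w w' : u \in X -> w \in X :|: [set y in zs] -> w' \in X :|: [set y in zs] ->
    e u w -> e u w' -> w != w' -> connect (induced e ((X :|: [set y in zs]) :\ u)) w w' -> e w w'.
  move=> uX wH w'H uw uw' ww' cw; case: (tree_blocks gsym girr frm notheta cA XA _ notri uX wH w'H uw uw' ww' cw).
  by move=> y; rewrite inE => /hz[].
have [|q [zs2 [Lam' [at' [pos' [cmb' sz2 sub2]]]]]] :=
  comb_in_frame gsym girr frm blocks (b := false) notri small_clique (m := comb_comb_bound k).
  by rewrite czs.
have [||S /nopyramid//] := comb_comb (k := k) AB cmb (combS XB cmb').
- by move=> y /sub2; rewrite inE.
by rewrite sz2.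
Qed.

(** By [star_claw] no vertex of the frame has three pairwise nonadjacent neighbors, so the blocks
    are cliques and the clique bound limits the branching. *)
Lemma claw_free_comb A zs m : conn e A -> uniq zs -> stable e [set y in zs] ->
  (forall y, y \in zs -> y \notin A /\ pendant e A y) ->
  (forall y1 y2 y3, y1 \in zs -> y2 \in zs -> y3 \in zs ->
     y1 != y2 -> y1 != y3 -> y2 != y3 -> ~ claw e A [set y1; y2; y3]) ->
  comb_bound m <= size zs ->
  exists s zs' Lam at_ pos, [/\ comb e true A s zs' Lam at_ pos, size zs' = m & {subset zs' <= zs}].
Proof.
move=> cA uz stz hz noclaw big.
have czs : #|[set y in zs]| = size zs by rewrite cardsE (card_uniqP uz).
have [X XA frm] : exists2 X : {set V}, X \subset A & terminal_frame e X [set y in zs].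
  apply: exists_terminal_frame => //.
  - rewrite disjoint_sym disjoint_subset; apply/subsetP => y; rewrite !inE => /hz[nA _].
    exact: nA.
  - by rewrite czs; apply: leq_trans big.
  by move=> y; rewrite inE => /hz[].
have nostar : local_kind e X [set y in zs] true.
  move=> u w1 w2 w3 uX w1H w2H w3H uw1 uw2 uw3 n12 n13 n23; apply: contraT.
  rewrite !negb_or => /and3P[e12 e13 e23].
  have [y1 [y2 [y3 [[y1z y2z y3z] [m12 m13 m23 cl]]]]] :=
    star_claw gsym girr frm uX w1H w2H w3H uw1 uw2 uw3 n12 n13 n23 e12 e13 e23.
  rewrite !inE in y1z y2z y3z.
  by case: (noclaw y1 y2 y3 y1z y2z y3z m12 m13 m23); apply: clawS cl.
have blocks := clique_blocks gsym girr frm nostar.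
have [|s [zs' [Lam [at_ [pos [cmb sz sub]]]]]] :=
  comb_in_frame gsym girr frm blocks (b := true) nostar small_clique (m := m).
  by rewrite czs.
exists s, zs', Lam, at_, pos; split=> //; first exact: combS cmb.
by move=> y /sub; rewrite inE.
Qed.

Definition pendant_bound := comb_bound (comb_bound (comb_comb_bound k)).

Lemma claw_free_pendants A B zs : conn e A -> conn e B -> anticomplete e A B ->
  uniq zs -> stable e [set y in zs] ->
  (forall y, y \in zs -> [/\ y \notin A, y \notin B, pendant e A y & pendant e B y]) ->
  (forall y1 y2 y3, y1 \in zs -> y2 \in zs -> y3 \in zs ->
     y1 != y2 -> y1 != y3 -> y2 != y3 -> ~ claw e A [set y1; y2; y3]) ->
  size zs < pendant_bound.
Proof.
move=> cA cB AB uz stz hz noclaw; rewrite ltnNge; apply/negP => big.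
have [|s [zs' [Lam [at_ [pos [cmb sz sub]]]]]] := claw_free_comb cA uz stz _ noclaw big.
  by move=> y /hz[].
have : size zs' < comb_bound (comb_comb_bound k); last by rewrite sz ltnn.
apply: (pendant_claw_comb cA cB AB cmb).
  exact: stable_sub sub stz.
move=> y /sub/hz[yA yB [x xA hx] pB]; split=> //; apply/touchP; exists x => //.
by rewrite hx.
Qed.

(** Triples are colored by whether they span a claw in [A]. Since claws on both sides give a theta,
    either color leaves one side free of claws. *)
Lemma two_pendant_sides A B zs : conn e A -> conn e B -> anticomplete e A B ->
  uniq zs -> stable e [set y in zs] ->
  (forall y, y \in zs -> [/\ y \notin A, y \notin B, pendant e A y & pendant e B y]) ->
  size zs < ram3 (pendant_bound + pendant_bound).
Proof.
move=> cA cB AB uz stz hz; rewrite ltnNge; apply/negP => big.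
pose P y1 y2 y3 := `[< claw e A [set y1; y2; y3] >].
have stS (s : seq V) : {subset s <= zs} -> stable e [set y in s].
  by move=> sub; apply: stable_sub stz.
have [s ss [[sz hom]|[sz hom]]] := ramsey3 P big; have us := subseq_uniq ss uz;
  have sub := mem_subseq ss.
  have : size s < pendant_bound; last by rewrite sz ltnn.
  have BA : anticomplete e B A by rewrite anticomplete_sym.
  apply: (claw_free_pendants cB cA BA us (stS s sub)).
    by move=> y /sub/hz[].
  move=> y1 y2 y3 y1s y2s y3s n12 n13 n23 clB.
  have /asboolP clA : P y1 y2 y3.
    apply: (triplewise_distinct (P := P) _ _ us hom) => // x y z; rewrite /P.
      by rewrite set3_swap12.
    by rewrite set3_swap23.
  by have [S /notheta//] := claw_claw_theta AB n12 n13 n23 clA clB.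
have : size s < pendant_bound; last by rewrite sz ltnn.
apply: (claw_free_pendants cA cB AB us (stS s sub)).
  by move=> y /sub/hz[].
move=> y1 y2 y3 y1s y2s y3s n12 n13 n23 /asboolP; apply/negP.
apply: (triplewise_distinct (P := fun y1 y2 y3 => ~~ P y1 y2 y3) _ _ us hom) => // x y z; rewrite /P.
  by rewrite set3_swap12.
by rewrite set3_swap23.
Qed.

End Class.

End TwoSides.

(** * A path facing a side with pendant terminals *)

Lemma pairwise_triplewise (T : eqType) (r : rel T) (P : T -> T -> T -> bool) s :
  pairwise r s ->
  (forall x y z, x \in s -> y \in s -> z \in s -> r x y -> r x z -> r y z -> P x y z) ->
  triplewise P s.
Proof.
elim: s => //= x s IH /andP[/allP rx pw] h; apply/andP; split; last first.
  apply: IH => // u v w us vs ws; apply: h; by rewrite inE ?us ?vs ?ws orbT.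
have hx y z : y \in s -> z \in s -> r y z -> P x y z.
  by move=> ys zs; apply: h; rewrite ?inE ?eqxx ?ys ?zs ?orbT // rx.
elim: s pw hx {IH h rx} => //= y s IH /andP[/allP ry pw] hx; apply/andP; split.
  by apply/allP => z zs; apply: hx; rewrite ?inE ?eqxx ?zs ?orbT // ry.
by apply: IH => // u v us vs; apply: hx; rewrite inE ?us ?vs orbT.
Qed.

Lemma index_pairwise (T : eqType) (s : seq T) : uniq s ->
  pairwise (fun x y => index x s <= index y s) s.
Proof.
case: s => // x0 s us; apply/(pairwiseP x0) => i j; rewrite !inE => il jl ij.
by rewrite !index_uniq // ltnW.
Qed.

Section PathSide.
Variables (V : finType) (e : rel V).
Hypotheses (gsym : symmetric e) (girr : irreflexive e).
Implicit Types (A B L X Y Z S : {set V}) (u v w x y z : V) (s p q zs : seq V).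

(* A wide vertex can replace the part of [p] between its first and last neighbors. *)
Lemma reroute p y zs : ip e p -> uniq (y :: zs) -> stable e [set z in y :: zs] ->
  pairwise (before e p) (y :: zs) ->
  (forall z, z \in y :: zs -> [/\ z \notin p, touch e [set x in p] z & wide e p z]) ->
  exists q, [/\ ip e (y :: q), subseq (y :: zs) (y :: q),
    forall w, w \in y :: q -> w \in p \/ w \in y :: zs &
    forall w u, w \in q -> w \in p -> u \in p -> e y u -> index u p <= index w p].
Proof.
move=> ipp; elim: zs y => [|y' zs IH] y uz st pw hz.
  by exists [::]; split=> //= [|w]; [rewrite eqxx | right].
have sub : {subset y' :: zs <= [:: y, y' & zs]} by move=> x xs; rewrite inE xs orbT.
have /andP[yz uz'] := uz.
have /andP[/allP befy pw'] : all (before e p y) (y' :: zs) && pairwise (before e p) (y' :: zs) := pw.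
have [q [ipq ssq qE idxq]] := IH y' uz' (stable_sub sub st) pw' (fun z zz => hz z (sub z zz)).
have [yp ty _] := hz y (mem_head _ _).
have [y'p ty' wy'] := hz y' (sub y' (mem_head _ _)).
have bef := befy y' (mem_head _ _).
have [s [ips sn sp hs [sidx _]]] := bridge ipp ty ty' bef.
have /touchP[u' + y'u'] := ty'; rewrite inE => u'p.
have yq' : y \notin y' :: q.
  by apply/negP => /qE[yp'|yz']; [rewrite yp' in yp | rewrite yz' in yz].
have y'q : y' \notin q by have /andP[] := ip_uniq ipq.
have eyy' : e y y' = false by rewrite (stable_in st) // ?mem_head // sub ?mem_head.
have qp w : w \in q -> w \in p \/ w \in zs.
  move=> wq; have := qE w; rewrite inE wq orbT => /(_ isT)[wp|]; first by left.
  by rewrite inE => /predU1P[wy|]; [rewrite -wy wq in y'q | right].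
have eyq w : w \in y' :: q -> e y w = false.
  rewrite inE => /predU1P[->//|wq]; have [wp|wz] := qp w wq.
    apply/negP => yw; have := idxq w u' wq wp u'p y'u'.
    by rewrite leqNgt; case/negP; apply: (beforeP _ _ _ _ bef).
  by rewrite (stable_in st) ?mem_head // !inE wz !orbT.
have cross w v : w \in s -> v \in y' :: q ->
    w != v /\ e w v = (w == last y s) && (v == y').
  move=> ws; have wp := sp w ws; have hw u : u \in p -> e y' u -> index w p <= index u p.
    by move=> upp; case: (sidx w u ws upp).
  rewrite inE => /predU1P[->|vq].
    split; first by apply: contraNneq y'p => <-.
    by rewrite eqxx andbT gsym; have [] := hs y w ws.
  have -> : (v == y') = false by apply: contraNF y'q => /eqP<-.
  rewrite andbF; have [vp|vz] := qp v vq; last first.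
    have vz' : v \in y' :: zs by rewrite inE vz orbT.
    have [nvp _ _] := hz v (sub v vz'); split; first by apply: contraNneq nvp => <-.
    rewrite gsym; apply/negP => vw.
    have bef' : before e p y' v by have /andP[/allP/(_ v vz)] := pw'.
    by have := beforeP _ _ _ _ bef' u' w u'p wp y'u' vw; rewrite ltnNge hw.
  (* The new piece [s] stops no later than [u1], and the vertices of [q] on [p] come no earlier than
     [u2]; the gap between these two neighbors of [y'] excludes chords. *)
  have /wideP[u1 [u2 [u1p u2p yu1 yu2 lt12]]] := wy'.
  have i1 := hw u1 u1p yu1; have i2 := idxq v u2 vq vp u2p yu2.
  have lt : index w p + 2 <= index v p.
    by apply: leq_trans i2; apply: leq_trans lt12; rewrite leq_add2r.
  split; first by apply/eqP => wv; move: lt; rewrite wv addn2 ltnNge leqnSn.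
  rewrite (ip_index gsym girr ipp) //; apply/negbTE.
  by move: (index w p) (index v p) lt; clear; lia.
have ipsq : ip e (s ++ y' :: q) by apply: (ip_cat_nonempty (x0 := y)).
exists (s ++ y' :: q); split.
- rewrite -cat1s; apply: (ip_cat_nonempty (x0 := y)) => //; first by case: (s).
  move=> u v; rewrite inE => /eqP->; rewrite [last _ _]/= eqxx.
  have -> : head y (s ++ y' :: q) = head y s by case: (s) sn.
  have hds : head y s \in s by case: (s) sn => // a s' _; apply: mem_head.
  rewrite mem_cat => /orP[vs|vq].
    have [-> _] := hs y v vs; split=> //.
    by apply: contraNneq yp => ->; apply: sp.
  rewrite eyq //; split; first by apply: contraNneq yq' => ->.
  apply/esym/negbTE; apply/eqP => vh; have := eyq v vq; rewrite vh.
  by have [->] := hs y (head y s) hds; rewrite eqxx.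
- by rewrite [subseq _ _]/= eqxx; apply: subseq_trans ssq (suffix_subseq _ _).
- move=> w; rewrite inE mem_cat => /or3P[/eqP->|/sp|/qE[|]]; [by right; apply: mem_head | by left | by left |].
  by move=> wz; right; apply: sub.
move=> w u; rewrite mem_cat inE => /or3P[ws|/eqP->|wq] wp upp yu.
- by have [h _] := sidx w u ws upp; apply: h.
- by rewrite wp in y'p.
by apply: leq_trans (idxq w u' wq wp u'p y'u'); apply/ltnW/(beforeP _ _ _ _ bef).
Qed.

(** A claw would make the middle terminal a hub when its center is adjacent to it, and would give a
    theta otherwise. *)
Lemma claw_free_wide A B p y1 y2 y3 : (forall S, ~ theta e S) -> ~ hub e y2 ->
  anticomplete e A B -> ip e p -> {subset p <= B} ->
  stable e [set y in [:: y1; y2; y3]] ->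
  (forall y, y \in [:: y1; y2; y3] ->
     [/\ y \notin A, y \notin B, pendant e A y & touch e [set x in p] y]) ->
  y1 != y2 -> y1 != y3 -> y2 != y3 ->
  before e p y1 y2 -> before e p y2 y3 -> before e p y1 y3 -> wide e p y2 ->
  ~ claw e A [set y1; y2; y3].
Proof.
move=> notheta nhub AB ipp pB st hz n12 n13 n23 b12 b23 b13 wy2 [a [L [aA hL aL]]].
have aAB := anticompleteP _ _ _ AB.
have in1 : y1 \in [set y1; y2; y3] by rewrite !inE eqxx.
have in2 : y2 \in [set y1; y2; y3] by rewrite !inE eqxx orbT.
have in3 : y3 \in [set y1; y2; y3] by rewrite !inE eqxx orbT.
have im1 : y1 \in [:: y1; y2; y3] by rewrite !inE eqxx.
have im2 : y2 \in [:: y1; y2; y3] by rewrite !inE eqxx orbT.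
have im3 : y3 \in [:: y1; y2; y3] by rewrite !inE eqxx !orbT.
have [A1 B1 p1 t1] := hz y1 im1; have [A2 B2 p2 t2] := hz y2 im2; have [A3 B3 p3 t3] := hz y3 im3.
have [yL1 /subsetP sL1 cL1 naL1 ta1] := hL y1 in1.
have [yL2 /subsetP sL2 cL2 naL2 ta2] := hL y2 in2.
have [yL3 /subsetP sL3 cL3 naL3 ta3] := hL y3 in3.
have l12 := anticompleteP _ _ _ (aL y1 y2 in1 in2 n12).
have l13 := anticompleteP _ _ _ (aL y1 y3 in1 in3 n13).
have l23 := anticompleteP _ _ _ (aL y2 y3 in2 in3 n23).
have /wideP[u1 [u2 [u1p u2p yu1 yu2 lt12]]] := wy2.
have [s12 [ip12 sn12 sp12 hs12 [idx12 _]]] := bridge ipp t1 t2 b12.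
have [s23 [ip23 sn23 sp23 hs23 [idx23 _]]] := bridge ipp t2 t3 b23.
have [s13 [ip13 sn13 sp13 hs13 [idx13 all13]]] := bridge ipp t1 t3 b13.
have hd s : s != [::] -> head a s \in s by case: s => // *; apply: mem_head.
have lst s : s != [::] -> last a s \in s by case: s => // x s _; apply: (mem_last x s).
have legB y v w : {subset L y <= y |: A} -> y \notin B -> v \in L y -> w \in p ->
    (v = y -> e y w = false) -> v != w /\ e v w = false.
  move=> sL yB vL wp hy; have := sL v vL; rewrite !inE => /predU1P[vy|vA].
    by rewrite vy hy // -vy; split=> //; apply: contraNneq yB => h; rewrite -vy h pB.
  by apply: aAB => //; apply: pB.
have [ay2|nay2] := boolP (e a y2).
  (* The hole runs from [y1] to [y3] through [a] and back along [p]. It contains [a] and two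
     nonadjacent neighbors of [y2] on [p], which makes [y2] a hub. *)
  have cT : conn e (a |: (L y1 :|: L y3)).
    have c1 : conn e (a |: L y1) by apply: connU1.
    have -> : a |: (L y1 :|: L y3) = (a |: L y1) :|: L y3 by rewrite setUA.
    by apply: (@connU_touch _ e gsym _ _ a) => //; rewrite !inE eqxx.
  have [||r [ipr lr sr]] := conn_ip (x := y1) (y := y3) cT.
  - by rewrite !inE yL1 orbT.
  - by rewrite !inE yL3 !orbT.
  set P0 := y1 :: r in ipr sr.
  have y3P : y3 \in P0 by rewrite -lr mem_last.
  have aP : a \in P0.
    apply: contraT => naP.
    have sr' v : v \in P0 -> v \in L y1 \/ v \in L y3.
      move=> vP; have := sr v vP; rewrite !inE => /or3P[/eqP va|->|->]; [|by left|by right].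
      by rewrite -va vP in naP.
    have /subsetP/(_ y3) : [set x in P0] \subset L y1.
      apply: (conn_closed (x := y1) (ip_conn gsym ipr)); rewrite ?inE ?eqxx //.
      move=> u v uL _; rewrite inE => /sr'[//|vL3] uv.
      by have [_] := l13 u v uL vL3; rewrite uv.
    rewrite inE y3P => /(_ isT) y3L1.
    by have [] := l13 y3 y3 y3L1 yL3; rewrite eqxx.
  have ya y : y \notin A -> a != y by apply: contraNneq => <-.
  have szP : 3 <= size P0.
    have us : uniq [:: y1; a; y3].
      by rewrite /= !inE negb_or n13 andbT eq_sym ya //= ya.
    apply: (uniq_leq_size us) => v; rewrite !inE => /or3P[] /eqP-> //.
    by rewrite eqxx.
  have hH : hole e ([set x in P0] :|: [set x in s13]).
    apply: (hole_cat_nonempty gsym girr (x0 := a)) => //.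
    move=> u v uP vs; have vp := sp13 v vs; have [h1 h3] := hs13 a v vs.
    rewrite -[head a P0]/y1 [last a P0]lr.
    have [->|uy1] := eqVneq u y1.
      rewrite h1 (negbTE n13) orbF; split=> //.
      by apply: contraNneq B1 => ->; apply: pB.
    have [->|uy3] := eqVneq u y3.
      by rewrite h3; split=> //; apply: contraNneq B3 => ->; apply: pB.
    apply: aAB; last exact: pB.
    have := sr u uP; rewrite !inE => /or3P[/eqP->//|/sL1|/sL3]; rewrite !inE.
      by rewrite (negbTE uy1).
    by rewrite (negbTE uy3).
  have inH u : u \in p -> e y2 u -> u \in [set x in P0] :|: [set x in s13].
    move=> upp yu; rewrite !inE; apply/orP; right; apply: all13 => // w wp yw.
      exact: (beforeP _ _ _ _ b12).
    exact: (beforeP _ _ _ _ b23).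
  have a12 u : u \in p -> a != u /\ ~~ e a u.
    by move=> upp; have [-> ->] := aAB a u aA (pB u upp).
  have [au1 nau1] := a12 u1 u1p; have [au2 nau2] := a12 u2 u2p.
  apply: (nonhub_adjacent gsym girr hH nhub (u := a) (v := u1) (w := u2)) => //; try exact: inH.
  - by rewrite in_setU in_set aP.
  - by rewrite gsym.
  - by apply/eqP => u12; move: lt12; rewrite u12 addn2 ltnNge leqnSn.
  rewrite (ip_index gsym girr ipp) //.
  by move: (index u1 p) (index u2 p) lt12; clear; lia.
(* The theta has ends [a] and [y2]: one path uses the leg of [y2], the others go through [y1] and
   [y3] and along [p] to the two ends of the span of [y2]. *)
have ay2' : a != y2 by apply: contraNneq A2 => <-.
have S1A : L y2 :\ y2 \subset A.
  by apply/subsetP => v /setD1P[vy /sL2]; rewrite !inE (negbTE vy).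
have ta2' : touch e (L y2 :\ y2) a.
  have /touchP[v vL av] := ta2; apply/touchP; exists v => //.
  by rewrite in_setD1 vL andbT; apply: contraNneq nay2 => <-.
have ty2 : touch e (L y2 :\ y2) y2.
  have /touchP[v /setD1P[vy vL] _] := ta2'.
  have [||||x1 [x2 [/set1P-> _ x2L x2y yx2]]] :=
    conn_leave (T := [set y2]) (x := y2) (y := v) cL2 => //; rewrite ?inE //.
  by apply/touchP; exists x2 => //; rewrite in_setD1 x2L andbT -in_set1.
have cS1 : conn e (L y2 :\ y2).
  apply: conn_setD_leaves => // [u _ /set1P->//|u v w _ /set1P-> vL wL yv yw].
  have [x xA hx] := p2.
  have inA z : z \in L y2 -> e y2 z -> z \in A.
    move=> /sL2; rewrite !inE => /predU1P[->|//]; by rewrite girr.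
  have /eqP -> : v == x by rewrite -hx ?inA.
  by have /eqP -> : w == x by rewrite -hx ?inA.
have cS2 : conn e (L y1 :|: [set x in s12]).
  apply: (@connU _ e gsym _ _ y1 (head a s12)) => //; first exact: ip_conn.
    by rewrite inE hd.
  by right; have [->] := hs12 a _ (hd _ sn12); rewrite eqxx.
have cS3 : conn e (L y3 :|: [set x in s23]).
  apply: (@connU _ e gsym _ _ y3 (last a s23)) => //; first exact: ip_conn.
    by rewrite inE lst.
  by right; have [_ ->] := hs23 a _ (lst _ sn23); rewrite eqxx.
have i12 w : w \in s12 -> index w p <= index u1 p.
  by move=> ws; have [_ h] := idx12 w u1 ws u1p; apply: h.
have i23 w : w \in s23 -> index u2 p <= index w p.
  by move=> ws; have [h _] := idx23 w u2 ws u2p; apply: h.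
have lt12' : index u1 p < index u2 p by move: lt12; rewrite addn2 => /ltnW.
have [S /notheta//] : exists S, theta e S.
apply: (theta_sets gsym girr cS1 cS2 cS3 ay2' nay2) => //.
- by rewrite touchU ta1.
- rewrite touchU; apply/orP; right; apply/touchP; exists (last a s12); first by rewrite inE lst.
  by have [_ ->] := hs12 a _ (lst _ sn12); rewrite eqxx.
- by rewrite touchU ta3.
- rewrite touchU; apply/orP; right; apply/touchP; exists (head a s23); first by rewrite inE hd.
  by have [-> _] := hs23 a _ (hd _ sn23); rewrite eqxx.
- rewrite anticompleteUr //; apply/andP; split; apply/anticompleteP => u v uS.
    have uL : u \in L y2 by case/setD1P: uS.
    by move=> vL; have [] := l12 v u vL uL; rewrite eq_sym gsym.
  by rewrite inE => /sp12/pB vB; apply: aAB => //; apply: (subsetP S1A).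
- rewrite anticompleteUr //; apply/andP; split; apply/anticompleteP => u v uS.
    have uL : u \in L y2 by case/setD1P: uS.
    exact: l23.
  by rewrite inE => /sp23/pB vB; apply: aAB => //; apply: (subsetP S1A).
rewrite anticompleteUr // !anticompleteUl; apply/andP; split; apply/andP; split.
- exact: aL.
- apply/anticompleteP => u v; rewrite inE => us vL; have up' := sp12 u us.
  have [] := legB y3 v u sL3 B3 vL up'; last by rewrite eq_sym gsym.
  move=> _; apply/negP => y3u; have := beforeP _ _ _ _ b23 u1 u u1p up' yu1 y3u.
  by rewrite ltnNge i12.
- apply/anticompleteP => u v uL; rewrite inE => vs; have vp := sp23 v vs.
  apply: (legB y1) => // _; apply/negP => y1v.
  by have := beforeP _ _ _ _ b12 v u2 vp u2p y1v yu2; rewrite ltnNge i23.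
apply/anticompleteP => u v; rewrite !inE => us vs.
have iu := i12 u us; have iv := i23 v vs.
split; first by apply/eqP => uv; move: (leq_ltn_trans iu (leq_trans lt12' iv)); rewrite uv ltnn.
rewrite (ip_index gsym girr ipp (sp12 u us) (sp23 v vs)); apply/negbTE.
move: iu iv lt12; clear; move: (index u1 p) (index u2 p) (index u p) (index v p) => i1 i2 i j.
by lia.
Qed.

End PathSide.

(** * The bound for terminals attached to two anticomplete sets *)

Section TwoAttachments.
Variables (V : finType) (e : rel V).
Hypotheses (gsym : symmetric e) (girr : irreflexive e).
Implicit Types (A B L X Y Z S : {set V}) (u v w x y z : V) (s p q zs : seq V).
Variables (t k : nat).
Hypothesis notheta : forall S, ~ theta e S.
Hypothesis noprism : forall S, ~ prism e S.
Hypothesis small_clique : forall K : {set V}, clique e K -> #|K| < t.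
Hypothesis nopyramid : forall S, ~ generalized_pyramid e k S.

(** A terminal with at least two neighbors on [p], but no two nonadjacent ones, sees exactly an edge
    of [p]. The terminals themselves are then the teeth of a comb of kind [true]. *)
Lemma narrow_path_bound A B p zs : conn e A -> conn e B -> anticomplete e A B ->
  ip e p -> {subset p <= B} -> uniq zs -> stable e [set y in zs] ->
  pairwise (before e p) zs ->
  (forall y, y \in zs -> [/\ y \notin A, y \notin B, pendant e A y,
     1 < #|nbh e y :&: [set x in p]| & ~~ wide e p y]) ->
  size zs < comb_bound t (comb_comb_bound k).
Proof.
move=> cA cB AB ipp pB uz st pw hz; have up := ip_uniq ipp.
have [c hc] : {c : V -> nat & forall y, y \in zs -> (c y).+1 < size p /\
    forall w, w \in p -> e y w = (index w p == c y) || (index w p == (c y).+1)}.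
  apply: (@choice _ _ (fun y c => y \in zs -> c.+1 < size p /\
    forall w, w \in p -> e y w = (index w p == c) || (index w p == c.+1))) => y.
  have [yz|] := boolP (y \in zs); last by exists 0.
  have [_ _ _ two nw] := hz y yz.
  by have [c ltc hc] := not_wide_nbrs nw two; exists c.
have tz y : y \in zs -> touch e [set x in p] y.
  move=> yz; have [ltc hcy] := hc y yz; apply/touchP; exists (nth y p (c y)).
    by rewrite inE mem_nth // ltnW.
  by rewrite hcy ?mem_nth ?index_uniq ?eqxx // ltnW.
have cmb : comb e true B p zs (fun y => [set y]) id c.
  split; split=> //.
  - apply: (sub_in_pairwise (P := mem zs)) pw; last by apply/allP.
    move=> y y' yz y'z /beforeP bef; have [ltc hcy] := hc y yz; have [ltc' hcy'] := hc y' y'z.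
    have := bef (nth y p (c y)) (nth y p (c y')).
    rewrite !mem_nth ?index_uniq ?(ltnW ltc) ?(ltnW ltc') // addn1.
    by apply; rewrite // ?hcy ?hcy' ?mem_nth ?index_uniq ?eqxx // ltnW.
  - move=> y yz; rewrite !set11 sub1set !inE eqxx; split=> //; exact: conn1.
  - by move=> y /hc[ltc _]; rewrite addn1.
  - move=> y v w yz /set1P-> wp; have [_ hcy] := hc y yz; have [_ yB _ _ _] := hz y yz.
    by rewrite hcy // eqxx; split=> //; apply: contraNneq yB => ->; apply: pB.
  move=> y y' yz y'z yy'; apply/anticompleteP => u v /set1P-> /set1P->.
  by rewrite yy' (stable_in st).
have BA : anticomplete e B A by rewrite anticomplete_sym.
apply: (pendant_claw_comb gsym girr notheta noprism small_clique nopyramid cB cA BA cmb st).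
move=> y yz; have [yA yB pA two _] := hz y yz; split=> //.
by apply: touchS (tz y yz); apply/subsetP => x; rewrite inE; apply: pB.
Qed.

(** As in [comb_comb_bound]; the inner power here aligns the order of the teeth on the comb with the
    order of the terminals along the other path. *)
Definition wide_bound := comb_bound t (2 ^ (2 ^ (k.+2 + k.+2) + 3)).

(** [A] has no claws, hence contains a comb of kind [true]. Rerouting [p] through the terminals
    turns each of them into the foot of its own rung on the new path, which yields a ladder. *)
Lemma wide_path_bound A B p zs : conn e A -> anticomplete e A B ->
  ip e p -> {subset p <= B} -> uniq zs -> stable e [set y in zs] ->
  pairwise (before e p) zs ->
  (forall y, y \in zs -> [/\ ~ hub e y, y \notin A, y \notin B, pendant e A y & wide e p y]) ->
  size zs < wide_bound.
Proof.
move=> cA AB ipp pB uz st pw hz; rewrite ltnNge; apply/negP => big.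
have aAB := anticompleteP _ _ _ AB.
have tz y : y \in zs -> touch e [set x in p] y.
  move=> /hz[_ _ _ _ /wideP[w [_ [wp _ yw _ _]]]].
  by apply/touchP; exists w; rewrite ?inE.
pose P x y z := ~~ `[< claw e A [set x; y; z] >].
have noclaw y1 y2 y3 : y1 \in zs -> y2 \in zs -> y3 \in zs ->
    y1 != y2 -> y1 != y3 -> y2 != y3 -> ~ claw e A [set y1; y2; y3].
  move=> z1 z2 z3 n12 n13 n23 /asboolP; apply/negP.
  (* The claw predicate is symmetric, so triples in their order along [p] suffice. *)
  apply: (triplewise_distinct (P := P) _ _ uz) => // [x y z|x y z|].
  - by rewrite /P set3_swap12.
  - by rewrite /P set3_swap23.
  apply: (pairwise_triplewise (r := fun x y => before e p x y && (x != y))).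
    rewrite pairwise_relI pw /=; by rewrite uniq_pairwise in uz.
  move=> x y z xz yz zz /andP[bxy nxy] /andP[bxz nxz] /andP[byz nyz]; apply/negP => /asboolP.
  have sub w : w \in [:: x; y; z] -> w \in zs.
    by rewrite !inE => /or3P[] /eqP->.
  have [nhub _ _ _ wy] := hz y yz.
  apply: (claw_free_wide gsym girr notheta nhub AB ipp pB _ _ nxy nxz nyz bxy byz bxz wy).
    exact: stable_sub sub st.
  by move=> w /sub wz; have [_ ? ? ? _] := hz w wz; split=> //; apply: tz.
have [|s [zs1 [Lam [at_ [pos [cmb sz1 sub1]]]]]] :=
  claw_free_comb gsym girr small_clique cA uz st _ noclaw big.
  by move=> y /hz[].
have [zs2 [ss2 sz2 pw2]] := comb_spread cmb (eq_leq (esym sz1)).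
have [_ _ uz1 _] := cmb.1.
have uz2 := subseq_uniq ss2 uz1.
have sub2 y : y \in zs2 -> y \in zs by move=> /(mem_subseq ss2)/sub1.
pose L := filter (mem zs2) zs.
have szL : size L = 2 ^ (k.+2 + k.+2) by rewrite size_filter_mem.
have uL : uniq L by rewrite filter_uniq.
have cmpL : {in L &, forall y y', y != y' -> pos y + 2 <= pos y' \/ pos y' + 2 <= pos y}.
  move=> y y'; rewrite !mem_filter => /andP[yz _] /andP[y'z _].
  exact: (pairwise_comparable pw2 yz y'z).
have [L2 [ssL szL2 hL2]] := ramsey2_chain (r := fun y y' => pos y + 2 <= pos y') uL cmpL (eq_leq (esym szL)).
have ss : subseq L2 zs by apply: subseq_trans ssL (filter_subseq _ _).
have uL2 := subseq_uniq ss uz; have subL := mem_subseq ss.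
have subL2 y : y \in L2 -> y \in zs2.
  by move=> /(mem_subseq ssL); rewrite mem_filter => /andP[].
case def_L2: L2 (szL2) => [//|y0 L3] _.
have [||||q0 [ipq ssq qE _]] := reroute gsym girr (y := y0) (zs := L3) ipp; rewrite -?def_L2 //.
- exact: stable_sub subL st.
- exact: subseq_pairwise ss pw.
- move=> z zL; have [_ _ zB _ wz] := hz z (subL z zL); split=> //; last exact: tz (subL z zL).
  by apply: contra zB; apply: pB.
rewrite -def_L2 in ssq qE; set q := y0 :: q0 in ipq ssq qE.
have uq := ip_uniq ipq.
have [[ips sA _ _] [h1 h2 h3 h4]] := cmb.
have s1 y : y \in L2 -> y \in zs1 by move=> /subL2/(mem_subseq ss2).
have [b hb] : {b : V -> V & forall y, y \in zs -> b y \in A /\ forall v, v \in A -> e y v = (v == b y)}.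
  apply: (@choice _ _ (fun y x => y \in zs -> x \in A /\ forall v, v \in A -> e y v = (v == x))) => y.
  have [yz|] := boolP (y \in zs); last by exists y.
  by have [_ _ _ [x xA hx] _] := hz y yz; exists x.
have nA y : y \in zs -> y \notin A by move=> /hz[].
have nB y : y \in zs -> y \notin B by move=> /hz[].
(* The terminal lies on the rerouted path, so the rung stops just before it, at its only neighbor
   [b y] in [A]. *)
pose G y := Lam y :\ y.
have GA y v : y \in L2 -> v \in G y -> v \in A.
  move=> yL /setD1P[vy vLam]; have [_ _ sLam _] := h1 y (s1 y yL).
  by have := subsetP sLam v vLam; rewrite !inE (negbTE vy).
have sp2 y : y \in L2 -> (pos y).+1 < size s by move=> /s1/h2; rewrite addn1.
(* [at_ y] has two neighbors on the path [s] in [A], whereas [y] has a single neighbor in [A]. *)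
have atne y : y \in L2 -> at_ y != y.
  move=> yL; apply/eqP => aty; have [_ atL _ _] := h1 y (s1 y yL); have lt := sp2 y yL.
  have us := ip_uniq ips; pose g i := nth y s i.
  have gs i : i < size s -> g i \in s by move=> il; rewrite mem_nth.
  have [bA hy] := hb y (subL y yL).
  have eg i : i < size s -> (i == pos y) || (i == (pos y).+1) -> g i = b y.
    move=> il hi; apply/eqP; rewrite -hy; last by apply/sA/gs.
    by rewrite -{1}aty; have [_ ->] := h3 y _ (g i) (s1 y yL) atL (gs i il); rewrite eqxx index_uniq.
  have : g (pos y) = g (pos y).+1 by rewrite !eg ?eqxx ?orbT // ltnW.
  by move/eqP; rewrite nth_uniq // ?(ltnW lt) // ltn_eqF.
have hG y : y \in L2 -> [/\ conn e (G y), at_ y \in G y, b y \in G y,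
    (pos y).+1 < size s & index y q < size q].
  move=> yL; have [yLam atL sLam cLam] := h1 y (s1 y yL); have [bA hy] := hb y (subL y yL).
  have atG : at_ y \in G y by rewrite in_setD1 atL atne.
  have bG : b y \in G y.
    have ny : at_ y \notin [set y] by rewrite inE atne.
    have [x1 [x2 [/set1P-> _ x2L x2y yx2]]] := conn_leave cLam (set11 y) yLam atL ny.
    have x2G : x2 \in G y by rewrite in_setD1 x2L andbT -in_set1.
    by have := hy x2 (GA y x2 yL x2G); rewrite yx2 => /esym/eqP <-.
  split=> //; last 2 first.
  - exact: sp2.
  - by rewrite index_mem; apply: (mem_subseq ssq).
  apply: conn_setD_leaves => // [u _ /set1P->|u v w _ /set1P-> vL wL yv yw].
    by apply/touchP; exists (b y); rewrite // hy.
  have inG z : z \in Lam y -> e y z -> z \in A.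
    by move=> zL yz; apply: (GA y) => //; rewrite in_setD1 zL andbT; apply: contraTneq yz => ->; rewrite girr.
  have /eqP -> : v == b y by rewrite -hy ?inG.
  by have /eqP -> : w == b y by rewrite -hy ?inG.
have GL y v : v \in G y -> v \in Lam y by case/setD1P.
have hp y v w : y \in L2 -> v \in G y -> w \in s -> v != w /\
    e v w = (v == at_ y) && ((index w s == pos y) || (index w s == (pos y).+1)).
  by move=> yL /GL vL ws; apply: h3 => //; apply: s1.
have hq y v w : y \in L2 -> v \in G y -> w \in q -> v != w /\
    e v w = (v == b y) && (index w q == index y q).
  move=> yL vG wq; have vA := GA y v yL vG; have [bA hy] := hb y (subL y yL).
  have yq := mem_subseq ssq yL; rewrite index_inj_in //.
  have [/pB wB|wL] := qE w wq.
    have [-> ->] := aAB v w vA wB; split=> //; apply/esym/negbTE; rewrite negb_and orbC.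
    by apply/orP; left; apply: contraTneq wB => ->; apply: nB (subL y yL).
  have wA := nA w (subL w wL); split; first by apply: contraNneq wA => <-.
  have [->|wy] := eqVneq w y; first by rewrite andbT gsym hy.
  have [wLam _ _ _] := h1 w (s1 w wL).
  have := anticompleteP _ _ _ (h4 y w (s1 y yL) (s1 w wL) _) v w (GL y v vG) wLam.
  by rewrite eq_sym wy => /(_ isT)[_ ->]; rewrite andbF.
have anti y y' : y \in L2 -> y' \in L2 -> y != y' -> anticomplete e (G y) (G y').
  move=> yL y'L yy'; apply: anticompleteS (h4 y y' (s1 y yL) (s1 y' y'L) yy'); exact: subsetDl.
have sq : anticomplete e [set x in s] [set x in q].
  apply/anticompleteP => u w; rewrite !inE -[(w == y0) || _]/(w \in q) => us wq.
  have uA := sA u us; have [/pB wB|wL] := qE w wq; first exact: aAB.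
  have [wLam _ _ _] := h1 w (s1 w wL).
  have [nwu ewu] := h3 w w u (s1 w wL) wLam us; rewrite eq_sym gsym nwu ewu eq_sym.
  by rewrite (negbTE (atne w wL)).
have mono := subseq_pairwise ssq (index_pairwise uq).
case: hL2 => hom.
  by have [S /nopyramid] := ladder gsym girr ips ipq sq uL2 szL2 hom mono hG hp hq anti.
have mr y : (y \in rev L2) = (y \in L2) by rewrite mem_rev.
have [||||||||S /nopyramid//] := @ladder_rev V e gsym girr k s q (rev L2) G at_ b pos
    (fun y => index y q) ips ipq sq.
- by rewrite rev_uniq.
- by rewrite size_rev.
- by rewrite pairwise_rev.
- by rewrite pairwise_rev.
- by move=> y; rewrite mr; apply: hG.
- by move=> y v w; rewrite mr; apply: hp.
- by move=> y v w; rewrite mr; apply: hq.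
by move=> y y'; rewrite !mr; apply: anti.
Qed.

Definition pendant_path_bound := wide_bound + comb_bound t (comb_comb_bound k).

Lemma pendant_path A B p zs : conn e A -> conn e B -> anticomplete e A B ->
  ip e p -> {subset p <= B} -> uniq zs -> stable e [set y in zs] ->
  pairwise (before e p) zs ->
  (forall y, y \in zs -> [/\ ~ hub e y, y \notin A, y \notin B, pendant e A y &
     1 < #|nbh e y :&: [set x in p]|]) ->
  size zs < pendant_path_bound.
Proof.
move=> cA cB AB ipp pB uz st pw hz.
rewrite -(count_predC (wide e p) zs) -!size_filter /pendant_path_bound -addSn.
have fs (a : pred V) : {subset filter a zs <= zs} by move=> x; rewrite mem_filter => /andP[].
apply: leq_add; last apply: ltnW.
  apply: (wide_path_bound cA AB ipp pB) (filter_uniq _ uz) (stable_sub (fs _) st) _ _.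
    exact: subseq_pairwise (filter_subseq _ _) pw.
  by move=> y; rewrite mem_filter => /andP[wy /hz[]].
apply: (narrow_path_bound cA cB AB ipp pB) (filter_uniq _ uz) (stable_sub (fs _) st) _ _.
  exact: subseq_pairwise (filter_subseq _ _) pw.
by move=> y; rewrite mem_filter => /andP[wy /hz[]].
Qed.

(** [y1] and [y3] are joined by a stretch of each path, and the resulting hole contains all
    neighbors of [y2] on both: at least two in [A] and two in [B], which is too many for a
    non-hub. *)
Lemma between_two_paths A B p p' s' y1 y2 y3 : anticomplete e A B ->
  ip e p -> {subset p <= A} -> {subset p' <= B} ->
  before e p y1 y2 -> before e p y2 y3 -> before e p y1 y3 ->
  (forall y, y \in [:: y1; y2; y3] -> y \notin A /\ y \notin B) ->
  y1 != y3 -> ~~ e y1 y3 ->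
  touch e [set x in p] y1 -> touch e [set x in p] y3 ->
  ip e s' -> s' != [::] -> {subset s' <= p'} ->
  (forall x0 w, w \in s' -> e y1 w = (w == head x0 s') /\ e y3 w = (w == last x0 s')) ->
  (forall w, w \in p' -> e y2 w -> w \in s') ->
  1 < #|nbh e y2 :&: [set x in p]| -> 1 < #|nbh e y2 :&: [set x in p']| -> hub e y2.
Proof.
move=> AB ipp pA p'B b12 b23 b13 hy n13 n13e t1 t3 ips' sn' sp' hs' all' two two'.
have aAB := anticompleteP _ _ _ AB.
have [A1 B1] : y1 \notin A /\ y1 \notin B by apply: hy; rewrite !inE eqxx.
have [A3 B3] : y3 \notin A /\ y3 \notin B by apply: hy; rewrite !inE eqxx !orbT.
have [s [ips sn sp hs [_ alls]]] := bridge ipp t1 t3 b13.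
have hd r : r != [::] -> head y1 r \in r by case: r => // *; apply: mem_head.
have lst r : r != [::] -> last y1 r \in r by case: r => // x r _; apply: (mem_last x r).
have ip3 : ip e (rcons s y3).
  rewrite -cats1; apply: (ip_cat_nonempty (x0 := y1)) => // u v us; rewrite inE => /eqP->.
  rewrite [head _ _]/= eqxx andbT gsym; have [_ ->] := hs y1 u us.
  by split=> //; apply: contraNneq A3 => <-; apply/pA/sp.
have ipP : ip e (y1 :: rcons s y3).
  rewrite -cat1s; apply: (ip_cat_nonempty (x0 := y1)) => //; first by case: (s).
  move=> u v; rewrite inE mem_rcons inE => /eqP-> vs; rewrite [last _ _]/= eqxx.
  have -> : head y1 (rcons s y3) = head y1 s by case: (s) sn.
  case/predU1P: vs => [->|vs].
    split=> //; rewrite (negbTE n13e); apply/esym/negbTE; apply: contraNneq A3 => ->.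
    by apply/pA/sp/hd.
  have [-> _] := hs y1 v vs; split=> //.
  by apply: contraNneq A1 => ->; apply/pA/sp.
have hH : hole e ([set x in y1 :: rcons s y3] :|: [set x in s']).
  apply: (hole_cat_nonempty gsym girr (x0 := y1)) => //.
    by rewrite /= size_rcons !ltnS lt0n size_eq0.
  move=> u v; rewrite inE mem_rcons inE /= last_rcons => us vs.
  have vB := p'B v (sp' v vs); have [h1 h3] := hs' y1 v vs.
  case/or3P: us => [/eqP->|/eqP->|us].
  - by rewrite h1 eqxx (negbTE n13) orbF; split=> //; apply: contraNneq B1 => ->.
  - by rewrite h3 eqxx [y3 == y1]eq_sym (negbTE n13); split=> //; apply: contraNneq B3 => ->.
  have uA := pA u (sp u us); have [-> ->] := aAB u v uA vB; split=> //.
  have -> : (u == y1) = false by apply: contraNF A1 => /eqP<-.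
  by have -> : (u == y3) = false by apply: contraNF A3 => /eqP<-.
apply: contrapT => nhub; have := nonhub_lt4 hH nhub; rewrite ltnNge; case/negP.
have sub : (nbh e y2 :&: [set x in p]) :|: (nbh e y2 :&: [set x in p']) \subset
    nbh e y2 :&: ([set x in y1 :: rcons s y3] :|: [set x in s']).
  apply/subsetP => w; rewrite !inE mem_rcons inE => /orP[/andP[y2w wp]|/andP[y2w wp]]; rewrite y2w /=.
    rewrite alls ?orbT //.
      by move=> u upp yu; apply: (beforeP _ _ _ _ b12).
    by move=> u upp yu; apply: (beforeP _ _ _ _ b23).
  by rewrite all' ?orbT.
apply: leq_trans (subset_leq_card sub); rewrite cardsU.
have -> : (nbh e y2 :&: [set x in p]) :&: (nbh e y2 :&: [set x in p']) = set0.
  apply/setP => w; rewrite !inE; apply/negP => /andP[/andP[_ wp] /andP[_ wp']].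
  by have [] := aAB w w (pA w wp) (p'B w wp'); rewrite eqxx.
by rewrite cards0 subn0; apply: (leq_add two two').
Qed.

(** Ramsey gives three terminals in the same or in opposite order on the two paths. Either way the
    same one lies in the middle on both, whence [2 ^ (3 + 3)]. *)
Lemma two_paths A B p p' zs zs' : anticomplete e A B ->
  ip e p -> {subset p <= A} -> ip e p' -> {subset p' <= B} ->
  uniq zs -> stable e [set y in zs] -> pairwise (before e p) zs -> pairwise (before e p') zs' ->
  {subset zs <= zs'} ->
  (forall y, y \in zs -> [/\ ~ hub e y, y \notin A, y \notin B,
     1 < #|nbh e y :&: [set x in p]| & 1 < #|nbh e y :&: [set x in p']|]) ->
  size zs < 2 ^ (3 + 3).
Proof.
move=> AB ipp pA ipp' p'B uz st pw pw' sub hz; rewrite ltnNge; apply/negP => big.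
have tch (r : seq V) y : 1 < #|nbh e y :&: [set x in r]| -> touch e [set x in r] y.
  move=> gt1; have /set0Pn[x] : nbh e y :&: [set x in r] != set0 by rewrite -card_gt0 ltnW.
  by rewrite !inE => /andP[yx xr]; apply/touchP; exists x; rewrite ?inE.
have cmp : {in zs &, forall y y', y != y' -> before e p' y y' \/ before e p' y' y}.
  by move=> y y' /sub yz /sub y'z; apply: (pairwise_comparable pw' yz y'z).
have [s [ss sz hom]] := ramsey2_chain uz cmp big.
have us := subseq_uniq ss uz; have subs := mem_subseq ss; have pws := subseq_pairwise ss pw.
case: s sz us subs pws hom {ss} => [|y1 [|y2 [|y3 []]]] //= _ us subs pws hom.
have [m1 m2 m3] : [/\ y1 \in zs, y2 \in zs & y3 \in zs].
  by split; apply: subs; rewrite !inE eqxx ?orbT.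
have n13 : y1 != y3 by move: us; rewrite !inE negb_or => /andP[/andP[]].
move: pws; rewrite !andbT => /andP[/andP[b12 b13] b23].
have [h1 A1 B1 two1 two1'] := hz y1 m1; have [h2 A2 B2 two2 two2'] := hz y2 m2.
have [h3 A3 B3 two3 two3'] := hz y3 m3.
have hy y : y \in [:: y1; y2; y3] -> y \notin A /\ y \notin B.
  by rewrite !inE => /or3P[] /eqP->.
have n13e : ~~ e y1 y3 by rewrite (stable_in st).
apply: h2; case: hom; rewrite !andbT => /andP[/andP[c12 c13] c23].
  have [s' [ips' sn' sp' hs' [_ alls']]] := bridge ipp' (tch _ _ two1') (tch _ _ two3') c13.
  apply: (between_two_paths AB ipp pA p'B b12 b23 b13 hy n13 n13e (tch _ _ two1) (tch _ _ two3)
    ips' sn' sp' hs' _ two2 two2').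
  move=> w wp y2w; apply: alls' => // u upp yu.
    exact: (beforeP _ _ _ _ c12).
  exact: (beforeP _ _ _ _ c23).
have [s' [ips' sn' sp' hs' [_ alls']]] := bridge ipp' (tch _ _ two3') (tch _ _ two1') c13.
have hr : forall x0, head x0 (rev s') = last x0 s' /\ last x0 (rev s') = head x0 s'.
  move=> x0; split; first by case/lastP: (s') => // r z; rewrite rev_rcons last_rcons.
  by case: (s') => // z r; rewrite rev_cons last_rcons.
apply: (between_two_paths (s' := rev s') AB ipp pA p'B b12 b23 b13 hy n13 n13e (tch _ _ two1) (tch _ _ two3)
    _ _ _ _ _ two2 two2').
- exact: ip_rev.
- by rewrite -size_eq0 size_rev size_eq0.
- by move=> x; rewrite mem_rev => /sp'.
- by move=> x0 w; rewrite mem_rev => ws; have [-> ->] := hr x0; have [-> ->] := hs' x0 w ws.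
move=> w wp y2w; rewrite mem_rev; apply: alls' => // u upp yu.
  exact: (beforeP _ _ _ _ c23).
exact: (beforeP _ _ _ _ c12).
Qed.

(** One [side_bound] is spent on each side. The sum dominates the bounds for two paths, for a path
    facing pendant terminals, and for two pendant sides. *)
Definition two_sides_bound :=
  side_bound (side_bound (2 ^ (3 + 3) + pendant_path_bound +
    ram3 (pendant_bound t k + pendant_bound t k))).

Lemma two_sides A B zs : conn e A -> conn e B -> anticomplete e A B ->
  uniq zs -> stable e [set y in zs] ->
  (forall y, y \in zs -> [/\ ~ hub e y, y \notin A, y \notin B, touch e A y & touch e B y]) ->
  size zs < two_sides_bound.
Proof.
move=> cA cB AB uz st hz; rewrite ltnNge; apply/negP; rewrite /two_sides_bound.
set M := _ + _; set M1 := side_bound M => big.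
have [lt1 lt2 lt3] : [/\ 2 ^ (3 + 3) <= M, pendant_path_bound <= M &
    ram3 (pendant_bound t k + pendant_bound t k) <= M].
  by rewrite /M; split; [rewrite -addnA leq_addr | rewrite addnAC leq_addl | rewrite leq_addl].
have BA : anticomplete e B A by rewrite anticomplete_sym.
have att1 y : y \in zs -> touch e A y /\ touch e B y by move=> /hz[].
have nA y : y \in zs -> y \notin A by move=> /hz[].
have contra_size (r : seq V) n : size r = M -> n <= M -> size r < n -> False.
  by move=> -> le lt; have := leq_trans lt le; rewrite ltnn.
case: (attach_side gsym girr notheta cA cB AB uz st nA att1 big).
  move=> [X [zs1 [XA cX [uz1 sub1] sz1 pX]]].
  have att2 y : y \in zs1 -> touch e B y /\ touch e A y by move=> /sub1/hz[].
  have nB y : y \in zs1 -> y \notin B by move=> /sub1/hz[].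
  have st1 := stable_sub sub1 st.
  have XB : anticomplete e X B by apply: anticompleteS AB.
  have nX y : y \in zs1 -> y \notin X by move=> /sub1/nA; apply: contra; apply: (subsetP XA).
  case: (attach_side gsym girr notheta cB cA BA uz1 st1 nB att2 (eq_leq (esym sz1))).
    move=> [X' [zs2 [XB' cX' [uz2 sub2] sz2 pX']]].
    apply: (contra_size zs2 _ sz2 lt3).
    apply: (two_pendant_sides gsym girr notheta noprism small_clique nopyramid cX cX') => //.
    - exact: anticompleteS XB.
    - exact: stable_sub st1.
    move=> y yz; split; [exact/nX/sub2 | | exact/pX/sub2 | exact: pX'].
    by apply: contra (nB y (sub2 y yz)); apply: (subsetP XB').
  move=> [p [zs2 [[ipp pB] [uz2 sub2] sz2 pw two]]].
  apply: (contra_size zs2 _ sz2 lt2).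
  apply: (pendant_path cX cB XB ipp pB uz2 (stable_sub sub2 st1) pw).
  move=> y yz; have yz1 := sub2 y yz; have [? _ ? _ _] := hz y (sub1 y yz1).
  by split=> //; [apply: nX | apply: pX | apply: two].
move=> [p [zs1 [[ipp pA] [uz1 sub1] sz1 pw two]]].
have att2 y : y \in zs1 -> touch e B y /\ touch e A y by move=> /sub1/hz[].
have nB y : y \in zs1 -> y \notin B by move=> /sub1/hz[].
have st1 := stable_sub sub1 st.
case: (attach_side gsym girr notheta cB cA BA uz1 st1 nB att2 (eq_leq (esym sz1))).
  move=> [X' [zs2 [XB' cX' [uz2 sub2] sz2 pX']]].
  pose zs3 := filter (mem zs2) zs1.
  have sz3 : size zs3 = M by rewrite size_filter_mem.
  have sub3 y : y \in zs3 -> y \in zs1 /\ y \in zs2 by rewrite mem_filter => /andP[].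
  apply: (contra_size zs3 _ sz3 lt2).
  have X'A : anticomplete e X' A by apply: anticompleteS BA.
  apply: (pendant_path cX' cA X'A ipp pA) => //.
  - by rewrite filter_uniq.
  - by apply: stable_sub st1 => y /sub3[].
  - exact: subseq_pairwise (filter_subseq _ _) pw.
  move=> y /sub3[y1 y2]; have [? ? _ _ _] := hz y (sub1 y y1).
  split=> //; [|exact: pX'|exact: two].
  by apply: contra (nB y y1); apply: (subsetP XB').
move=> [p' [zs2 [[ipp' pB] [uz2 sub2] sz2 pw' two']]].
pose zs3 := filter (mem zs2) zs1.
have sz3 : size zs3 = M by rewrite size_filter_mem.
have sub3 y : y \in zs3 -> y \in zs1 /\ y \in zs2 by rewrite mem_filter => /andP[].
apply: (contra_size zs3 _ sz3 lt1).
apply: (two_paths AB ipp pA ipp' pB) pw' _ _ => //.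
- by rewrite filter_uniq.
- by apply: stable_sub st1 => y /sub3[].
- exact: subseq_pairwise (filter_subseq _ _) pw.
- by move=> y /sub3[].
move=> y /sub3[y1 y2]; have [? ? ? _ _] := hz y (sub1 y y1).
by split=> //; [apply: two | apply: two'].
Qed.

End TwoAttachments.

(** * Cliques of minimal chordal completions *)

Section MinimalCompletion.
Variables (V : finType) (e f : rel V).
Hypotheses (gsym : symmetric e) (minf : minimal_chordal_completion e f).
Implicit Types (D H K S : {set V}) (u v w x y : V).

Lemma clique_edge K x y : clique f K -> x \in K -> y \in K -> x != y -> f x y.
Proof. by move=> /forall_inP cK xK yK; have /forall_inP/(_ y yK)/implyP := cK x xK; apply. Qed.

Lemma eq_in_hole (g : rel V) H : hole g H ->
  (forall x y, x \in H -> y \in H -> f x y = g x y) -> hole f H.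
Proof.
case=> c [-> szc uc hc] fg; exists c; split=> // x y xc yc.
by rewrite fg ?inE // hc.
Qed.

(* Deleting from [f] all edges that skip the clique of neighbors of [D] keeps it chordal:
   both arcs of a hole crossing from one side to the other would meet that clique. *)
Lemma no_skipping_edge D K u v : clique f K ->
  (forall a b, a \in D -> b \notin D -> e a b -> b \in K) ->
  u \in D -> v \notin D -> ~~ touch e D v -> f u v = false.
Proof.
move=> cK clD uD vD ntv; have [[[fsym firr] ef chf] minim] := minf.
pose R := [set w | (w \notin D) && ~~ touch e D w].
pose g := [rel a b | f a b && ~~ ((a \in D) && (b \in R) || (a \in R) && (b \in D))].
have gsymg : symmetric g.
  by move=> a b; rewrite /g /= fsym [(a \in D) && _]andbC [(a \in R) && _]andbC orbC.
have girrg : irreflexive g by move=> a; rewrite /g /= firr.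
have gDR a b : a \in D -> b \in R -> g a b = false by move=> aD bR; rewrite /g /= aD bR andbF.
have cg : chordal_completion e g.
  split; first by split.
    move=> a b ab; rewrite /g /= ef //=; apply/negP => /orP[]/andP[].
      move=> aD; rewrite inE => /andP[_ /negP]; apply; apply/touchP; exists a => //.
      by rewrite gsym.
    by rewrite inE => /andP[_ /negP nt] bD; apply: nt; apply/touchP; exists b.
  move=> H hH.
  have [/exists_inP[h hHh hD]|/exists_inPn nD] := boolP [exists h in H, h \in D]; last first.
    apply: (chf H); apply: eq_in_hole hH _ => x y xH yH.
    by rewrite /g /= (negbTE (nD x xH)) (negbTE (nD y yH)) andbF andbT.
  have [/exists_inP[h' hHh' hR]|/exists_inPn nR] := boolP [exists h in H, h \in R]; last first.
    apply: (chf H); apply: eq_in_hole hH _ => x y xH yH.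
    by rewrite /g /= (negbTE (nR x xH)) (negbTE (nR y yH)) andbF andbT.
  have hh' : h != h' by apply: contraTneq hD => ->; move: hR; rewrite inE => /andP[].
  have [S1 [S2 [[c1 c2] /anticompleteP anti [t1 t1' t2 t2'] [n1 n1' n2 n2'] _]]] :=
    hole_arcs gsymg girrg hH hHh hHh' hh' (negbT (gDR h h' hD hR)).
  have meets S : conn g S -> touch g S h -> touch g S h' -> exists2 b, b \in S & (b \notin D) && touch e D b.
    move=> cS th th'; have cT : conn g (h' |: (h |: S)).
      apply: connU1 => //; first exact: connU1.
      by apply: touchS th'; apply: subsetUr.
    have h'D : h' \notin D by move: hR; rewrite inE => /andP[].
    have [||a [b [aD _ bT bD ab]]] := conn_leave cT hD _ _ h'D; rewrite ?inE ?eqxx ?orbT //.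
    have bR : b \notin R by apply/negP => bR; move: ab; rewrite [X in is_true X](gDR a b aD bR).
    have tb : touch e D b by move: bR; rewrite inE bD negbK.
    exists b; last by rewrite bD.
    move: bT; rewrite !inE => /or3P[/eqP bh|/eqP bh|//].
      by move: bR; rewrite bh hR.
    by move: bD; rewrite bh hD.
  have [b1 b1S /andP[b1D tb1]] := meets S1 c1 t1 t1'.
  have [b2 b2S /andP[b2D tb2]] := meets S2 c2 t2 t2'.
  have inK b : b \notin D -> touch e D b -> b \in K.
    by move=> bD /touchP[a aD ba]; apply: (clD a) => //; rewrite gsym.
  have [b12] := anti b1 b2 b1S b2S.
  rewrite /g /= (clique_edge cK (inK _ b1D tb1) (inK _ b2D tb2) b12).
  by rewrite !inE (negbTE b1D) (negbTE b2D) !andbF.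
have vR : v \in R by rewrite inE vD.
have sgf : subrel g f by move=> a b /andP[].
by apply/negP => uv; have := minim g cg sgf u v uv; rewrite [X in is_true X](gDR u v uD vR).
Qed.

(** By minimality, deleting the edge [x y] from [f] creates a hole through [x] and [y]. Only one of
    its two arcs can meet the clique [K]; the other stays in a single component outside [K]. *)
Lemma component_link K x y : clique f K -> x \in K -> y \in K -> x != y -> ~~ e x y ->
  exists u, [/\ u \notin K, touch e (component e (~: K) u) x & touch e (component e (~: K) u) y].
Proof.
move=> cK xK yK xy nxy; have [[[fsym firr] ef chf] minim] := minf.
pose g := [rel a b | f a b && ~~ ((a == x) && (b == y) || (a == y) && (b == x))].
have gsymg : symmetric g.
  by move=> a b; rewrite /g /= fsym [(a == x) && _]andbC [(a == y) && _]andbC orbC.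
have girrg : irreflexive g by move=> a; rewrite /g /= firr.
have [H hH] : exists H, hole g H.
  apply: contrapT => nohole; have cg : chordal_completion e g.
    split; [by split| |by move=> H hH; apply: nohole; exists H].
    move=> a b ab; rewrite /g /= ef //=; apply/negP => /orP[]/andP[/eqP ax /eqP byy].
      by rewrite -ax -byy ab in nxy.
    by rewrite -ax -byy gsym ab in nxy.
  have := minim g cg _ x y (clique_edge cK xK yK xy).
  by rewrite /g /= !eqxx andbF => h; have /h : subrel g f by move=> a b /andP[].
have gxy : g x y = false by rewrite /g /= !eqxx andbF.
have [xH yH] : x \in H /\ y \in H.
  apply: contrapT => nH; apply: (chf H); apply: eq_in_hole hH _ => a b aH bH.
  rewrite /g /=; suff -> : (a == x) && (b == y) || (a == y) && (b == x) = false by rewrite andbT.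
  by apply/negP => /orP[]/andP[/eqP ax /eqP byy]; apply: nH; rewrite -ax -byy.
have [S1 [S2 [[c1 c2] /anticompleteP anti [t1 t1' t2 t2'] [n1 n1' n2 n2'] _]]] :=
  hole_arcs gsymg girrg hH xH yH xy (negbT gxy).
have [S [cS tx ty dSK]] : exists S, [/\ conn g S, touch g S x, touch g S y & [disjoint S & K]].
  have [d1|] := boolP [disjoint S1 & K]; first by exists S1.
  rewrite -setI_eq0 => /set0Pn[a /setIP[aS1 aK]].
  exists S2; split=> //; rewrite -setI_eq0; apply/eqP/setP => b; rewrite in_set0.
  apply/negP => /setIP[bS2 bK].
  have [ab] := anti a b aS1 bS2; rewrite /g /= (clique_edge cK aK bK ab) /=.
  have -> : (a == x) = false by apply: contraNF n1 => /eqP<-.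
  by have -> : (a == y) = false by apply: contraNF n1' => /eqP<-.
have /touchP[s sS xs] := tx.
have sK w : w \in S -> w \in ~: K by move=> wS; rewrite inE (disjointFr dSK).
set D := component e (~: K) s.
have clD a b : a \in D -> b \notin D -> e a b -> b \in K.
  move=> aD bD ab; apply: contraR bD => bK.
  by apply: component_closed aD _ ab; [apply: sK | rewrite inE].
(* The arc consists of edges of [f], possibly absent from [e]; [no_skipping_edge] prevents them from
   leaving the component. *)
have SD : S \subset D.
  apply: (conn_closed (x := s) cS) => //; first exact: component_self.
  move=> a b aD _ bS /andP[ab _]; apply: contraT => bD.
  have ntb : ~~ touch e D b.
    apply: contra bD => /touchP[c cD bc]; apply: component_closed cD _ _; rewrite ?sK //.
    by rewrite gsym.
  by rewrite (no_skipping_edge cK clD aD bD ntb) in ab.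
have tch z : z \in K -> touch g S z -> touch e D z.
  move=> zK /touchP[c cS' /andP[zc _]]; apply: contraT => ntz.
  have zD : z \notin D.
    by apply/negP => /(subsetP (component_sub e (sK s sS))); rewrite inE zK.
  by rewrite fsym (no_skipping_edge cK clD (subsetP SD c cS') zD ntz) in zc.
by exists s; split; [have := sK s sS; rewrite inE | apply: tch | apply: tch].
Qed.

(** If the component touched all of [K], choose in it [d] with the most [f]-neighbors in [K]. By
    maximality of [K] some [k] in [K] is missed by [d]. Moving away from [d] among vertices missing
    [k], one meets a neighbor [d'] of [k], which by the choice of [d] misses some neighbor [j] of
    [d] in [K]. Then [j] and [d'] are joined both by [k] and by the vertices passed, against
    chordality. *)
Lemma component_misses K u : maxset (clique f) K -> u \notin K ->
  exists2 w, w \in K & ~~ touch e (component e (~: K) u) w.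
Proof.
move=> /maxsetP[cK maxK] uK; have [[[fsym firr] ef chf] minim] := minf.
set D := component e (~: K) u.
have uK' : u \in ~: K by rewrite inE.
have sD v : v \in D -> v \notin K by move=> /(subsetP (component_sub e uK')); rewrite inE.
apply: contrapT => no.
have tD w : w \in K -> touch e D w.
  by move=> wK; apply: contrapT => /negP nt; apply: no; exists w.
have cD : conn f D.
  move=> a b aD bD; have := component_conn gsym uK' aD bD.
  by apply: connect_sub => x y /and3P[xy xD yD]; apply: connect1; rewrite /induced /= ef ?xD.
have [d dD maxd] : exists2 d, d \in D & forall d', d' \in D -> #|nbh f d' :&: K| <= #|nbh f d :&: K|.
  case: (@arg_maxnP _ u (mem D) (fun d => #|nbh f d :&: K|) (component_self e _ u)) => d dD maxd.
  by exists d.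
have [/subsetP sub|/subsetPn[k kK]] := boolP (K \subset nbh f d).
  have cdK : clique f (d |: K).
    apply/forall_inP => a aK; apply/forall_inP => b bK; apply/implyP => ab.
    move: aK bK ab; rewrite !inE => /predU1P[->|aK] /predU1P[->|bK]; rewrite ?eqxx // => ab.
    - by have := sub b bK; rewrite inE.
    - by have := sub a aK; rewrite inE fsym.
    exact: clique_edge cK aK bK ab.
  have := maxK _ cdK (subsetUr _ _) => /setP/(_ d).
  by rewrite !inE eqxx (negbTE (sD d dD)).
rewrite inE => ndk; have kD : k \notin D by apply: contraL kK => /sD.
pose N := D :\: [set x | f k x]; have dN : d \in N by rewrite in_setD in_set fsym ndk.
set C := component f N d.
have sC v : v \in C -> v \in D /\ f k v = false.
  by move=> /(subsetP (component_sub f dN)); rewrite in_setD in_set => /andP[/negbTE-> ->].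
have /touchP[d0 d0D kd0] := tD k kK.
have d0C : d0 \notin C by apply/negP => /sC[_]; rewrite ef.
have [a [d' [aC _ d'D d'C ad']]] := conn_leave cD (component_self f N d) dD d0D d0C.
have kd' : f k d'.
  apply: contraNT d'C => nkd'; apply: component_closed dN aC _ ad'.
  by rewrite in_setD in_set nkd'.
have [j jK /andP[dj nd'j]] : exists2 j, j \in K & f d j && ~~ f d' j.
  apply: contrapT => nj; have : nbh f d :&: K \proper nbh f d' :&: K.
    apply/properP; split.
      apply/subsetP => j; rewrite !inE => /andP[dj jK]; rewrite jK andbT.
      by apply: contrapT => /negP nd'j; apply: nj; exists j; rewrite // dj.
    by exists k; rewrite !inE ?kK ?andbT // fsym.
  by move/proper_card; rewrite ltnNge maxd.
have jk : j != k by apply: contraNneq ndk => <-.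
apply: (chordal_no_two_arcs fsym firr (a := j) (b := d') (S1 := [set k]) (S2 := C) chf) => //.
- exact: conn1.
- exact: component_conn.
- by apply: contraTneq jK => ->; apply: sD.
- by rewrite fsym.
- by rewrite inE.
- by rewrite inE; apply: contraTneq d'D => ->.
- by apply/negP => /sC[/sD]; rewrite jK.
- by rewrite touch1; apply: (clique_edge cK).
- by rewrite touch1 fsym.
- by apply/touchP; exists d; rewrite ?component_self // fsym.
- by apply/touchP; exists a; rewrite // fsym.
apply/anticompleteP => x v /set1P-> vC; have [vD ->] := sC v vC.
by split=> //; apply: contraNneq kD => ->.
Qed.

End MinimalCompletion.

(** * Stable sets of non-hubs in a potential maximal clique *)

Section PMCBound.
Variables (V : finType) (e f : rel V) (K Y : {set V}) (t k : nat).
Hypotheses (gsym : symmetric e) (girr : irreflexive e).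
Hypotheses (minf : minimal_chordal_completion e f) (maxK : maxset (clique f) K).
Hypothesis notheta : forall S, ~ theta e S.
Hypothesis noprism : forall S, ~ prism e S.
Hypothesis small_clique : forall C : {set V}, clique e C -> #|C| < t.
Hypothesis nopyramid : forall S, ~ generalized_pyramid e k S.
Hypotheses (YK : Y \subset K) (nonhub : forall y, y \in Y -> ~ hub e y) (stY : stable e Y).
Implicit Types (u v w x y z : V).

Let D u := component e (~: K) u.
Let T := two_sides_bound t k.

Lemma stable_pair y y' : y \in Y -> y' \in Y -> ~~ e y y'.
Proof. by move=> yY y'Y; have /forall_inP/(_ y yY)/forall_inP/(_ y' y'Y) := stY. Qed.

Lemma components_anticomplete u v : u \notin K -> v \notin K -> D u != D v ->
  anticomplete e (D u) (D v).
Proof.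
move=> uK vK nD; have [uK' vK'] : u \in ~: K /\ v \in ~: K by rewrite !inE.
apply/anticompleteP => a b aD bD.
have neq c : c \in D u -> c \in D v -> False.
  move=> cu cv; case/eqP: nD; rewrite /D -(component_eq gsym cu).
  exact: component_eq.
split; first by apply/negP => /eqP ab; apply: (neq a); rewrite // ab.
apply/negP => ab; apply: (neq b) => //; apply: component_closed aD _ ab => //.
exact: (subsetP (component_sub e vK')).
Qed.

Lemma component_terminals u : u \notin K -> #|[set y in Y | touch e (D u) y]| < T.
Proof.
move=> uK; have uK' : u \in ~: K by rewrite inE.
have [cK _] := maxsetP maxK.
have [w wK ntw] := component_misses gsym minf maxK uK.
(* Components are described by their vertices: [B] is the union of [w] and of the components
   attached to it, [w] itself not touching [D u]. *)
pose B := [set x | (x == w) || [&& x \notin K, touch e (D x) w & D x != D u]].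
have DB x : x \in B -> x != w -> D x \subset B.
  rewrite inE => /predU1P[->|/and3P[xK tx nx] _]; first by rewrite eqxx.
  have xK' : x \in ~: K by rewrite inE.
  apply/subsetP => z zD; have zK := subsetP (component_sub e xK') z zD.
  rewrite inE /D (component_eq gsym zD) -/(D x) tx nx; rewrite inE in zK.
  by rewrite zK orbT.
have cB : conn e B.
  apply: (conn_root gsym (r := w)); first by rewrite inE eqxx.
  move=> x xB; have [->|xw] := eqVneq x w; first exact: connect0.
  have := xB; rewrite inE (negbTE xw) => /and3P[xK tx nx].
  apply: (@connect_mono _ e (w |: D x)).
    by rewrite subUset sub1set DB // andbT inE eqxx.
  have cwD : conn e (w |: D x) by apply: connU1 => //; apply: component_conn; rewrite ?inE.
  by apply: cwD; rewrite !inE ?eqxx // connect0 orbT.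
have anti : anticomplete e (D u) B.
  apply/anticompleteP => a b aD; rewrite inE => /predU1P[->|/and3P[bK tb nb]].
    split.
      by apply: contraTneq wK => <-; have := subsetP (component_sub e uK') a aD; rewrite inE.
    by apply: contraNF ntw => aw; apply/touchP; exists a; rewrite // gsym.
  have := components_anticomplete uK bK; rewrite eq_sym => /(_ nb)/anticompleteP; apply=> //.
  exact: component_self.
have -> : #|[set y in Y | touch e (D u) y]| = size (enum [set y in Y | touch e (D u) y]) by rewrite cardE.
apply: (two_sides gsym girr notheta noprism small_clique nopyramid (component_conn gsym uK') cB anti).
- exact: enum_uniq.
- apply/forall_inP => y; rewrite inE mem_enum inE => /andP[yY _].
  by apply/forall_inP => y'; rewrite inE mem_enum inE => /andP[y'Y _]; apply: stable_pair.
move=> y; rewrite mem_enum inE => /andP[yY ty]; have yK := subsetP YK y yY.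
have yw : y != w by apply: contraTneq ty => ->.
split=> //; first exact: nonhub.
- by apply/negP => /(subsetP (component_sub e uK')); rewrite inE yK.
- by rewrite inE (negbTE yw) yK.
have [eyw|nyw] := boolP (e y w); first by apply/touchP; exists w; rewrite // inE eqxx.
(* This component touches [w], hence differs from [D u] and lies in [B]. *)
have [u' [u'K ty' tw]] := component_link gsym minf cK yK wK yw nyw.
apply: touchS ty'; apply: DB.
  rewrite inE u'K tw /=; apply/orP; right; apply/eqP => eqD.
  by rewrite -/(D u') eqD (negbTE ntw) in tw.
by apply: contraNneq u'K => ->.
Qed.

Definition common y y' z := [exists u in ~: K, [&& touch e (D u) y, touch e (D u) y' & touch e (D u) z]].

(** Three components attached to both [y] and [y'] would form a theta. So there are at most two,
    each touching fewer than [T] elements of [Y]. *)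
Lemma common_bound y y' : y \in Y -> y' \in Y -> y != y' ->
  #|[set z in Y | common y y' z]| <= T + T.
Proof.
move=> yY y'Y yy'; have [cK _] := maxsetP maxK.
have [u1 [u1K t1 t1']] := component_link gsym minf cK (subsetP YK y yY) (subsetP YK y' y'Y) yy' (stable_pair yY y'Y).
have cD u : u \notin K -> conn e (D u) by move=> uK; apply: component_conn; rewrite ?inE.
have [u2 u2K only] : exists2 u2, u2 \notin K & forall u, u \notin K ->
    touch e (D u) y -> touch e (D u) y' -> D u = D u1 \/ D u = D u2.
  have [/existsP[u2 /and4P[u2K n21 t2 t2']]|/existsPn no] :=
    boolP [exists u, [&& u \notin K, D u != D u1, touch e (D u) y & touch e (D u) y']].
    exists u2 => // u uK tu tu'; have [->|n1] := eqVneq (D u) (D u1); first by left.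
    have [->|n2] := eqVneq (D u) (D u2); first by right.
    have [S /notheta//] := theta_sets gsym girr (cD u uK) (cD u1 u1K) (cD u2 u2K) yy'
      (stable_pair yY y'Y) tu tu' t1 t1' t2 t2' (components_anticomplete uK u1K n1)
      (components_anticomplete uK u2K n2)
      (components_anticomplete u1K u2K (eq_ind_r (fun b => is_true (~~ b)) n21 (eq_sym _ _))).
  exists u1 => // u uK tu tu'; left; have := no u; rewrite uK tu tu' !andbT /= negbK.
  by move/eqP.
have sub : [set z in Y | common y y' z] \subset
    [set z in Y | touch e (D u1) z] :|: [set z in Y | touch e (D u2) z].
  apply/subsetP => z; rewrite inE => /andP[zY /exists_inP[u]].
  rewrite inE => uK /and3P[tu tu' tz].
  by rewrite !inE zY /=; case: (only u uK tu tu') => <-; rewrite tz ?orbT.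
apply: leq_trans (subset_leq_card sub) _; rewrite cardsU.
apply: leq_trans (leq_subr _ _) _; apply: leq_add; apply: ltnW; exact: component_terminals.
Qed.

Lemma PMC_stable_bound : #|Y| <= 4 * (T + T).
Proof.
rewrite leqNgt; apply/negP => big; have [cK _] := maxsetP maxK.
have pick (A : {set V}) : #|A| < #|Y| -> exists2 y, y \in Y & y \notin A.
  move=> lt; apply/subsetPn; apply: contraL lt => /subset_leq_card; by rewrite -leqNgt.
have [y1 y1Y _] := pick set0 (leq_ltn_trans (eq_leq (cards0 _)) (leq_ltn_trans (leq0n _) big)).
have T0 : 0 < T by rewrite /T /two_sides_bound /side_bound.
have [|y2 y2Y y21] := pick [set y1].
  by rewrite cards1; apply: leq_ltn_trans big; move: T0; clear; lia.
rewrite inE in y21; have n12 : y1 != y2 by rewrite eq_sym.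
pose C y y' := [set z in Y | common y y' z].
have inC y y' : y \in Y -> y' \in Y -> y != y' -> y \in C y y' /\ y' \in C y y'.
  move=> yY y'Y yy'; have [u [uK ty ty']] :=
    component_link gsym minf cK (subsetP YK y yY) (subsetP YK y' y'Y) yy' (stable_pair yY y'Y).
  have uK' : u \in ~: K by rewrite inE.
  by rewrite !inE yY y'Y; split; apply/exists_inP; exists u; rewrite // /D ty ty'.
have b12 := common_bound y1Y y2Y n12.
have [|y3 y3Y y3C] := pick (C y1 y2).
  by apply: leq_ltn_trans b12 (leq_ltn_trans _ big); clear; lia.
have [i1 i2] := inC _ _ y1Y y2Y n12.
have n13 : y1 != y3 by apply: contraNneq y3C => <-.
have n23 : y2 != y3 by apply: contraNneq y3C => <-.
have b13 := common_bound y1Y y3Y n13; have b23 := common_bound y2Y y3Y n23.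
have [i1' i3] := inC _ _ y1Y y3Y n13.
(* Three sets of at most [T + T] elements do not cover [Y], so no component is attached to [y4] and
   two of the other vertices. *)
have [|y4 y4Y] := pick (C y1 y2 :|: C y1 y3 :|: C y2 y3).
  apply: leq_ltn_trans big; rewrite !cardsU.
  apply: leq_trans (leq_subr _ _) _; apply: (@leq_trans (T + T + (T + T) + (T + T))).
    by apply: leq_add b23; apply: leq_trans (leq_subr _ _) _; apply: leq_add.
  by clear; lia.
rewrite !in_setU !negb_or => /andP[/andP[c12 c13] c23].
have n14 : y1 != y4 by apply: contraNneq c12 => <-.
have n24 : y2 != y4 by apply: contraNneq c12 => <-.
have n34 : y3 != y4 by apply: contraNneq c13 => <-.
have link y y' : y \in Y -> y' \in Y -> y != y' ->
    exists u, [/\ u \notin K, touch e (D u) y & touch e (D u) y'].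
  move=> yY y'Y yy'.
  exact: (component_link gsym minf cK (subsetP YK y yY) (subsetP YK y' y'Y) yy' (stable_pair yY y'Y)).
have nc y y' z : z \in Y -> z \notin C y y' -> forall u, u \notin K ->
    touch e (D u) y -> touch e (D u) y' -> touch e (D u) z = false.
  move=> zY; rewrite inE zY => nC u uK ty ty'; apply: contraNF nC => tz.
  by apply/exists_inP; exists u; rewrite ?inE // ty ty' tz.
have no3 := nc y1 y2 y3 y3Y y3C; have no124 := nc y1 y2 y4 y4Y c12.
have no134 := nc y1 y3 y4 y4Y c13; have no234 := nc y2 y3 y4 y4Y c23.
have [u14 [K14 p1 p4]] := link _ _ y1Y y4Y n14.
have [u12 [K12 q1 q2]] := link _ _ y1Y y2Y n12.
have [u24 [K24 r2 r4]] := link _ _ y2Y y4Y n24.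
have [u13 [K13 s1 s3]] := link _ _ y1Y y3Y n13.
have [u34 [K34 t3 t4]] := link _ _ y3Y y4Y n34.
have cD u : u \notin K -> conn e (D u) by move=> uK; apply: component_conn; rewrite ?inE.
have dif u u' y : touch e (D u) y -> touch e (D u') y = false -> D u != D u'.
  by move=> ty nty; apply: contraTneq ty => ->; rewrite nty.
have ac u u' y : u \notin K -> u' \notin K -> touch e (D u) y -> touch e (D u') y = false ->
    anticomplete e (D u) (D u').
  by move=> uK u'K ty nty; apply: components_anticomplete => //; apply: dif ty nty.
have acy u y : u \notin K -> y \in Y -> touch e (D u) y = false ->
    anticomplete e (D u) [set y] /\ anticomplete e [set y] (D u).
  move=> uK yY nty; have a1 : anticomplete e [set y] (D u).
    apply/anticompleteP => a b /set1P-> bD; split.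
      apply: contraTneq bD => <-; apply/negP => yD; have uK' : u \in ~: K by rewrite inE.
      by have := subsetP (component_sub e uK') y yD; rewrite inE (subsetP YK).
    by apply: contraFF nty => yb; apply/touchP; exists b.
  by split=> //; rewrite anticomplete_sym.
have falseI (b : bool) : (b -> False) -> b = false by case: b => // h; case: (h isT).
have f12 : touch e (D u14) y2 = false by apply: falseI => h; move: (no124 u14 K14 p1 h); rewrite p4.
have f13 : touch e (D u14) y3 = false by apply: falseI => h; move: (no134 u14 K14 p1 h); rewrite p4.
have f123 := no3 u12 K12 q1 q2; have f124 := no124 u12 K12 q1 q2.
have f241 : touch e (D u24) y1 = false by apply: falseI => h; move: (no124 u24 K24 h r2); rewrite r4.
have f243 : touch e (D u24) y3 = false by apply: falseI => h; move: (no234 u24 K24 r2 h); rewrite r4.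
have f132 : touch e (D u13) y2 = false by apply: falseI => h; move: (no3 u13 K13 s1 h); rewrite s3.
have f134 := no134 u13 K13 s1 s3.
have f341 : touch e (D u34) y1 = false by apply: falseI => h; move: (no134 u34 K34 h t3); rewrite t4.
have f342 : touch e (D u34) y2 = false by apply: falseI => h; move: (no234 u34 K34 h t3); rewrite t4.
(* The theta has ends [y1] and [y4]: one path crosses their common component, the others pass
   through [y2] and [y3]. The components used for different paths are distinct because none touches
   three of the four vertices. *)
pose S2 := (y2 |: D u12) :|: D u24; pose S3 := (y3 |: D u13) :|: D u34.
have cS2 : conn e S2.
  by apply: (connU_touch gsym (x := y2)) => //; rewrite ?inE ?eqxx //; [apply: connU1 => //|]; apply: cD.
have cS3 : conn e S3.
  by apply: (connU_touch gsym (x := y3)) => //; rewrite ?inE ?eqxx //; [apply: connU1 => //|]; apply: cD.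
have y23 : anticomplete e [set y2] [set y3].
  by apply/anticompleteP => a b /set1P-> /set1P->; rewrite (negbTE (stable_pair y2Y y3Y)).
have [S /notheta//] : exists S, theta e S.
apply: (theta_sets gsym girr (cD u14 K14) cS2 cS3 n14 (stable_pair y1Y y4Y) p1 p4).
- by rewrite !touchU q1 orbT.
- by rewrite !touchU r4 orbT.
- by rewrite !touchU s1 orbT.
- by rewrite !touchU t4 orbT.
- rewrite !(anticompleteUr gsym) (acy u14 y2 K14 y2Y f12).1.
  by rewrite anticomplete_sym // (ac u12 u14 y2) //= anticomplete_sym // (ac u24 u14 y2).
- rewrite !(anticompleteUr gsym) (acy u14 y3 K14 y3Y f13).1.
  by rewrite anticomplete_sym // (ac u13 u14 y3) //= anticomplete_sym // (ac u34 u14 y3).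
rewrite !(anticompleteUr gsym) !anticompleteUl y23.
rewrite (acy u12 y3 K12 y3Y f123).1 (acy u24 y3 K24 y3Y f243).1.
rewrite (acy u13 y2 K13 y2Y f132).2 (acy u34 y2 K34 y2Y f342).2.
by rewrite (ac u12 u13 y2) // (ac u24 u13 y2) // (ac u12 u34 y2) // (ac u24 u34 y2).
Qed.

End PMCBound.

Theorem theorem6p3 :
  forall t : nat, exists tau : nat,
  forall (V : finType) (e : rel V), simple_graph e -> class_Ctt t e ->
  forall (T : finType) (f : rel T) (chi : T -> {set V}),
    tree_decomposition e f chi -> structured e chi ->
  forall (v : T) (Y : {set V}),
    Y \subset chi v -> (forall y, y \in Y -> ~ hub e y) -> stable e Y ->
    #|Y| <= 4 * tau.
Proof.
(* The parameter [t] is used twice: as clique bound and as the number of paths R_i of the excluded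
   pyramid. *)
move=> t; exists (two_sides_bound t t + two_sides_bound t t).
move=> V e [gsym girr] [[[_ notheta noprism _] noclique] nopyramid] T f chi _ strc v Y Ychi nonhub stY.
have [g [ming maxg]] := strc v.
(* The class excludes cliques of size exactly [t]; a larger clique contains one. *)
have small (K : {set V}) : clique e K -> #|K| < t.
  move=> cK; rewrite ltnNge; apply/negP => tK.
  apply: (noclique [set x in take t (enum K)]).
    apply/forall_inP => x; rewrite inE => /mem_take; rewrite mem_enum => xK.
    apply/forall_inP => y; rewrite inE => /mem_take; rewrite mem_enum => yK.
    by have /forall_inP/(_ x xK)/forall_inP/(_ y yK) := cK.
  rewrite cardsE; have /card_uniqP -> : uniq (take t (enum K)) by rewrite take_uniq ?enum_uniq.
  by rewrite size_takel // -cardE.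
exact: (PMC_stable_bound gsym girr ming maxg notheta noprism small nopyramid Ychi nonhub stY).
Qed.
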